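(* Let $\mathbb{D}=\{z\in\mathbb{C}:|z|<1\}$ and let $f=h+\overline{g}$ be a sense-preserving univalent harmonic mapping of $\mathbb{D}$ with $h(z)=z+\sum_{n=2}^\infty a_nz^n$ and $g(z)=\sum_{n=2}^\infty b_nz^n$ (so $f\in\mathcal{S}^0_H$), which is stable convex, i.e. $h+\mu\overline{g}$ is univalent and convex in $\mathbb{D}$ for every $|\mu|=1$. Let $m\in\mathbb{N}$, $\omega_m\in\mathcal{B}_m$ and $\lambda\in[0,1]$. Then $$\big|(1-\lambda)f(\omega_m(z))+\lambda Df(\omega_m(z))\big|\le d\big(f(0),\partial f(\mathbb{D})\big)\quad\text{and}\quad\big|(1-\lambda)f(\omega_m(z))+\lambda \mathscr{D}f(\omega_m(z))\big|\le d\big(f(0),\partial f(\mathbb{D})\big)$$ both hold for $|z|=r\le r_{6,m}$, where $r_{6,m}$ is the unique root in $(0,1)$ of $$\frac{(1-\lambda)r^m}{1-r^m}+\frac{\lambda r^m}{(1-r^m)^2}-\frac12=0.$$ The radius $r_{6,m}$ is best possible.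
   Context: For $n\in\mathbb{N}$, $\mathcal{B}_n$ denotes the set of analytic functions $\omega:\mathbb{D}\to\mathbb{C}$ with $|\omega(z)|\le1$ in $\mathbb{D}$, $\omega(0)=\omega'(0)=\cdots=\omega^{(n-1)}(0)=0$ and $\omega^{(n)}(0)\neq0$. For a harmonic $f$, $Df=zf_z-\overline{z}f_{\overline{z}}$ and $\mathscr{D}f=zf_z+\overline{z}f_{\overline{z}}$, and $Df(\omega_m(z))$ means $(Df)(\omega_m(z))$ (similarly for $\mathscr{D}$). $d(f(0),\partial f(\mathbb{D}))$ is the Euclidean distance from $f(0)$ to the boundary of $f(\mathbb{D})$. ''Best possible'' means that for every $r>r_{6,m}$ there exist such $f,\omega_m$ and $z$ with $|z|=r$ for which the inequality fails. *)

(* Defs.v *)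
(* Complex numbers: C R := R[i] for R : realType,
   with the normed/topological structure MathComp-Analysis puts on any
   numFieldType; complex derivatives are derive1 / derivable over C. *)
From HB Require Import structures.
From mathcomp Require Import all_boot all_order all_algebra.
From mathcomp Require Import all_classical all_reals all_analysis.
From mathcomp Require Import complex.
Import Order.TTheory GRing.Theory Num.Theory.
Import numFieldNormedType.Exports.
Local Open Scope ring_scope.
Local Open Scope classical_set_scope.

Set Implicit Arguments.
Unset Strict Implicit.
Unset Printing Implicit Defensive.

Definition C (R : realType) : numFieldType := R[i].

Definition RtoC (R : realType) (x : R) : C R := (x%:C)%C.

Definition Disk (R : realType) : set (C R) := [set z | `|z| < 1].

Definition analytic_in_D (R : realType) (f : C R -> C R) : Prop :=
  forall z : C R, `|z| < 1 -> derivable f z 1.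

Definition harm (R : realType) (h g : C R -> C R) : C R -> C R :=
  fun z => h z + Num.conj (g z).

Definition univalent_in_D (R : realType) (F : C R -> C R) : Prop :=
  forall z w : C R, `|z| < 1 -> `|w| < 1 -> F z = F w -> z = w.

Definition convex_set_C (R : realType) (S : set (C R)) : Prop :=
  forall u v : C R, S u -> S v -> forall t : R, 0 <= t <= 1 ->
    S (RtoC (1 - t) * u + RtoC t * v).

(* sense-preserving: Jacobian |h'|^2 - |g'|^2 positive in D *)
Definition sense_preserving (R : realType) (h g : C R -> C R) : Prop :=
  forall z : C R, `|z| < 1 -> `|(derive1 g) z| < `|(derive1 h) z|.

(* f = h + conj g belongs to S_H^0 : sense-preserving univalent harmonic in D,
   h(z) = z + sum_{n>=2} a_n z^n, g(z) = sum_{n>=2} b_n z^n,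
   i.e. h(0)=0, h'(0)=1, g(0)=0, g'(0)=0. *)
Definition in_SH0 (R : realType) (h g : C R -> C R) : Prop :=
  [/\ analytic_in_D h /\ analytic_in_D g,
      h 0 = 0 /\ (derive1 h) 0 = 1, g 0 = 0 /\ (derive1 g) 0 = 0,
      sense_preserving h g & univalent_in_D (harm h g)].

Definition stable_convex (R : realType) (h g : C R -> C R) : Prop :=
  forall mu : C R, `|mu| = 1 ->
    univalent_in_D (fun z => h z + mu * Num.conj (g z)) /\
    convex_set_C ((fun z => h z + mu * Num.conj (g z)) @` @Disk R).

Definition in_B (R : realType) (m : nat) (w : C R -> C R) : Prop :=
  [/\ analytic_in_D w,
      (forall z : C R, `|z| < 1 -> `|w z| <= 1),
      (forall k : nat, (k < m)%N -> derive1n k w 0 = 0)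
    & derive1n m w 0 != 0].

(* D f (z) = z f_z - conj z f_{conj z} = z h'(z) - conj z conj(g'(z)) *)
Definition Dop (R : realType) (h g : C R -> C R) (z : C R) : C R :=
  z * (derive1 h) z - Num.conj z * Num.conj ((derive1 g) z).

(* script D f (z) = z f_z + conj z f_{conj z} *)
Definition Dscr (R : realType) (h g : C R -> C R) (z : C R) : C R :=
  z * (derive1 h) z + Num.conj z * Num.conj ((derive1 g) z).

Definition bdry (R : realType) (S : set (C R)) : set (C R) :=
  closure S `\` interior S.

(* "x <= d(F(0), boundary of F(D))", where d is the Euclidean distance
   inf { |w - F 0| : w in boundary F(D) } (= +oo if the boundary is empty):
   x is below every such distance. *)
Definition le_dist_bdry (R : realType) (x : C R) (F : C R -> C R) : Prop :=
  forall w : C R, bdry (F @` @Disk R) w -> x <= `|w - F 0|.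

Definition r6_fun (R : realType) (lam : R) (m : nat) (r : R) : R :=
  (1 - lam) * r ^+ m / (1 - r ^+ m) + lam * r ^+ m / (1 - r ^+ m) ^+ 2 - 2^-1.

Definition comb_D (R : realType) (lam : R) (h g w : C R -> C R) (z : C R) : C R :=
  RtoC (1 - lam) * harm h g (w z) + RtoC lam * Dop h g (w z).
Definition comb_Dscr (R : realType) (lam : R) (h g w : C R -> C R) (z : C R) : C R :=
  RtoC (1 - lam) * harm h g (w z) + RtoC lam * Dscr h g (w z).

(* Main.v *)
(* Stability means that [h + mu conj g] is univalent with convex image for all
   unimodular [mu]. Shearing along lines transfers this to the analytic functions
   [F = h + eps g]: on a line in the image of [f = h + mu conj g] (with [mu]
   chosen from [eps] and the direction of the line), [F] and [f] differ by a real
   multiple of the direction, and [F o f^-1] is monotone because [|g'| < |h'|].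
   So each [F] is convex univalent with [F 0 = 0] and [F' 0 = 1]. The Schwarz
   lemma applied to [F^-1 ((1 - t) F(x) + t F(c x))] and Harnack's inequality at a
   boundary point give [Re (z F'/F) >= 1/2], hence [|F| <= r/(1-r)] and
   [|F'| <= 1/(1-r)^2] on [|z| = r]. Choosing [eps] suitably these become bounds
   for [|h| + |g|] and [|h'| + |g'|], evaluated at [|w z| <= |z|^m].

   The distance to the boundary is at least 1/2: a half-plane [Re (c W) <= d]
   containing [f(D)] also contains the image of the analytic [c h + conj c g],
   whose derivative at 0 has modulus 1, so [1 <= 2 d].

   Complex analysis rests on the mean value inequality for functions
   that are merely complex differentiable, proved by Goursat's bisection in
   logarithmic polar coordinates. Sharpness is attained by [h z = z/(1-z)],
   [g = 0], [w z = z^m]. *)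
Require Import Defs.
From HB Require Import structures.
From mathcomp Require Import all_boot all_order all_algebra.
From mathcomp Require Import all_classical all_reals all_analysis.
From mathcomp Require Import complex.
From mathcomp Require Import ring lra.
Import Order.TTheory GRing.Theory Num.Theory.
Import numFieldNormedType.Exports.
Local Open Scope ring_scope.
Local Open Scope classical_set_scope.

Set Implicit Arguments.
Unset Strict Implicit.
Unset Printing Implicit Defensive.

(* [`|z|] on [R[i]] takes values in [R[i]]; [N z] is the same modulus as a real. *)
Local Notation N := (@Normc.normc _).
Local Notation Re := (@complex.Re _).
Local Notation Im := (@complex.Im _).
Local Notation "x %:K" := (real_complex _ x) (at level 2, format "x %:K").

(** * Real modulus and complex derivatives on R[i] *)

(** Analyticity is given as mere complex differentiability at every point, so neither power series
    nor continuity of the derivative is at hand. Everything is drawn from [mean_ineq]: the real part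
    at the centre of a disk is at most its bound on a circle. It asks only for continuity at the
    centre, so difference quotients continued by the derivative qualify; the maximum principle, the
    Schwarz lemma with order of vanishing, Cauchy estimates and differentiability of derivatives
    then follow. Stability, rather than convexity of [f] alone, enters because the [mu] that makes
    the shear work depends on the direction of the line. The bound [Re (z F'/F) >= 1/2] is not
    integrated directly: it is sharpened through [z - F/F'], which vanishes to second order at 0,
    into [|z F'| (1 - |z|) <= |F|], the source of both growth and distortion. *)

Section RealNorm.
Variable R : realType.
Implicit Types (z w : R[i]) (x y : R).

Lemma NE z : `|z| = (N z)%:K. Proof. by []. Qed.
Lemma N_ge0 z : 0 <= N z. Proof. by case: z => a b; rewrite sqrtr_ge0. Qed.
Lemma N0 : N (0 : R[i]) = 0. Proof. exact: Normc.normc0. Qed.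
Lemma N1 : N (1 : R[i]) = 1. Proof. exact: Normc.normc1. Qed.
Lemma NM z w : N (z * w) = N z * N w. Proof. exact: Normc.normcM. Qed.
Lemma NN z : N (- z) = N z. Proof. exact: normcN. Qed.
Lemma NB z w : N (z - w) = N (w - z). Proof. by rewrite -NN opprB. Qed.
Lemma ND z w : N (z + w) <= N z + N w. Proof. exact: le_normcD. Qed.
Lemma N_tri z w : N (z - w) <= N z + N w. Proof. by rewrite -(NN w) ND. Qed.
Lemma N_rtri z w : N z - N w <= N (z - w).
Proof. by rewrite lerBlDr (le_trans _ (ND _ _))// subrK. Qed.
Lemma NV z : N z^-1 = (N z)^-1. Proof. exact: Normc.normcV. Qed.
Lemma N_eq0 z : (N z == 0) = (z == 0).
Proof. by apply/eqP/eqP => [/Normc.eq0_normc|->]; rewrite ?N0. Qed.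
Lemma N_gt0 z : (0 < N z) = (z != 0).
Proof. by rewrite lt_def N_ge0 andbT N_eq0. Qed.
Lemma NX z n : N (z ^+ n) = N z ^+ n.
Proof. by elim: n => [|n ih]; rewrite ?expr0 ?N1// !exprS NM ih. Qed.
Lemma Nreal x : N x%:K = `|x|.
Proof. by rewrite /Normc.normc /= expr0n /= addr0 sqrtr_sqr. Qed.
Lemma Npos x : 0 <= x -> N x%:K = x.
Proof. by move=> h; rewrite Nreal ger0_norm. Qed.
Lemma Nconj z : N (conjc z) = N z.
Proof. by case: z => a b; rewrite /Normc.normc /= sqrrN. Qed.
Lemma Nsq z : N z ^+ 2 = Re z ^+ 2 + Im z ^+ 2.
Proof. by case: z => a b; rewrite /= sqr_sqrtr// addr_ge0 ?sqr_ge0. Qed.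
Lemma Nle z y : 0 <= y -> (N z <= y) = (Re z ^+ 2 + Im z ^+ 2 <= y ^+ 2).
Proof. by move=> y0; rewrite -Nsq ler_pXn2r// nnegrE N_ge0. Qed.
Lemma Re_le z : `|Re z| <= N z.
Proof.
by rewrite -(@ler_pXn2r _ 2)// ?nnegrE ?normr_ge0 ?N_ge0// Nsq real_normK ?num_real// lerDl sqr_ge0.
Qed.
Lemma Im_le z : `|Im z| <= N z.
Proof.
by rewrite -(@ler_pXn2r _ 2)// ?nnegrE ?normr_ge0 ?N_ge0// Nsq real_normK ?num_real// lerDr sqr_ge0.
Qed.
Lemma Re_leN z : Re z <= N z. Proof. exact: le_trans (ler_norm _) (Re_le z). Qed.
Lemma N_leD z : N z <= `|Re z| + `|Im z|.
Proof.
rewrite Nle ?addr_ge0// -(real_normK (num_real (Re z))) -(real_normK (num_real (Im z))).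
have := normr_ge0 (Re z); have := normr_ge0 (Im z); nra.
Qed.

Lemma ReD z w : Re (z + w) = Re z + Re w. Proof. by case: z; case: w. Qed.
Lemma ImD z w : Im (z + w) = Im z + Im w. Proof. by case: z; case: w. Qed.
Lemma ReN z : Re (- z) = - Re z. Proof. by case: z. Qed.
Lemma ImN z : Im (- z) = - Im z. Proof. by case: z. Qed.
Lemma ReM z w : Re (z * w) = Re z * Re w - Im z * Im w.
Proof. by case: z; case: w. Qed.
Lemma ImM z w : Im (z * w) = Re z * Im w + Im z * Re w.
Proof. by case: z; case: w. Qed.
Lemma ReJ z : Re (conjc z) = Re z. Proof. by case: z. Qed.
Lemma ImJ z : Im (conjc z) = - Im z. Proof. by case: z. Qed.
Lemma Rek x : Re x%:K = x. Proof. by []. Qed.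
Lemma Imk x : Im x%:K = 0. Proof. by []. Qed.
Definition ReImE := (ReD, ImD, ReN, ImN, ReM, ImM, ReJ, ImJ, Rek, Imk).
Lemma cpx_eq z w : Re z = Re w -> Im z = Im w -> z = w.
Proof. by case: z => a b; case: w => c d /= -> ->. Qed.
Lemma Re_1 : Re (1 : R[i]) = 1. Proof. by []. Qed.
Lemma Im_1 : Im (1 : R[i]) = 0. Proof. by []. Qed.
Lemma Re_0 : Re (0 : R[i]) = 0. Proof. by []. Qed.
Lemma Im_0 : Im (0 : R[i]) = 0. Proof. by []. Qed.

Lemma conjM z w : conjc (z * w) = conjc z * conjc w.
Proof. by apply: cpx_eq; rewrite !ReImE; ring. Qed.
Lemma conjN z : conjc (- z) = - conjc z.
Proof. by apply: cpx_eq; rewrite !ReImE. Qed.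
Lemma conjk x : conjc x%:K = x%:K.
Proof. by apply: cpx_eq; rewrite !ReImE ?oppr0. Qed.

Lemma mul_conj z : z * conjc z = (N z ^+ 2)%:K.
Proof. by rewrite Nsq; apply: cpx_eq; rewrite !ReImE; ring. Qed.

(* Multiplication by [conjc z / N z] rotates [z] onto the positive axis. *)
Lemma unit_dir z : exists c : R[i], N c = 1 /\ c * z = (N z)%:K.
Proof.
have [->|z0] := eqVneq z 0; first by exists 1; rewrite N1 N0 mulr0.
have Nz : N z != 0 by rewrite N_eq0.
exists (conjc z * ((N z)^-1)%:K); split.
  by rewrite NM Nconj Npos ?invr_ge0 ?N_ge0// divff.
rewrite mulrAC [_ * z]mulrC mul_conj -rmorphM; congr (_%:K).
by rewrite expr2 mulfK.
Qed.

Lemma ltC_real x y : ((x%:K : C R) < y%:K) = (x < y). Proof. exact: ltcR. Qed.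
Lemma leC_real x y : ((x%:K : C R) <= y%:K) = (x <= y). Proof. exact: lecR. Qed.
Lemma normC_lt1 z : (`|z : C R| < 1) = (N z < 1).
Proof. by rewrite -(ltC_real (N z) 1). Qed.
Lemma normC_le1 z : (`|z : C R| <= 1) = (N z <= 1).
Proof. by rewrite -(leC_real (N z) 1). Qed.

End RealNorm.

Section Derivative.
Variable R : realType.
Implicit Types (f g : R[i] -> R[i]) (z w k l : R[i]).

(** A quotient-free form of complex differentiability with real errors: [k = 0] needs no separate
    case and most estimates become linear arithmetic. [cderP] ties it to [is_derive]. *)
Definition cder f z l := forall e : R, 0 < e -> exists d : R, 0 < d /\
  forall k, N k < d -> N (f (z + k) - f z - l * k) <= e * N k.

Definition ccont f z := forall e : R, 0 < e -> exists d : R, 0 < d /\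
  forall k, N k < d -> N (f (z + k) - f z) <= e.

Lemma cderP f z l : is_derive (z : C R) (1 : C R) (f : C R -> C R) (l : C R) <-> cder f z l.
Proof.
pose q (h : C R) : C R := h^-1 *: ((f \o shift z) (h *: (1 : C R)) - f z).
have qE : is_derive (z : C R) (1 : C R) (f : C R -> C R) (l : C R) <->
    q h @[h --> (0 : C R)^'] --> (l : C R).
  split=> [[dv <-]|h]; first exact: dv.
  by split; [exact: cvgP h|exact: cvg_lim h].
rewrite qE; split.
- move=> /cvgrPdist_le/= H e e0.
  have /H : (0 : C R) < e%:K by rewrite (ltC_real 0 e).
  rewrite near_withinE => /nbhs_ballP[d /= d0 Hd].
  exists (Re d); split; first by move: d0; rewrite ltcE => /andP[].
  move=> k kd; have [->|k0] := eqVneq k 0.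
    by rewrite addr0 subrr mulr0 subr0 !N0 mulr0.
  have dE : d = (Re d)%:K.
    by move: d0; rewrite ltcE => /andP[/eqP/= h _]; case: (d) h => a b /= ->.
  have /Hd : ball (0 : C R) d k.
    by rewrite -ball_normE /ball_ /= sub0r normrN dE NE ltC_real.
  move=> /(_ k0); rewrite NE leC_real /q /= => hk.
  have -> : f (z + k) - f z - l * k = - ((l - k^-1 * (f (k * 1 + z) - f z)) * k).
    by rewrite mulr1 [k + z]addrC; field.
  by rewrite NN NM ler_wpM2r// N_ge0.
- move=> H; apply/cvgrPdist_le => /= e e0.
  have eE : e = (Re e)%:K.
    by move: e0; rewrite ltcE => /andP[/eqP/= h _]; case: (e) h => a b /= ->.
  have e0' : 0 < Re e by move: e0; rewrite ltcE => /andP[].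
  have [d [d0 Hd]] := H _ e0'.
  rewrite near_withinE; apply/nbhs_ballP; exists d%:K; first by rewrite /= (ltC_real 0 d).
  move=> k; rewrite -ball_normE /ball_ /= sub0r normrN NE ltC_real => kd k0.
  rewrite eE NE leC_real /q /=.
  have Nk : 0 < N k by rewrite N_gt0.
  rewrite -(ler_pM2r Nk) -NM -NN.
  have -> : - ((l - k^-1 * (f (k * 1 + z) - f z)) * k) = f (z + k) - f z - l * k.
    by rewrite mulr1 [k + z]addrC; field.
  exact: Hd.
Qed.

Lemma cder_derivable f z l : cder f z l -> derivable (f : C R -> C R) z 1.
Proof. by move=> /cderP[]. Qed.

Lemma cder_derive1 f z l : cder f z l -> derive1 (f : C R -> C R) z = l.
Proof. by move=> /cderP[_ E]; rewrite -E derive1E. Qed.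

Lemma derivable_cder f z : derivable (f : C R -> C R) z 1 ->
  cder f z (derive1 (f : C R -> C R) z).
Proof.
move=> h.
have E := derive1E (f : C R -> C R) z.
have H : is_derive (z : C R) (1 : C R) (f : C R -> C R) (derive1 (f : C R -> C R) z : C R).
  by apply: DeriveDef; [exact h | exact (esym E)].
case: (cderP f z (derive1 (f : C R -> C R) z)) => H1 _.
exact (H1 H).
Qed.

Lemma cder_cst (c : R[i]) z : cder (fun=> c) z 0.
Proof. exact: (iffLR (cderP _ _ _) (is_derive_cst _ _ _)). Qed.

Lemma cder_id z : cder id z 1.
Proof. exact: (iffLR (cderP _ _ _) (is_derive_id _ _)). Qed.

Lemma cderD f g z l m : cder f z l -> cder g z m ->
  cder (fun x => f x + g x) z (l + m).
Proof. by move=> /cderP hf /cderP hg; exact: (iffLR (cderP _ _ _) (is_deriveD hf hg)). Qed.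

Lemma cderB f g z l m : cder f z l -> cder g z m ->
  cder (fun x => f x - g x) z (l - m).
Proof. by move=> /cderP hf /cderP hg; exact: (iffLR (cderP _ _ _) (is_deriveB hf hg)). Qed.

Lemma cderM f g z l m : cder f z l -> cder g z m ->
  cder (fun x => f x * g x) z (f z * m + g z * l).
Proof. by move=> /cderP hf /cderP hg; exact: (iffLR (cderP _ _ _) (is_deriveM hf hg)). Qed.

Lemma cderX f n z l : cder f z l -> cder (fun x => f x ^+ n) z (n%:R * f z ^+ n.-1 * l).
Proof.
move=> hf; elim: n => [|n ih].
  by rewrite !mul0r; under eq_fun do rewrite expr0; exact: cder_cst.
under eq_fun do rewrite exprS; have := cderM hf ih.
congr cder; case: n {ih} => [|n]; first by rewrite /= !mul0r !expr0 mulr0 add0r mulr1.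
by rewrite /= exprS -(natr1 n.+1); ring.
Qed.

Lemma cderMl c f z l : cder f z l -> cder (fun x => c * f x) z (c * l).
Proof. by move=> hf; have := cderM (cder_cst c z) hf; rewrite mulr0 addr0. Qed.

Lemma cderV f z l : f z != 0 -> cder f z l -> cder (fun x => (f x)^-1) z (- l / f z ^+ 2).
Proof.
move=> fz /cderP[df vf]; apply/cderP; split; first exact: derivableV.
by rewrite deriveV// vf scaleNr mulNr mulrC.
Qed.

Lemma cder_div f g z l m : g z != 0 -> cder f z l -> cder g z m ->
  cder (fun x => f x / g x) z ((l * g z - f z * m) / g z ^+ 2).
Proof.
move=> gz hf hg; have := cderM hf (cderV gz hg); congr cder; by field.
Qed.

Lemma cder_lip f z l : cder f z l -> exists d : R, 0 < d /\
  forall k, N k < d -> N (f (z + k) - f z) <= (N l + 1) * N k.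
Proof.
move=> /(_ 1 ltr01)[d [d0 Hd]]; exists d; split => // k /Hd h.
have -> : f (z + k) - f z = (f (z + k) - f z - l * k) + l * k by rewrite subrK.
by rewrite (le_trans (ND _ _))// NM mulrDl mul1r addrC lerD2l -[N k]mul1r.
Qed.

Lemma cder_ccont f z l : cder f z l -> ccont f z.
Proof.
move=> /cder_lip[d [d0 Hd]] e e0.
have l1 : 0 < N l + 1 by rewrite ltr_wpDl ?N_ge0.
exists (Num.min d (e / (N l + 1))); split; first by rewrite lt_min d0 divr_gt0.
move=> k; rewrite lt_min => /andP[/Hd h1 h2]; apply: le_trans h1 _.
by rewrite mulrC -ler_pdivlMr// ltW.
Qed.

Lemma cder_comp f g z l m : cder g z m -> cder f (g z) l ->
  cder (fun x => f (g x)) z (l * m).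
Proof.
move=> hg hf e e0; have [d1 [d10 H1]] := cder_lip hg.
have m1 : 0 < N m + 1 by rewrite ltr_wpDl ?N_ge0.
have l1 : 0 < N l + 1 by rewrite ltr_wpDl ?N_ge0.
have [d2 [d20 H2]] := hf (e / 2 / (N m + 1)) ltac:(by rewrite !divr_gt0).
have [d3 [d30 H3]] := hg (e / 2 / (N l + 1)) ltac:(by rewrite !divr_gt0).
exists (Num.min (Num.min d1 d3) (d2 / (N m + 1))).
split; first by rewrite !lt_min d10 d30 divr_gt0.
move=> k; rewrite !lt_min => /andP[/andP[k1 k3] k2].
set j := g (z + k) - g z.
have jk : N j <= (N m + 1) * N k by exact: H1.
have /H2 : N j < d2.
  by apply: le_lt_trans jk _; rewrite mulrC -ltr_pdivlMr.
have -> : g z + j = g (z + k) by rewrite /j addrC subrK.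
move=> h; have -> : f (g (z + k)) - f (g z) - l * m * k =
    (f (g (z + k)) - f (g z) - l * j) + l * (j - m * k) by ring.
apply: le_trans (ND _ _) _; rewrite NM.
have e1 : e / 2 / (N m + 1) * N j <= e / 2 * N k.
  have -> : e / 2 * N k = e / 2 / (N m + 1) * ((N m + 1) * N k) by field; rewrite gt_eqF.
  by rewrite ler_wpM2l// !divr_ge0// ltW.
have h3 := H3 _ k3.
have e2 : N l * N (j - m * k) <= e / 2 * N k.
  have -> : e / 2 * N k = (N l + 1) * (e / 2 / (N l + 1) * N k) by field; rewrite gt_eqF.
  by apply: ler_pM; rewrite ?N_ge0 ?lerDl.
have := N_ge0 k; lra.
Qed.

Lemma cder_near f g z l (d : R) : 0 < d -> (forall k, N k < d -> f (z + k) = g (z + k)) ->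
  cder f z l -> cder g z l.
Proof.
move=> d0 fg hf e e0; have [d1 [d10 H1]] := hf _ e0.
exists (Num.min d d1); split; first by rewrite lt_min d0 d10.
move=> k; rewrite lt_min => /andP[kd k1].
by rewrite -fg// -{2}[z]addr0 -fg ?N0// addr0; exact: H1.
Qed.


End Derivative.

(** * Integrals of continuous functions *)

Section Integral.
Variable R : realType.
Implicit Types (f F : R -> R) (a b c d x : R).

Lemma is_derive_limP f x l : is_derive x 1 f l <-> forall e : R, 0 < e -> exists d : R, 0 < d /\
  forall k, `|k| < d -> `|f (x + k) - f x - l * k| <= e * `|k|.
Proof.
pose q (h : R) : R := h^-1 *: ((f \o shift x) (h *: (1 : R)) - f x).
have qE : is_derive x 1 f l <-> q h @[h --> (0 : R)^'] --> l.
  split=> [[dv <-]|h]; first exact: dv.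
  by split; [exact: cvgP h|exact: cvg_lim h].
have key (k : R) : k != 0 -> f (x + k) - f x - l * k = - ((l - q k) * k).
  by move=> k0; rewrite /q /= /GRing.scale /= mulr1 [k + x]addrC; field.
rewrite qE; split.
- move=> /cvgrPdist_le/= H e /H.
  rewrite near_withinE => /nbhs_ballP[d /= d0 Hd].
  exists d; split => // k kd; have [->|k0] := eqVneq k 0.
    by rewrite addr0 subrr mulr0 subr0 !normr0 mulr0.
  have /Hd /(_ k0) hk : ball (0 : R) d k by rewrite -ball_normE /ball_ /= sub0r normrN.
  by rewrite key// normrN normrM ler_wpM2r.
- move=> H; apply/cvgrPdist_le => /= e /H[d [d0 Hd]].
  rewrite near_withinE; apply/nbhs_ballP; exists d => //= k.
  rewrite -ball_normE /ball_ /= sub0r normrN => /Hd h k0.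
  have Nk : 0 < `|k| by rewrite normr_gt0.
  by rewrite -(ler_pM2r Nk) -normrM -normrN -key.
Qed.

Lemma continuous_atP f x : {for x, continuous f} <-> forall e : R, 0 < e ->
  exists d : R, 0 < d /\ forall k, `|k| < d -> `|f (x + k) - f x| <= e.
Proof.
split.
- move=> /cvgrPdist_le/= H e /H /nbhs_ballP[d /= d0 Hd].
  exists d; split => // k kd; rewrite distrC; apply: Hd.
  by rewrite -ball_normE /ball_ /= opprD addrA subrr sub0r normrN.
- move=> H; apply/cvgrPdist_le => /= e /H[d [d0 Hd]].
  apply/nbhs_ballP; exists d => //= y xy.
  have {}xy : `|x - y| < d by exact: xy.
  have := Hd (y - x); rewrite [x + _]addrC subrK => h.
  by rewrite distrC; apply: h; rewrite distrC.
Qed.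

Definition cint f a b : R := (\int[@lebesgue_measure R]_(x in `[a, b]) f x)%R.

Lemma cint_primitive f a b : continuous f -> exists F : R -> R,
  (forall x, a <= x <= b -> is_derive x 1 F (f x)) /\
  forall c d, a <= c -> c <= d -> d <= b -> cint f c d = F d - F c.
Proof.
(* Starting at [a - 1] and allowing room up to [b + 1] keeps both endpoints interior, so [F] has
   two-sided derivatives on all of [[a, b]]. *)
move=> cf; pose F x := (\int[@lebesgue_measure R]_(t in `[a - 1, x]) f t)%R.
have dF x : a <= x <= b -> is_derive x 1 F (f x).
  move=> /andP[ax xb].
  have xb1 : x < b + 1 by lra.
  have ig : (@lebesgue_measure R).-integrable `[a - 1, b + 1] (EFin \o f).
    apply: continuous_compact_integrable; first exact: segment_compact.
    exact: continuous_subspaceT.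
  have ax1 : a - 1 < x by lra.
  have [] := @continuous_FTC1_closed R f (a - 1) x (b + 1) xb1 ig ax1 (cf x).
  by move=> h1 h2; exact: (DeriveDef h1 (etrans (esym (derive1E F x)) h2)).
exists F; split => // c d ac cd db.
have [->|cd'] := eqVneq c d; first by rewrite subrr /cint set_itv1 Rintegral_set1.
have {}cd' : c < d by rewrite lt_neqAle cd' cd.
have cF x : a <= x <= b -> {for x, continuous F}.
  by move=> /dF h; apply/differentiable_continuous/derivable1_diffP.
have H : (\int[@lebesgue_measure R]_(x in `[c, d]) (f x)%:E = (F d)%:E - (F c)%:E)%E.
  apply: (@continuous_FTC2 R f F c d cd').
  - exact: continuous_subspaceT.
  - split.
    + move=> x; rewrite in_itv /= => /andP[h1 h2].
      by have [] // := dF x; lra.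
    + by apply: cvg_at_right_filter; apply: cF; lra.
    + by apply: cvg_at_left_filter; apply: cF; lra.
  - move=> x; rewrite in_itv /= => /andP[h1 h2].
    by have [|_ E] := dF x; [lra|rewrite derive1E E].
by rewrite /cint /Rintegral H.
Qed.

Lemma cint_split f a b c : continuous f -> a <= b -> b <= c ->
  cint f a c = cint f a b + cint f b c.
Proof.
move=> cf ab bc; have [F [_ H]] := cint_primitive a c cf.
by rewrite !H//; [ring|lra].
Qed.

(** The mean value theorem is applied to a primitive of [f] minus the quadratic primitive of
    [u + v * x]; no inequality between integrals is involved. *)
Lemma cint_approx f a b (u v e : R) : continuous f -> a <= b ->
  (forall x, a <= x <= b -> `|f x - (u + v * x)| <= e) ->
  `|cint f a b - (u * (b - a) + v / 2 * (b ^+ 2 - a ^+ 2))| <= e * (b - a).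
Proof.
move=> cf ab H; have [F [dF HF]] := cint_primitive a b cf.
rewrite HF//; have [->|ab'] := eqVneq a b.
  by rewrite !subrr !mulr0 addr0 subr0 normr0.
have {}ab' : a < b by rewrite lt_neqAle ab' ab.
pose G := F - (fun x => u * x + v / 2 * x ^+ 2).
have dG x : a <= x <= b -> is_derive x 1 G (f x - (u + v * x)).
  move=> /dF h; apply: is_deriveB; apply/is_derive_limP => e0 e00.
  have v0 : 0 < `|v| + 1 by rewrite ltr_wpDl.
  exists (e0 / (`|v| + 1)); split; first by rewrite divr_gt0.
  move=> k; rewrite ltr_pdivlMr// => hk.
  have -> : u * (x + k) + v / 2 * (x + k) ^+ 2 - (u * x + v / 2 * x ^+ 2) - (u + v * x) * k
     = (v / 2 * k) * k by field.
  rewrite normrM ler_wpM2r// !normrM (@ger0_norm _ 2^-1)//.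
  by have := normr_ge0 v; have := normr_ge0 k; nra.
have [| |c] := @MVT R G (fun x => f x - (u + v * x)) a b ab'.
- by move=> x; rewrite in_itv /= => /andP[h1 h2]; apply: dG; lra.
- apply/continuous_within_itvP => //.
  have cG x : a <= x <= b -> {for x, continuous G}.
    by move=> /dG h; apply/differentiable_continuous/derivable1_diffP.
  split.
  + by move=> x; rewrite in_itv /= => /andP[h1 h2]; apply: cG; lra.
  + by apply: cvg_at_right_filter; apply: cG; lra.
  + by apply: cvg_at_left_filter; apply: cG; lra.
- rewrite in_itv /= => /andP[h1 h2] E.
  have -> : F b - F a - (u * (b - a) + v / 2 * (b ^+ 2 - a ^+ 2)) = G b - G a.
    by rewrite /G !fctE; ring.
  rewrite E normrM (@ger0_norm _ (b - a)); last lra.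
  by apply: ler_wpM2r; [lra|apply: H; lra].
Qed.

Lemma cint_mean f a b : continuous f -> a <= b ->
  exists c, a <= c <= b /\ cint f a b = f c * (b - a).
Proof.
move=> cf ab; have [F [dF HF]] := cint_primitive a b cf.
rewrite HF//; have [->|ab'] := eqVneq a b; first by exists b; rewrite lexx !subrr mulr0.
have {}ab' : a < b by rewrite lt_neqAle ab' ab.
have cF x : a <= x <= b -> {for x, continuous F}.
  by move=> /dF h; apply/differentiable_continuous/derivable1_diffP.
have [| |c] := @MVT R F f a b ab'.
- by move=> x; rewrite in_itv /= => /andP[h1 h2]; apply: dF; lra.
- apply/continuous_within_itvP => //; split.
  + by move=> x; rewrite in_itv /= => /andP[h1 h2]; apply: cF; lra.
  + by apply: cvg_at_right_filter; apply: cF; lra.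
  + by apply: cvg_at_left_filter; apply: cF; lra.
- by rewrite in_itv /= => /andP[h1 h2] ->; exists c; split => //; lra.
Qed.

End Integral.

(** * Goursat's theorem on rectangles *)

Section Goursat.
Variable R : realType.

Lemma nested_point (u : nat -> R) (L : R) : 0 <= L ->
  (forall n, u n <= u n.+1) ->
  (forall n, u n.+1 + L / 2 ^+ n.+1 <= u n + L / 2 ^+ n) ->
  exists x, forall n, u n <= x <= u n + L / 2 ^+ n.
Proof.
move=> L0 u1 u2.
have mono m n : (m <= n)%N -> u m <= u n.
  by move=> /subnK <-; elim: (n - m)%N => [|k ih]; [rewrite add0n|rewrite addSn (le_trans ih)].
have mono2 m n : (m <= n)%N -> u n + L / 2 ^+ n <= u m + L / 2 ^+ m.
  move=> /subnK <-; elim: (n - m)%N => [|k ih]; [by rewrite add0n|].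
  by rewrite addSn (le_trans (u2 _)).
have L2 n : 0 <= L / 2 ^+ n by rewrite divr_ge0// exprn_ge0.
have ub n : ubound (range u) (u n + L / 2 ^+ n).
  move=> _ [m _ <-]; have [mn|/ltnW nm] := leqP m n.
    by rewrite (le_trans (mono _ _ mn))// lerDl.
  by rewrite (le_trans _ (mono2 _ _ nm))// lerDl.
have hs : has_sup (range u) by split; [exists (u 0%N), 0%N|exists (u 0%N + L / 2 ^+ 0)].
exists (sup (range u)) => n; apply/andP; split.
  by apply: sup_upper_bound => //; exists n.
by apply: ge_sup => //; case: hs.
Qed.

Variables (P Q : R -> R -> R).
Hypothesis cP : forall y, continuous (P ^~ y).
Hypothesis cQ : forall x, continuous (Q x).

(** The integral of the form [P dx + Q dy], counterclockwise around the rectangle with lower left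
    corner [(a, c)], width [w] and height [h]. *)
Definition loop (a w c h : R) : R :=
  cint (P ^~ c) a (a + w) + cint (Q (a + w)) c (c + h)
  - cint (P ^~ (c + h)) a (a + w) - cint (Q a) c (c + h).

Lemma loop_quarter a w c h : 0 <= w -> 0 <= h ->
  loop a w c h = loop a (w / 2) c (h / 2) + loop (a + w / 2) (w / 2) c (h / 2)
    + loop a (w / 2) (c + h / 2) (h / 2) + loop (a + w / 2) (w / 2) (c + h / 2) (h / 2).
Proof.
move=> w0 h0; rewrite /loop.
have e1 x : x + w / 2 + w / 2 = x + w by field.
have e2 x : x + h / 2 + h / 2 = x + h by field.
rewrite !e1 !e2.
rewrite (@cint_split _ (P ^~ c) a (a + w / 2) (a + w))//; [|lra|lra].
rewrite (@cint_split _ (P ^~ (c + h)) a (a + w / 2) (a + w))//; [|lra|lra].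
rewrite (@cint_split _ (Q a) c (c + h / 2) (c + h))//; [|lra|lra].
rewrite (@cint_split _ (Q (a + w)) c (c + h / 2) (c + h))//; [|lra|lra].
ring.
Qed.

(* The linear parts contribute nothing because [P_y = Q_x = p2]. *)
Lemma loop_approx a w c h (x y p q p1 p2 q2 e : R) : 0 <= w -> 0 <= h ->
  (forall s t, a <= s <= a + w -> c <= t <= c + h ->
    `|P s t - (p + p1 * (s - x) + p2 * (t - y))| <= e /\
    `|Q s t - (q + p2 * (s - x) + q2 * (t - y))| <= e) ->
  `|loop a w c h| <= 2 * e * (w + h).
Proof.
move=> w0 h0 H; rewrite /loop.
have HP t : c <= t <= c + h -> `|cint (P ^~ t) a (a + w) -
    ((p - p1 * x + p2 * (t - y)) * (a + w - a) + p1 / 2 * ((a + w) ^+ 2 - a ^+ 2))| <= e * (a + w - a).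
  move=> ht; apply: cint_approx => //; first lra.
  move=> s hs; have [h1 _] := H s t hs ht.
  by apply: le_trans h1; rewrite le_eqVlt; apply/orP; left; apply/eqP; congr `|_|; ring.
have HQ s : a <= s <= a + w -> `|cint (Q s) c (c + h) -
    ((q - q2 * y + p2 * (s - x)) * (c + h - c) + q2 / 2 * ((c + h) ^+ 2 - c ^+ 2))| <= e * (c + h - c).
  move=> hs; apply: cint_approx => //; first lra.
  move=> t ht; have [_ h1] := H s t hs ht.
  by apply: le_trans h1; rewrite le_eqVlt; apply/orP; left; apply/eqP; congr `|_|; ring.
have := HP c ltac:(lra); have := HP (c + h) ltac:(lra).
have := HQ a ltac:(lra); have := HQ (a + w) ltac:(lra).
set A1 := cint _ _ _; set A2 := cint _ _ _; set A3 := cint _ _ _; set A4 := cint _ _ _.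
rewrite !ler_norml => /andP[u1 u2] /andP[u3 u4] /andP[u5 u6] /andP[u7 u8].
by apply/andP; split; lra.
Qed.

Variables (a0 w0 c0 h0 : R).
Hypotheses (w0_ge0 : 0 <= w0) (h0_ge0 : 0 <= h0).
(** The form is closed in the pointwise sense: [P] and [Q] are differentiable and the shared
    coefficient [p2] says [P_y = Q_x]. *)
Hypothesis dPQ : forall x y, a0 <= x <= a0 + w0 -> c0 <= y <= c0 + h0 ->
  exists p1 p2 q2 : R, forall e, 0 < e -> exists d : R, 0 < d /\
    forall s t, `|s| < d -> `|t| < d ->
      `|P (x + s) (y + t) - (P x y + p1 * s + p2 * t)| <= e * (`|s| + `|t|) /\
      `|Q (x + s) (y + t) - (Q x y + p2 * s + q2 * t)| <= e * (`|s| + `|t|).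

Lemma goursat : loop a0 w0 c0 h0 = 0.
Proof.
apply/eqP; rewrite -normr_le0 leNgt; apply/negP => l0.
pose W n := w0 / 2 ^+ n; pose H n := h0 / 2 ^+ n.
have W0 n : 0 <= W n by rewrite divr_ge0// exprn_ge0.
have H0 n : 0 <= H n by rewrite divr_ge0// exprn_ge0.
have W1 n : W n.+1 = W n / 2 by rewrite /W exprS; field; rewrite expf_neq0.
have H1 n : H n.+1 = H n / 2 by rewrite /H exprS; field; rewrite expf_neq0.
(* [K] makes the whole rectangle bad, and the threshold [K * (W n + H n) ^+ 2] is divided by 4 at
   each level, as in the bisection. In the end [loop_approx] with error [K / 2 * (W n + H n)] gives
   exactly this threshold. The [+ 1] keeps the denominator positive for a degenerate rectangle. *)
pose K := `|loop a0 w0 c0 h0| / (2 * ((w0 + h0) ^+ 2 + 1)).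
have D0 : 0 < 2 * ((w0 + h0) ^+ 2 + 1) by rewrite mulr_gt0// ltr_wpDl// sqr_ge0.
have K0 : 0 < K by rewrite divr_gt0.
pose bad n (s : R * R) := K * (W n + H n) ^+ 2 < `|loop s.1 (W n) s.2 (H n)|.
have bad0 : bad 0%N (a0, c0).
  rewrite /bad /W /H /= expr0 !divr1.
  have E : `|loop a0 w0 c0 h0| = K * (2 * ((w0 + h0) ^+ 2 + 1)) by rewrite divfK// gt_eqF.
  by rewrite E ltr_pM2l//; have := sqr_ge0 (w0 + h0); lra.
have step n s : bad n s -> exists s' : R * R, bad n.+1 s' /\
   (s.1 <= s'.1 /\ s'.1 + W n.+1 <= s.1 + W n) /\ (s.2 <= s'.2 /\ s'.2 + H n.+1 <= s.2 + H n).
  case: s => a c; rewrite /bad /= => b; apply: contrapT => nex.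
  have small a' c' : a <= a' -> a' + W n.+1 <= a + W n -> c <= c' -> c' + H n.+1 <= c + H n ->
      `|loop a' (W n / 2) c' (H n / 2)| <= K * (W n + H n) ^+ 2 / 4.
    move=> i1 i2 i3 i4; rewrite leNgt; apply/negP => b'; apply: nex; exists (a', c') => /=.
    split => //; rewrite W1 H1; apply: le_lt_trans b'.
    by rewrite le_eqVlt; apply/orP; left; apply/eqP; field.
  move: b; rewrite ltNge => /negP; apply; rewrite loop_quarter//.
  have := W0 n; have := H0 n => Hn Wn.
  have t1 := small a c ltac:(lra) ltac:(rewrite W1; lra) ltac:(lra) ltac:(rewrite H1; lra).
  have t2 := small (a + W n / 2) c ltac:(lra) ltac:(rewrite W1; lra) ltac:(lra) ltac:(rewrite H1;
    lra).
  have t3 := small a (c + H n / 2) ltac:(lra) ltac:(rewrite W1; lra) ltac:(lra) ltac:(rewrite H1;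
    lra).
  have t4 := small (a + W n / 2) (c + H n / 2) ltac:(lra) ltac:(rewrite W1;
    lra) ltac:(lra) ltac:(rewrite H1; lra).
  apply: (le_trans (ler_normD _ _)); rewrite -lerBrDr; apply: (le_trans (ler_normD _ _)).
  rewrite -lerBrDr; apply: (le_trans (ler_normD _ _)); lra.
have [f Hf] : exists f : nat -> R * R, forall n, bad n (f n) /\
   ((f n).1 <= (f n.+1).1 /\ (f n.+1).1 + W n.+1 <= (f n).1 + W n) /\
   ((f n).2 <= (f n.+1).2 /\ (f n.+1).2 + H n.+1 <= (f n).2 + H n) /\ f 0%N = (a0, c0).
  (* Dependent choice: [nxt] is iterated on bad rectangles tagged with their level, and [g1]
     recovers the tag. *)
  pose T := {p : nat * (R * R) | bad p.1 p.2}.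
  have nxt (t : T) : {t' : T | (sval t').1 = (sval t).1.+1 /\
     ((sval t).2.1 <= (sval t').2.1 /\ (sval t').2.1 + W (sval t).1.+1 <= (sval t).2.1 + W (sval t).1) /\
     ((sval t).2.2 <= (sval t').2.2 /\ (sval t').2.2 + H (sval t).1.+1 <= (sval t).2.2 + H (sval t).1)}.
    by case: t => -[n s] /= b; have [s' [b' i]] := cid (step n s b); exists (exist _ (n.+1, s') b').
  pose g n : T := iter n (fun t => sval (nxt t)) (exist _ (0%N, (a0, c0)) bad0).
  have gS n : g n.+1 = sval (nxt (g n)) by [].
  have g1 n : (sval (g n)).1 = n.
    by elim: n => // n ih; rewrite gS (svalP (nxt (g n))).1 ih.
  exists (fun n => (sval (g n)).2) => n; split; first by rewrite -{1}(g1 n); exact: (svalP (g n)).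
  have [_ [i1 i2]] := svalP (nxt (g n)).
  by rewrite -gS g1 in i1 i2.
have f0 : f 0%N = (a0, c0) by have [_ [_ [_ ->]]] := Hf 0%N.
have [x Hx] : exists x, forall n, (f n).1 <= x <= (f n).1 + W n.
  by apply: nested_point => // n; have [_ [[? ?] _]] := Hf n.
have [y Hy] : exists x, forall n, (f n).2 <= x <= (f n).2 + H n.
  by apply: nested_point => // n; have [_ [_ [[? ?] _]]] := Hf n.
have hx : a0 <= x <= a0 + w0 by have := Hx 0%N; rewrite f0 /W /= expr0 divr1.
have hy : c0 <= y <= c0 + h0 by have := Hy 0%N; rewrite f0 /H /= expr0 divr1.
have [p1 [p2 [q2 /(_ (K / 2) ltac:(by rewrite divr_gt0))[d [d0 Hd]]]]] := dPQ hx hy.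
have [n Hn] : exists n, W n + H n < d.
  exists (Num.bound ((w0 + h0) / d)); set n := Num.bound _.
  have wd : 0 <= (w0 + h0) / d by rewrite divr_ge0 ?addr_ge0// ltW.
  have b1 : (w0 + h0) / d < n%:R by rewrite (le_lt_trans _ (archi_boundP wd)).
  have b2 : n%:R <= 2 ^+ n :> R by rewrite -natrX ler_nat ltnW// ltn_expl.
  have p2n : 0 < 2 ^+ n :> R by rewrite exprn_gt0.
  rewrite /W /H -mulrDl ltr_pdivrMr// mulrC -ltr_pdivrMr//.
  exact: lt_le_trans b1 b2.
have [b _] := Hf n; move: b; rewrite /bad ltNge => /negP; apply.
have hxn := Hx n; have hyn := Hy n; have wn := W0 n; have hn := H0 n.
have -> : K * (W n + H n) ^+ 2 = 2 * (K / 2 * (W n + H n)) * (W n + H n) by field.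
apply: (loop_approx (x := x) (y := y) (p := P x y) (q := Q x y) (p1 := p1) (p2 := p2) (q2 :=
  q2)) => // s t hs ht.
have s1 : `|s - x| <= W n by rewrite ler_norml; lra.
have t1 : `|t - y| <= H n by rewrite ler_norml; lra.
have [] := Hd (s - x) (t - y) ltac:(lra) ltac:(lra).
rewrite ![_ + (_ - _)]addrC !subrK => u1 u2.
have le : K / 2 * (`|s - x| + `|t - y|) <= K / 2 * (W n + H n).
  by rewrite ler_pM2l ?divr_gt0//; lra.
by split; apply: le_trans le.
Qed.

End Goursat.

(** * Mean value inequality *)

Section MeanValue.
Variable R : realType.
Implicit Types (z w k : R[i]) (H : R[i] -> R[i]).

Definition cexp z : R[i] :=
  ((expR (Re z) * cos (Im z)) +i* (expR (Re z) * sin (Im z)))%C.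

Lemma Re_cexp z : Re (cexp z) = expR (Re z) * cos (Im z). Proof. by []. Qed.
Lemma Im_cexp z : Im (cexp z) = expR (Re z) * sin (Im z). Proof. by []. Qed.

Lemma cexpD z w : cexp (z + w) = cexp z * cexp w.
Proof.
by apply: cpx_eq; rewrite !(ReImE, Re_cexp, Im_cexp) expRD ?cosD ?sinD; ring.
Qed.

Lemma N_cexp z : N (cexp z) = expR (Re z).
Proof.
rewrite /cexp /Normc.normc !exprMn -mulrDr cos2Dsin2 mulr1 sqrtr_sqr.
by rewrite ger0_norm// expR_ge0.
Qed.

Lemma cder_cexp0 : cder cexp 0 1.
Proof.
move=> e e0.
(* The real part will cost [3 * (e1 * N k)] and the imaginary part [4 * (e1 * N k)]; 8 covers the
   sum. *)
pose e1 := e / 8.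
have e10 : 0 < e1 by rewrite divr_gt0.
have [d1 [d10 H1]] := iffLR (is_derive_limP (@expR R) 0 _) (is_derive_expR 0) e1 e10.
have [d2 [d20 H2]] := iffLR (is_derive_limP (@cos R) 0 _) (is_derive_cos 0) e1 e10.
have [d3 [d30 H3]] := iffLR (is_derive_limP (@sin R) 0 _) (is_derive_sin 0) e1 e10.
exists (Num.min (Num.min d1 d2) (Num.min d3 (Num.min e1 1))); split.
  by rewrite !lt_min d10 d20 d30 e10 ltr01.
move=> k; rewrite !lt_min => /andP[/andP[k1 k2] /andP[k3 /andP[k4 k5]]].
have rk := Re_le k; have ik := Im_le k; have nk := N_ge0 k.
have := H1 (Re k) (le_lt_trans rk k1).
have := H2 (Im k) (le_lt_trans ik k2).
have := H3 (Im k) (le_lt_trans ik k3).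
rewrite !add0r expR0 cos0 sin0 oppr0 mul0r !(subr0, addr0) !mul1r.
set E := expR _; set c := cos _; set s := sin _ => hs hc hE.
have cR : Re (cexp k - cexp 0 - k) = E * c - 1 - Re k.
  by rewrite !(ReImE, Re_cexp) ?Re_0 ?Im_0 expR0 cos0 -/E -/c; ring.
have cI : Im (cexp k - cexp 0 - k) = E * s - Im k.
  by rewrite !(ReImE, Im_cexp) ?Re_0 ?Im_0 expR0 sin0 -/E -/s; ring.
apply: (le_trans (N_leD _)); rewrite cR cI.
have c1 : `|c| <= 1 by rewrite ler_norml cos_geN1 cos_le1.
have s1 : `|s| <= 1 by rewrite ler_norml sin_geN1 sin_le1.
have r1 : `|1 + Re k| <= 2 by move: rk; rewrite !ler_norml; lra.
have eN : e1 * `|Re k| <= e1 * N k by rewrite ler_pM2l.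
have eI : e1 * `|Im k| <= e1 * N k by rewrite ler_pM2l.
have bE (x : R) : `|x| <= 1 -> `|(E - 1 - Re k) * x| <= e1 * N k.
  move=> x1; rewrite normrM -[leRHS]mulr1; apply: ler_pM => //.
  exact: le_trans hE eN.
have bR (x : R) : `|x| <= e1 * N k -> `|(1 + Re k) * x| <= 2 * (e1 * N k).
  by move=> x1; rewrite normrM; apply: ler_pM.
have t1 : `|E * c - 1 - Re k| <= 3 * (e1 * N k).
  have -> : E * c - 1 - Re k = (E - 1 - Re k) * c + (1 + Re k) * (c - 1) by ring.
  have := bE c c1; have := bR (c - 1) (le_trans hc eI).
  have := ler_normD ((E - 1 - Re k) * c) ((1 + Re k) * (c - 1)); lra.
have t2 : `|E * s - Im k| <= 4 * (e1 * N k).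
  have -> : E * s - Im k = (E - 1 - Re k) * s + (1 + Re k) * (s - Im k) + Re k * Im k by ring.
  have := bE s s1; have := bR (s - Im k) (le_trans hs eI).
  have : `|Re k * Im k| <= e1 * N k.
    by rewrite normrM; apply: ler_pM => //; apply: le_trans rk (ltW k4).
  have := ler_normD ((E - 1 - Re k) * s + (1 + Re k) * (s - Im k)) (Re k * Im k).
  have := ler_normD ((E - 1 - Re k) * s) ((1 + Re k) * (s - Im k)); lra.
have -> : e * N k = 8 * (e1 * N k) by rewrite /e1; field.
have : 0 <= e1 * N k by rewrite mulr_ge0// ltW.
lra.
Qed.

Lemma cder_cexp z : cder cexp z (cexp z).
Proof.
move=> e e0; have [|d [d0 Hd]] := cder_cexp0 (e := e / N (cexp z)).
  by rewrite divr_gt0// N_cexp expR_gt0.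
exists d; split => // k /Hd h.
have -> : cexp (z + k) - cexp z - cexp z * k = cexp z * (cexp (0 + k) - cexp 0 - 1 * k).
  have -> : cexp 0 = 1 by apply: cpx_eq; rewrite /cexp /= expR0 ?cos0 ?sin0 ?mulr0 ?mulr1.
  by rewrite cexpD add0r; ring.
rewrite NM mulrC -ler_pdivlMr ?N_cexp ?expR_gt0//.
by move: h; rewrite N_cexp mulrAC.
Qed.

(** In the coordinates [z0 + cexp (s +i* t)] the annulus is a rectangle of height [2 pi]. Goursat is
    applied to the imaginary part of [G dz], that is [Im G ds + Re G dt]. The sides [t = 0] and
    [t = 2 pi] cancel by periodicity, so [Re H] has equal means on the two circles: near [Re (H z0)]
    on the small one by continuity, at most [B] on the large one. *)
Lemma mean_ineq H z0 (r rho B : R) : 0 < r -> r < rho -> ccont H z0 ->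
  (forall z, 0 < N (z - z0) -> N (z - z0) < rho -> exists l, cder H z l) ->
  (forall z, N (z - z0) = r -> Re (H z) <= B) -> Re (H z0) <= B.
Proof.
move=> r0 rrho cH dH HB; rewrite leNgt; apply/negP => BH.
pose e := (Re (H z0) - B) / 2; have e0 : 0 < e by rewrite /e; lra.
have [d [d0 Hd]] := cH e e0.
pose s0 := ln (Num.min (d / 2) r); pose S := ln r; pose s1 := ln ((r + rho) / 2).
have d2 : 0 < Num.min (d / 2) r by rewrite lt_min r0 andbT; lra.
have es0 : expR s0 = Num.min (d / 2) r by rewrite lnK.
have eS : expR S = r by rewrite lnK.
have rr0 : 0 < (r + rho) / 2 by lra.
have es1 : expR s1 = (r + rho) / 2 by rewrite lnK.
have Ss1 : S < s1 by rewrite ltr_ln// ?posrE//; lra.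
have s0S : s0 <= S by rewrite ler_ln ?posrE// ge_min lexx orbT.
pose G z := H (z0 + cexp z).
have dG z : Re z <= s1 -> exists l, cder G z l.
  move=> zs; have [||l hl] := dH (z0 + cexp z).
  - by rewrite addrAC subrr add0r N_cexp expR_gt0.
  - rewrite addrAC subrr add0r N_cexp; apply: (@le_lt_trans _ _ (expR s1)).
      by rewrite ler_expR.
    by rewrite es1; lra.
  exists (l * (0 + cexp z)); exact: (cder_comp (cderD (cder_cst z0 z) (cder_cexp z)) hl).
(* [G] is known to be differentiable only for [Re z <= s1], whereas [goursat] wants [P] and [Q]
   continuous along entire lines. Clamping at [s1], strictly beyond [S], leaves the form unchanged
   near the rectangle. *)
pose m s := Num.min s s1.
have ms s : m s <= s1 by rewrite /m ge_min lexx orbT.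
have msE s : s <= s1 -> m s = s by move=> h; rewrite /m; apply/min_idPl.
have mL (s k : R) : `|m (s + k) - m s| <= `|k|.
  rewrite /m; case: (leP s s1) => h1; case: (leP (s + k) s1) => h2.
  - by rewrite addrAC subrr add0r.
  - by rewrite ler_norml; have := ler_norm k; have := normr_ge0 k; lra.
  - by rewrite ler_norml; have := ler_norm (- k); rewrite normrN; have := normr_ge0 k; lra.
  - by rewrite subrr normr0.
pose P s t := Im (G (m s +i* t)%C); pose Q s t := Re (G (m s +i* t)%C).
have cont (p : R -> R[i]) : (forall s, Re (p s) <= s1) ->
    (forall s k : R, N (p (s + k) - p s) <= `|k|) ->
    continuous (fun s => Im (G (p s))) /\ continuous (fun s => Re (G (p s))).
  move=> ps pL; have key s : forall e, 0 < e -> exists d : R, 0 < d /\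
      forall k : R, `|k| < d -> N (G (p (s + k)) - G (p s)) <= e.
    have [l /cder_ccont hl] := dG (p s) (ps s).
    move=> e' /hl[d' [d'0 Hd']]; exists d'; split => // k kd.
    have := Hd' (p (s + k) - p s) (le_lt_trans (pL s k) kd).
    by rewrite [p s + _]addrC subrK.
  split=> s; apply/continuous_atP => e' /(key s)[d' [d'0 Hd']]; exists d'; split => // k /Hd'.
    by apply: le_trans; apply: le_trans (Im_le _); rewrite ImD ImN.
  by apply: le_trans; apply: le_trans (Re_le _); rewrite ReD ReN.
have cP y : continuous (P ^~ y).
  apply: (cont (fun s => (m s +i* y)%C) _ _).1 => // s k.
  apply: le_trans (N_leD _) _; rewrite /= subrr normr0 addr0; exact: mL.
have cQ x : continuous (Q x).
  apply: (cont (fun t => (m x +i* t)%C) _ _).2 => [s|s k]; first exact: ms.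
  by apply: le_trans (N_leD _) _; rewrite /= subrr normr0 add0r addrAC subrr add0r.
have L0 : loop P Q s0 (S - s0) 0 (pi *+ 2) = 0.
  apply: goursat => //; first lra.
    by rewrite mulrn_wge0// pi_ge0.
  move=> x y; rewrite addrC subrK => /andP[_ xS] _.
  have xs1 : x < s1 by apply: le_lt_trans Ss1.
  have [|l hl] := dG (x +i* y)%C; first exact: ltW.
  exists (Im l), (Re l), (- Im l) => e' e'0; have [d' [d'0 Hd']] := hl e' e'0.
  exists (Num.min (d' / 2) (s1 - x)); split; first by rewrite lt_min; apply/andP; split; lra.
  move=> s t; rewrite !lt_min => /andP[sd sx] /andP[td _].
  have nst : N (s +i* t)%C <= `|s| + `|t| := N_leD _.
  have := Hd' (s +i* t)%C ltac:(lra); set D := _ - _ - _ => hD.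
  have hD' : N D <= e' * (`|s| + `|t|).
    by apply: le_trans hD _; rewrite ler_pM2l.
  have e1 : m (x + s) = x + s by apply: msE; have := ler_norm s; lra.
  have e2 : m x = x by apply: msE; lra.
  have e3 : ((x + s) +i* (y + t))%C = (x +i* y)%C + (s +i* t)%C by [].
  have r3 : Re (s +i* t)%C = s by []. have i3 : Im (s +i* t)%C = t by [].
  split; apply: le_trans hD'.
    apply: le_trans (Im_le _); rewrite /D /P e1 e2 e3 !ReImE ?r3 ?i3.
    by rewrite le_eqVlt; apply/orP; left; apply/eqP; congr `|_|; ring.
  apply: le_trans (Re_le _); rewrite /D /Q e1 e2 e3 !ReImE ?r3 ?i3.
  by rewrite le_eqVlt; apply/orP; left; apply/eqP; congr `|_|; ring.
move: L0; rewrite /loop.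
have -> : P ^~ (0 + pi *+ 2) = P ^~ 0.
  apply/funext => s; rewrite /P /G /cexp /= add0r cos2pi sin2pi; by rewrite cos0 sin0.
have pi0 : 0 < pi *+ 2 :> R by rewrite pmulrn_lgt0// pi_gt0.
rewrite (_ : s0 + (S - s0) = S) ?add0r; last by ring.
(* Each circle mean is a value attained at some angle, so equality of means becomes equality of two
   point values of [Re H]. *)
have [t1 [_ ->]] := cint_mean (cQ S) (ltW pi0).
have [t2 [_ ->]] := cint_mean (cQ s0) (ltW pi0).
set A := cint _ _ _ => E0.
have /eqP : (Q S t1 - Q s0 t2) * (pi *+ 2) = 0 by rewrite -E0; ring.
rewrite mulf_eq0 (gt_eqF pi0) orbF subr_eq0 => /eqP E.
have q1 : Q S t1 <= B.
  apply: HB; rewrite addrAC subrr add0r N_cexp /= msE ?eS//; exact: ltW.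
have q2 : Re (H z0) - e <= Q s0 t2.
  have ms0 : m s0 = s0 by apply: msE; lra.
  have := Hd (cexp (m s0 +i* t2)%C); rewrite N_cexp /= ms0 es0 => /(_ _) h.
  have {h} := h ltac:(by rewrite gt_min; apply/orP; left; lra).
  move=> h; have := le_trans (Re_le _) h; rewrite ReD ReN ler_norml /Q /G ms0; lra.
by move: q2; rewrite -E /e; lra.
Qed.

End MeanValue.

(** * Maximum principle, Schwarz lemma and Cauchy estimates *)

Section MaxPrinciple.
Variable R : realType.
Implicit Types (z w k l a : R[i]) (f : R[i] -> R[i]).

(** Compactness is taken from [R * R], where the disk is closed in a product of segments. *)
Lemma EVT_ball (u : R[i] -> R) a (r : R) : 0 <= r ->
  (forall x, N (x - a) <= r -> forall e, 0 < e -> exists d : R, 0 < d /\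
     forall y, N (y - a) <= r -> N (y - x) < d -> `|u y - u x| <= e) ->
  exists x, N (x - a) <= r /\ forall y, N (y - a) <= r -> u y <= u x.
Proof.
move=> r0 cu; pose c (p : R * R) : R[i] := (p.1 +i* p.2)%C.
pose A : set (R * R) := [set p | N (c p - a) <= r].
have AE : A = (fun p :
  R * R => (p.1 - Re a) * (p.1 - Re a) + (p.2 - Im a) * (p.2 - Im a)) @^-1` [set x | x <= r ^+ 2].
  by apply/seteqP; split => p; rewrite /A /= Nle// !ReImE /= -!expr2.
have cA : closed A.
  rewrite AE; apply: preimage_closed; last exact: closed_le.
  move=> p _; apply: cvgD; apply: cvgM; apply: cvgB; try exact: cvg_cst;
    by [exact: cvg_fst|exact: cvg_snd].
have kA : compact A.
  apply: (subclosed_compact cA (compact_setX (@segment_compact _ (Re a - r) (Re a + r)) (@segment_compact _ (Im a - r) (Im a + r)))).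
  move=> p Ap; have := le_trans (Re_le _) Ap; have := le_trans (Im_le _) Ap.
  rewrite !ReImE /= !ler_norml => /andP[h1 h2] /andP[h3 h4].
  by split; rewrite /= in_itv /=; apply/andP; split; lra.
have A0 : A !=set0 by exists (Re a, Im a); rewrite /A /= -[X in N (X - _)]/(Re a +i* Im a)%C;
  case: (a) => x y; rewrite subrr N0.
have uA : {within A, continuous (u \o c)}.
  apply/subspace_continuousP => p Ap; apply/cvgrPdist_le => /= e e0.
  have [d [d0 Hd]] := cu _ Ap _ e0.
  rewrite near_withinE; apply/nbhs_ballP; exists (d / 2); first by rewrite /= divr_gt0.
  move=> q [/= q1 q2] Aq; rewrite distrC; apply: Hd => //.
  have {}q1 : `|p.1 - q.1| < d / 2 by exact: q1.
  have {}q2 : `|p.2 - q.2| < d / 2 by exact: q2.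
  apply: le_lt_trans (N_leD _) _; rewrite !ReImE /= distrC.
  by rewrite [`|q.2 - _|]distrC; lra.
have [p Ap Hp] := compact_EVT_max A0 kA uA.
exists (c p); split; first by rewrite inE in Ap.
move=> y yr; have /Hp : (Re y, Im y) \in A by rewrite inE /A /c /=; case: (y) yr.
by rewrite /c /=; case: (y).
Qed.

Lemma ccont_N f z : ccont f z -> forall e, 0 < e -> exists d : R, 0 < d /\
  forall y, N (y - z) < d -> `|N (f y) - N (f z)| <= e.
Proof.
move=> cf e /cf[d [d0 Hd]]; exists d; split => // y /Hd.
rewrite [z + _]addrC subrK ler_norml => h.
have := N_rtri (f y) (f z); have := N_rtri (f z) (f y); rewrite NB; lra.
Qed.

(** The perturbed modulus [u = N f + eta * N z ^+ 2] cannot have an interior maximum [z0]. By [key],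
    the linear term of [H] has real part [eta * (N y ^+ 2 + N z0 ^+ 2 - N (y - z0) ^+ 2)], so
    maximality of [u] would make [Re H] smaller by [eta * dl ^+ 2] on a circle about [z0] than at
    [z0], against [mean_ineq]. The value of [eta] makes the perturbation equal to [e] on the
    boundary. *)
Lemma max_modulus f (r B : R) : 0 < r ->
  (forall z, N z <= r -> ccont f z) ->
  (forall z, 0 < N z -> N z < r -> exists l, cder f z l) ->
  (forall z, N z = r -> N (f z) <= B) ->
  forall z, N z <= r -> N (f z) <= B.
Proof.
move=> r0 cf df fB z zr; apply/ler_addgt0Pr => e e0.
pose eta := e / r ^+ 2; have r20 : 0 < r ^+ 2 by rewrite exprn_gt0.
have eta0 : 0 < eta by rewrite divr_gt0.
pose u x := N (f x) + eta * N x ^+ 2.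
have [|x xr e' e'0|z0 []] := @EVT_ball u 0 r; first exact: ltW.
  rewrite subr0 in xr; have [||d1 [d10 H1]] :=
    @ccont_N f x _ (e' / 2); [exact: cf|by rewrite divr_gt0|].
  pose d2 := e' / 2 / (eta * (2 * r)).
  have dd : 0 < eta * (2 * r) by apply: mulr_gt0 => //; exact: mulr_gt0.
  have d20 : 0 < d2 by apply: divr_gt0 => //; exact: divr_gt0.
  exists (Num.min d1 d2); split; first by rewrite lt_min d10.
  move=> y; rewrite subr0 lt_min => yr /andP[y1 y2].
  have := H1 _ y1; have ny := N_ge0 y; have nx := N_ge0 x.
  have h3 : `|N y - N x| <= N (y - x).
    by rewrite ler_norml; have := N_rtri y x; have := N_rtri x y; rewrite NB; lra.
  have h4 : `|eta * (N y ^+ 2 - N x ^+ 2)| <= e' / 2.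
    have -> : eta * (N y ^+ 2 - N x ^+ 2) = (N y - N x) * (eta * (N y + N x)) by ring.
    have -> : e' / 2 = d2 * (eta * (2 * r)) by rewrite /d2 divfK// gt_eqF.
    rewrite normrM; apply: ler_pM => //; first by apply: le_trans h3 (ltW y2).
    rewrite ger0_norm; last by rewrite mulr_ge0 ?addr_ge0// ltW.
    by rewrite ler_pM2l//; lra.
  have -> : u y - u x = (N (f y) - N (f x)) + eta * (N y ^+ 2 - N x ^+ 2) by rewrite /u; ring.
  move=> h5; apply: le_trans (ler_normD _ _) _; lra.
rewrite subr0 => z0r Hz0.
have uz : N (f z) <= u z0.
  apply: (@le_trans _ _ (u z)); last by apply: Hz0; rewrite subr0.
  by rewrite /u lerDl mulr_ge0 ?sqr_ge0// ltW.
have [z0r'|z0r'] := eqVneq (N z0) r.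
  apply: le_trans uz _; rewrite /u z0r' /eta divfK ?gt_eqF//.
  by rewrite lerD2r; exact: fB.
have {}z0r : N z0 < r by rewrite lt_neqAle z0r' z0r.
(* Differentiability may fail at 0, so the punctured disk about [z0] must avoid 0. *)
have [rho [rho0 Hrho]] : exists rho : R, 0 < rho /\ forall y, 0 < N (y - z0) ->
  N (y - z0) < rho -> 0 < N y /\ N y < r.
  have [z00|z00] := eqVneq z0 0.
    by exists r; split => // y; rewrite z00 subr0.
  have nz0 : 0 < N z0 by rewrite N_gt0.
  exists (Num.min (N z0) (r - N z0)); split; first by rewrite lt_min nz0; lra.
  move=> y _; rewrite lt_min => /andP[y1 y2].
  have := N_rtri z0 y; have := N_rtri y z0; rewrite (NB z0 y); lra.
have [c [c1 cz0]] := unit_dir (f z0).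
pose H y := c * f y + 2%:R * eta%:K * conjc z0 * y.
pose dl := rho / 2.
have dl0 : 0 < dl by rewrite divr_gt0.
have cz : ccont (fun y : R[i] => 2%:R * eta%:K * conjc z0 * y) z0.
  exact: cder_ccont (cderMl _ (cder_id z0)).
have key (y : R[i]) : Re (2%:R * eta%:K * conjc z0 * y) =
  eta * (N y ^+ 2 + N z0 ^+ 2 - N (y - z0) ^+ 2).
  rewrite !Nsq (_ : 2%:R = (2 : R)%:K); last by rewrite rmorph_nat.
  by rewrite !ReImE; ring.
have : Re (H z0) <= Re (H z0) - eta * dl ^+ 2.
  apply: (@mean_ineq _ H z0 dl rho) => //; first by rewrite /dl; lra.
  - move=> e' e'0; have e2 : 0 < e' / 2 by rewrite divr_gt0.
    have [d1 [d10 H1]] := cf z0 (ltW z0r) _ e2; have [d2 [d20 H2]] := cz _ e2.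
    exists (Num.min d1 d2); split; first by rewrite lt_min d10.
    move=> k; rewrite lt_min => /andP[/H1 k1 /H2 k2].
    have -> : H (z0 + k) - H z0 = c * (f (z0 + k) - f z0) +
      (2%:R * eta%:K * conjc z0 * (z0 + k) - 2%:R * eta%:K * conjc z0 * z0) by rewrite /H; ring.
    by apply: le_trans (ND _ _) _; rewrite NM c1 mul1r; lra.
  - move=> y y1 y2; have [y3 y4] := Hrho _ y1 y2; have [l hl] := df _ y3 y4.
    exists (c * l + 2%:R * eta%:K * conjc z0 * 1).
    by apply: cderD; apply: cderMl => //; exact: cder_id.
  - move=> y yd; rewrite /H !ReD !key cz0 subrr N0 yd Rek.
    have [y3 y4] := Hrho y ltac:(by rewrite yd) ltac:(by rewrite yd /dl; lra).
    have := Hz0 y; rewrite subr0 => /(_ (ltW y4)); rewrite /u.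
    have := Re_leN (c * f y); rewrite NM c1 mul1r.
    rewrite !expr0n /=; lra.
have : 0 < eta * dl ^+ 2 by rewrite mulr_gt0// exprn_gt0.
lra.
Qed.

Lemma powers_bounded_le1 (y K : R) : 0 <= y -> (forall n, y ^+ n <= K) -> y <= 1.
Proof.
move=> y0 H; rewrite leNgt; apply/negP => y1.
have B n : 1 + n%:R * (y - 1) <= y ^+ n.
  elim: n => [|n ih]; first by rewrite mul0r addr0 expr0.
  rewrite exprS -natr1; have : y * (1 + n%:R * (y - 1)) <= y * y ^+ n by rewrite ler_pM2l//; lra.
  have : 0 <= n%:R * (y - 1) * (y - 1) by rewrite !mulr_ge0//; lra.
  nra.
have K0 : 0 <= K by apply: le_trans (H 0%N); rewrite expr0.
have Ky : 0 <= K / (y - 1) by rewrite divr_ge0//; lra.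
have := archi_boundP Ky; set n := Num.bound _ => hn.
have := B n; have := H n; move: hn; rewrite ltr_pdivrMr; lra.
Qed.

(* The bound is obtained for all powers of [f z / z ^+ m], each multiplied by [z]
   to remove the singularity at 0. *)
Lemma schwarz_order f m (C d : R) :
  (forall z, N z < 1 -> exists l, cder f z l) ->
  (forall z, N z < 1 -> N (f z) <= 1) ->
  0 < d -> (forall z, N z < d -> N (f z) <= C * N z ^+ m) ->
  forall z, N z < 1 -> N (f z) <= N z ^+ m.
Proof.
move=> df f1 d0 fC z z1; have [z0|z0] := eqVneq z 0.
  have := fC 0; rewrite z0 N0 => /(_ d0); case: m {fC} => [|m]; rewrite ?expr0 ?mulr1.
    by move=> _; apply: f1; rewrite N0.
  by rewrite expr0n mulr0 => h.
have nz : 0 < N z by rewrite N_gt0.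
have nzm : 0 < N z ^+ m by rewrite exprn_gt0.
have key s : N z <= s -> s < 1 -> N (f z) / N z ^+ m * s ^+ m <= 1.
  move=> zs s1; have s0 : 0 < s by apply: lt_le_trans zs.
  have sm0 : 0 < s ^+ m by rewrite exprn_gt0.
  have sm0' := ltW sm0.
  apply: (@powers_bounded_le1 _ (N z)^-1).
    by rewrite mulr_ge0 ?divr_ge0 ?N_ge0// ltW.
  move=> n; pose g x := x * (f x / x ^+ m) ^+ n.
  have Ng x : N (g x) = N x * (N (f x) / N x ^+ m) ^+ n by rewrite /g NM NX NM NV NX.
  have dg x : 0 < N x -> N x < 1 -> exists l, cder g x l.
    move=> x0 x1; have [l hl] := df x x1.
    have xm : x ^+ m != 0 by rewrite expf_neq0// -N_gt0.
    by eexists; apply: cderM; [exact: cder_id|apply: cderX; apply: cder_div => //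
      ; [exact: hl|apply: cderX; exact: cder_id]].
  have C0 : 0 <= `|C| ^+ n by rewrite exprn_ge0.
  have g0 : ccont g 0.
    move=> e e0; have C1 : 0 < `|C| ^+ n + 1 by lra.
    exists (Num.min d (e / (`|C| ^+ n + 1))); split; first by rewrite lt_min d0 divr_gt0.
    move=> k; rewrite lt_min add0r => /andP[kd]; rewrite ltr_pdivlMr// => ke.
    rewrite {2}/g mul0r subr0 Ng; have [->|k0] := eqVneq k 0; first by rewrite N0 mul0r ltW.
    have nk : 0 < N k by rewrite N_gt0.
    have h : (N (f k) / N k ^+ m) ^+ n <= `|C| ^+ n.
      apply: lerXn2r; rewrite ?nnegrE ?divr_ge0 ?N_ge0 ?exprn_ge0 ?N_ge0//.
      rewrite ler_pdivrMr ?exprn_gt0//; apply: le_trans (fC k kd) _.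
      by rewrite ler_pM2r ?exprn_gt0// ler_norm.
    have : N k * (N (f k) / N k ^+ m) ^+ n <= N k * `|C| ^+ n by rewrite ler_pM2l.
    nra.
  have H' : N z * (N (f z) / N z ^+ m) ^+ n <= s * (1 / s ^+ m) ^+ n.
    rewrite -Ng; apply: (@max_modulus g s) => //.
    - move=> x xs; have [->|x0] := eqVneq x 0; first exact: g0.
      have [||l] := dg x; [by rewrite N_gt0|exact: le_lt_trans s1|exact: cder_ccont].
    - by move=> x x0 xs; apply: dg => //; exact: lt_trans s1.
    - move=> x xs; rewrite Ng xs ler_pM2l// lerXn2r// ?nnegrE ?divr_ge0 ?N_ge0//.
      by rewrite ler_pM2r ?invr_gt0//; apply: f1; rewrite xs.
  rewrite exprMn; set X := (N (f z) / _) ^+ n in H' *.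
  have smn : 0 < (s ^+ m) ^+ n by rewrite exprn_gt0.
  rewrite -[leRHS]mul1r ler_pdivlMr// mulrAC -[leRHS](mulVf (lt0r_neq0 smn)).
  rewrite ler_pM2r// mulrC; apply: le_trans H' _.
  rewrite div1r exprVn -[leRHS]mul1r ler_pM2r ?invr_gt0//; exact: ltW.
set X := N (f z) / N z ^+ m in key.
have X1 : X <= 1.
  rewrite leNgt; apply/negP => X1.
  have bern (s : R) : 0 <= s -> s <= 1 -> 1 - m%:R * (1 - s) <= s ^+ m.
    move=> s0 s1; elim: (m) => [|p ih]; first by rewrite mul0r subr0 expr0.
    rewrite exprS -natr1; have : s * (1 - p%:R * (1 - s)) <= s * s ^+ p by rewrite ler_wpM2l.
    have : 0 <= p%:R * (1 - s) * (1 - s) by rewrite !mulr_ge0//; lra.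
    nra.
  have m1 : 0 < m%:R + 1 :> R by rewrite ltr_wpDl.
  (* By Bernoulli, [key] at [s = 1 - t] gives [X * (1 - m * t) <= 1], which
     [t * (m + 1) <= (X - 1) / X] contradicts. *)
  pose t := Num.min (1 - N z) ((X - 1) / X / (m%:R + 1)).
  have X0 : 0 < X by lra.
  have t0 : 0 < t.
    rewrite lt_min; apply/andP; split; first lra.
    by apply: divr_gt0 => //; apply: divr_gt0 => //; lra.
  have tz : t <= 1 - N z by rewrite ge_min lexx.
  have tX : t * (m%:R + 1) <= (X - 1) / X by rewrite -ler_pdivlMr// ge_min lexx orbT.
  have b1 := bern (1 - t) ltac:(lra) ltac:(lra); rewrite -(ler_pM2l X0) in b1.
  have b2 := le_trans b1 (key (1 - t) ltac:(lra) ltac:(lra)).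
  have : t * (m%:R + 1) * X <= X - 1 by rewrite -ler_pdivlMr.
  have : 0 < t * X by rewrite mulr_gt0.
  lra.
by move: X1; rewrite /X ler_pdivrMr// mul1r.
Qed.

Lemma schwarz f : (forall z, N z < 1 -> exists l, cder f z l) ->
  (forall z, N z < 1 -> N (f z) <= 1) -> f 0 = 0 ->
  forall z, N z < 1 -> N (f z) <= N z.
Proof.
move=> df f1 f0 z z1; have [l /cder_lip[d [d0 Hd]]] := df 0 ltac:(by rewrite N0).
rewrite -[leRHS]expr1; apply: (@schwarz_order f 1 (N l + 1) d) => // k kd.
by have := Hd k kd; rewrite add0r f0 subr0 expr1.
Qed.

Lemma schwarz_deriv f l : (forall z, N z < 1 -> exists l, cder f z l) ->
  (forall z, N z < 1 -> N (f z) <= 1) -> f 0 = 0 -> cder f 0 l -> N l <= 1.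
Proof.
move=> df f1 f0 hl; apply/ler_addgt0Pr => e e0; have [d [d0 Hd]] := hl e e0.
pose t := Num.min (d / 2) (1 / 2); have t0 : 0 < t by rewrite lt_min; apply/andP; split; lra.
have td : t < d by rewrite gt_min; apply/orP; left; lra.
have t1 : t < 1 by rewrite gt_min; apply/orP; right; lra.
have Nt : N t%:K = t by rewrite Npos// ltW.
have := Hd t%:K; rewrite Nt add0r f0 subr0 => /(_ td) h.
have := schwarz df f1 f0 (z := t%:K); rewrite Nt => /(_ t1) h2.
have := N_rtri (l * t%:K) (f t%:K); rewrite NB NM Nt => h3.
rewrite -(ler_pM2r t0); lra.
Qed.

(** [mean_ineq] for the difference quotient at [a], continued there by [l] and rotated so that its
    central value is [N l]. *)
Lemma cauchy_bound f a l (r rho M : R) : 0 < r -> r < rho ->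
  (forall z, N (z - a) < rho -> exists l, cder f z l) -> cder f a l ->
  (forall z, N (z - a) = r -> N (f z - f a) <= M) -> N l <= M / r.
Proof.
move=> r0 rr df hl fM.
have [c [c1 cl]] := unit_dir l.
pose H z := c * (if z == a then l else (f z - f a) / (z - a)).
have -> : N l = Re (H a) by rewrite /H eqxx cl.
apply: (@mean_ineq _ H a r rho) => //.
- move=> e e0; have [d [d0 Hd]] := hl e e0; exists d; split => // k kd.
  have [->|k0] := eqVneq k 0; first by rewrite addr0 subrr N0 ltW.
  have nk : 0 < N k by rewrite N_gt0.
  rewrite /H eqxx (_ : a + k == a = false); last by rewrite -subr_eq0 addrAC subrr add0r;
    apply/negbTE.
  rewrite -mulrBr NM c1 mul1r -(ler_pM2r nk) -NM.
  have -> : ((f (a + k) - f a) / (a + k - a) - l) * k = f (a + k) - f a - l * k.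
    by rewrite addrAC subrr add0r; field.
  exact: Hd.
- move=> z z0 zr; have [m hm] := df z zr.
  have za : z - a != 0 by rewrite -N_gt0.
  have D : cder (fun x => c * ((f x - f a) / (x - a))) z
      (c * (((m - 0) * (z - a) - (f z - f a) * (1 - 0)) / (z - a) ^+ 2)).
    apply: cderMl; apply: (@cder_div _ (fun x => f x - f a) (fun x => x - a)) => //.
      by apply: cderB => //; exact: cder_cst.
    by apply: cderB; [exact: cder_id|exact: cder_cst].
  eexists; apply: cder_near D; first exact: z0.
  move=> k kz; rewrite /H; case: eqP => // E.
  by move: kz; rewrite -E opprD addrA subrr sub0r NN ltxx.
- move=> z zr; apply: le_trans (Re_leN _) _; rewrite /H NM c1 mul1r.
  case: eqP => [E|_]; first by move: zr; rewrite E subrr N0 => E0; move: r0; rewrite -E0 ltxx.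
  by rewrite NM NV zr ler_pM2r ?invr_gt0//; exact: fM.
Qed.

Lemma is_derive_line f (c w v : R[i]) (t : R) l : cder f (w + t%:K * v) l ->
  is_derive t 1 (fun t : R => Re (c * f (w + t%:K * v))) (Re (c * (l * v))).
Proof.
move=> hl; apply/is_derive_limP => e e0.
have b0 : 0 < (N c + 1) * (N v + 1) by rewrite mulr_gt0 ?ltr_wpDl ?N_ge0.
have v0 : 0 < N v + 1 by rewrite ltr_wpDl ?N_ge0.
have [d [d0 Hd]] := hl (e / ((N c + 1) * (N v + 1))) ltac:(by rewrite divr_gt0).
exists (d / (N v + 1)); split; first by rewrite divr_gt0.
move=> k; rewrite ltr_pdivlMr// => kd.
have nkv : N (k%:K * v) <= `|k| * (N v + 1) by rewrite NM Nreal ler_wpM2l// lerDl.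
have := Hd _ (le_lt_trans nkv kd).
have -> : w + t%:K * v + k%:K * v = w + (t + k)%:K * v by rewrite rmorphD /=; ring.
move=> h; apply: (@le_trans _ _ (N (c * (f (w + (t + k)%:K * v) - f (w + t%:K * v) - l * (k%:K * v))))).
  apply: le_trans (Re_le _); rewrite !ReImE.
  by rewrite le_eqVlt; apply/orP; left; apply/eqP; congr `|_|; ring.
rewrite NM; apply: le_trans (ler_wpM2l (N_ge0 c) h) _.
have -> : e * `|k| = (N c + 1) * (e / ((N c + 1) * (N v + 1)) * (`|k| * (N v + 1))).
  by field; rewrite !gt_eqF// ltr_wpDl ?N_ge0.
apply: ler_pM; rewrite ?N_ge0 ?lerDl//.
  by rewrite mulr_ge0 ?N_ge0// divr_ge0 ?ltW.
by rewrite ler_pM2l// divr_gt0.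
Qed.

Lemma mean_value_le f (w v : R[i]) (L : R) :
  (forall t : R, 0 <= t <= 1 -> exists l, cder f (w + t%:K * v) l /\ N l <= L) ->
  N (f (w + v) - f w) <= L * N v.
Proof.
move=> df; have [c [c1 cf]] := unit_dir (f (w + v) - f w).
have [D HD] : exists D : R -> R[i], forall t : R, 0 <= t <= 1 ->
  cder f (w + t%:K * v) (D t) /\ N (D t) <= L.
  have H t : exists l, 0 <= t <= 1 -> cder f (w + t%:K * v) l /\ N l <= L.
    by have [/df[l hl]|h] := boolP (0 <= t <= 1); [exists l|exists 0].
  by have [D HD] := choice H; exists D.
have dg (t : R) : 0 <= t <= 1 ->
  is_derive t 1 (fun t : R => Re (c * f (w + t%:K * v))) (Re (c * (D t * v))).
  by move=> /HD[h _]; exact: is_derive_line.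
have cg (t : R) : 0 <= t <= 1 -> {for t, continuous (fun t : R => Re (c * f (w + t%:K * v)))}.
  by move=> /dg h; apply/differentiable_continuous/derivable1_diffP.
have [| |t] := @MVT R (fun t :
  R => Re (c * f (w + t%:K * v))) (fun t => Re (c * (D t * v))) 0 1 ltr01.
- by move=> x; rewrite in_itv /= => /andP[h1 h2]; apply: dg; lra.
- apply/continuous_within_itvP => //; split.
  + by move=> x; rewrite in_itv /= => /andP[h1 h2]; apply: cg; lra.
  + by apply: cvg_at_right_filter; apply: cg; lra.
  + by apply: cvg_at_left_filter; apply: cg; lra.
rewrite in_itv /= => /andP[t0 t1];
  rewrite subr0 mulr1 rmorph0 rmorph1 mul0r mul1r addr0 -ReN -ReD -mulrBr cf Rek => ->.
apply: le_trans (Re_leN _) _; rewrite !NM c1 mul1r ler_wpM2r ?N_ge0//.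
by have [] := HD t ltac:(lra).
Qed.

(** A Cauchy criterion with a rate: all lower bounds [q k - C * N k] lie below all upper bounds
    [q l + C * N l], and the supremum of the former is the limit. *)
Lemma real_squeeze (q : R[i] -> R) (d C : R) : 0 < d ->
  (forall k l, 0 < N k -> N k < d -> 0 < N l -> N l < d -> q k - q l <= C * (N k + N l)) ->
  exists x, forall k, 0 < N k -> N k < d -> `|q k - x| <= C * N k.
Proof.
move=> d0 H; pose S := [set y | exists k, [/\ 0 < N k, N k < d & y = q k - C * N k]].
have ub l : 0 < N l -> N l < d -> ubound S (q l + C * N l).
  by move=> l0 ld _ [k [k0 kd ->]]; have := H k l k0 kd l0 ld; lra.
pose k1 : R[i] := (d / 2)%:K.
have nk1 : N k1 = d / 2 by rewrite Npos// ltW// divr_gt0.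
have hs : has_sup S.
  split; first by exists (q k1 - C * N k1), k1; rewrite nk1; split => //; lra.
  by exists (q k1 + C * N k1); apply: ub; rewrite nk1; lra.
exists (sup S) => k k0 kd; rewrite ler_norml.
have h1 : q k - C * N k <= sup S by apply: sup_upper_bound => //; exists k.
have h2 : sup S <= q k + C * N k by apply: ge_sup; [case: hs|exact: ub].
by apply/andP; split; lra.
Qed.

Lemma complex_squeeze (q : R[i] -> R[i]) (d C : R) : 0 < d ->
  (forall k l, 0 < N k -> N k < d -> 0 < N l -> N l < d -> N (q k - q l) <= C * (N k + N l)) ->
  exists x, forall k, 0 < N k -> N k < d -> N (q k - x) <= 2 * C * N k.
Proof.
move=> d0 H.
have [|x Hx] := @real_squeeze (fun k => Re (q k)) d C d0.
  by move=> k l k0 kd l0 ld; rewrite -ReN -ReD; apply: le_trans (Re_leN _) (H _ _ _ _ _ _).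
have [|y Hy] := @real_squeeze (fun k => Im (q k)) d C d0.
  move=> k l k0 kd l0 ld; rewrite -ImN -ImD.
  exact: le_trans (ler_norm _) (le_trans (Im_le _) (H _ _ _ _ _ _)).
exists (x +i* y)%C => k k0 kd; apply: le_trans (N_leD _) _; rewrite !ReImE /=.
have := Hx k k0 kd; have := Hy k k0 kd; lra.
Qed.

(** [cauchy_bound] is used three times on shrinking disks. A bound on [f] bounds [D]; small
    increments of [f] then make [D] Lipschitz, whence a second-order Taylor remainder [D3]; so the
    difference [g] of two difference quotients of [f], with steps [k] and [l], is [O(N k + N l)].
    The derivative of [g] at [a] is [q k - q l], hence the difference quotients [q] of [D]
    converge. *)
Lemma cder_unit_disk_deriv f (D : R[i] -> R[i]) : (forall z, N z < 1 -> cder f z (D z)) ->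
  forall a, N a < 1 -> exists l, cder D a l.
Proof.
move=> df a a1; pose r := (1 - N a) / 5; have r0 : 0 < r by rewrite /r; lra.
have inD z : N (z - a) < 5 * r -> N z < 1.
  by have := N_rtri z (- a); rewrite NN opprK /r; have := N_rtri z a; lra.
have df' z : N (z - a) < 5 * r -> exists l, cder f z l by move=> /inD/df; exists (D z).
have tri x y z : N (x - z) <= N (x - y) + N (y - z).
  by apply: le_trans (ND _ _); rewrite addrA subrK.
have [x [_ Hx]] : exists x, N (x - a) <= 4 * r /\ forall y, N (y - a) <= 4 * r ->
  N (f y) <= N (f x).
  apply: EVT_ball => [|x xr e e0]; first lra.
  have [d [d0 Hd]] := ccont_N (cder_ccont (df x (inD x ltac:(lra)))) e0.
  by exists d; split => // y _; exact: Hd.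
pose M := N (f x).
have fM z : N (z - a) <= 4 * r -> N (f z) <= M by exact: Hx.
have M0 : 0 <= M by exact: N_ge0.
pose L1 := 2 * M / r.
have D1 z : N (z - a) <= 3 * r -> N (D z) <= L1.
  move=> zr; apply: (@cauchy_bound f z (D z) r (2 * r)) => //; first lra.
  - by move=> w wr; apply: df'; have := tri w z a; lra.
  - by apply: df; apply: inD; lra.
  - move=> w wr; apply: le_trans (N_tri _ _) _.
    have := fM w; have := fM z; have := tri w z a; lra.
have L10 : 0 <= L1 by apply: divr_ge0; [exact: mulr_ge0|exact: ltW].
have seg w v (t s : R) : N (w - a) <= s -> N (w + v - a) <= s -> 0 <= t <= 1 ->
  N (w + t%:K * v - a) <= s.
  move=> h1 h2 /andP[t0 t1].
  have -> : w + t%:K * v - a = (1 - t)%:K * (w - a) + t%:K * (w + v - a).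
    by rewrite rmorphB rmorph1; ring.
  by apply: le_trans (ND _ _) _; rewrite !NM !Npos ?subr_ge0//; nra.
have f2 z k : N (z - a) <= 3 * r -> N (z + k - a) <= 3 * r -> N (f (z + k) - f z) <= L1 * N k.
  move=> h1 h2; apply: mean_value_le => t t01; have h3 := seg _ _ _ _ h1 h2 t01.
  by exists (D (z + t%:K * k)); split; [apply: df; apply: inD; lra|exact: D1].
have sh z k : N (z + k - a) <= N (z - a) + N k by rewrite addrAC ND.
have cder_shift z k : N (z + k) < 1 -> cder (fun w => f (w + k)) z (D (z + k)).
  move=> h; rewrite -[D _]mulr1; apply: cder_comp; last exact: df.
  by rewrite -[1]addr0; apply: cderD; [exact: cder_id|exact: cder_cst].
pose L2 := 2 * L1 / r.
have D2 z k : N (z - a) <= r -> N k <= r -> N (D (z + k) - D z) <= L2 * N k.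
  move=> zr kr.
  have -> : L2 * N k = 2 * L1 * N k / r by rewrite /L2; field; rewrite gt_eqF.
  apply: (@cauchy_bound (fun w => f (w + k) - f w) z _ r (2 * r)) => //; first lra.
  - move=> w wr; have h := tri w z a; have h2 := sh w k.
    by eexists; apply: cderB; [apply: cder_shift|apply: df]; apply: inD; lra.
  - by have h2 := sh z k; apply: cderB; [apply: cder_shift|apply: df]; apply: inD; lra.
  - move=> w wr; apply: le_trans (N_tri _ _) _; have h := tri w z a; have h2 := sh w k.
    have h3 := sh z k.
    have := f2 w k ltac:(lra) ltac:(lra); have := f2 z k ltac:(lra) ltac:(lra); lra.
have L20 : 0 <= L2 by apply: divr_ge0; [exact: mulr_ge0|exact: ltW].
have D3 z k : N (z - a) <= r / 2 -> N k <= r / 2 -> N (f (z + k) - f z - D z * k) <= L2 * N k * N k.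
  move=> zr kr.
  have := @mean_value_le (fun w => f w - D z * w) z k (L2 * N k).
  have -> : f (z + k) - D z * (z + k) - (f z - D z * z) = f (z + k) - f z - D z * k by ring.
  apply=> t /andP[t0 t1].
  have ntk : N (t%:K * k) <= N k by rewrite NM Npos// ler_piMl ?N_ge0.
  exists (D (z + t%:K * k) - D z); split.
    rewrite -[X in _ - X]mulr1; apply: cderB; last by apply: cderMl; exact: cder_id.
    by apply: df; apply: inD; have := sh z (t%:K * k); lra.
  by apply: le_trans (D2 z (t%:K * k) _ _) _; [lra|lra|rewrite ler_wpM2l].
pose q k := k^-1 * (D (a + k) - D a).
have q2 k l : 0 < N k -> N k < r / 2 -> 0 < N l -> N l < r / 2 ->
    N (q k - q l) <= 4 * L2 / r * (N k + N l).
  move=> k0 kr l0 lr; have k0' : k != 0 by rewrite -N_gt0.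
  have l0' : l != 0 by rewrite -N_gt0.
  have -> : 4 * L2 / r * (N k + N l) = 2 * (L2 * (N k + N l)) / (r / 2) by field; rewrite gt_eqF.
  pose g w := k^-1 * (f (w + k) - f w) - l^-1 * (f (w + l) - f w).
  have gb z : N (z - a) <= r / 2 -> N (g z) <= L2 * (N k + N l).
    move=> zr.
    have -> : g z = k^-1 * (f (z + k) - f z - D z * k) - l^-1 * (f (z + l) - f z - D z * l).
      by rewrite /g; field; apply/andP.
    apply: le_trans (N_tri _ _) _; rewrite !NM !NV mulrDr.
    by apply: lerD; rewrite mulrC ler_pdivrMr//; apply: D3 => //; exact: ltW.
  have dg z : N (z - a) < 3 * r ->
      cder g z (k^-1 * (D (z + k) - D z) - l^-1 * (D (z + l) - D z)).
    move=> zr; have h1 := sh z k; have h2 := sh z l.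
    apply: cderB; apply: cderMl; apply: cderB;
      [apply: cder_shift|apply: df|apply: cder_shift|apply: df];
      apply: inD; lra.
  apply: (@cauchy_bound g a _ (r / 2) r); [lra|lra| | |].
  - by move=> z zr; eexists; apply: dg; lra.
  - by apply: dg; rewrite subrr N0; lra.
  - move=> z zr; apply: le_trans (N_tri _ _) _.
    have := gb z ltac:(lra); have := gb a ltac:(rewrite subrr N0; lra); lra.
have [x' Hx'] := complex_squeeze (d := r / 2) ltac:(lra) q2.
exists x' => e e0; set C := 2 * (4 * L2 / r) in Hx'.
have C0 : 0 <= C by apply: mulr_ge0 => //; apply: divr_ge0; [exact: mulr_ge0|exact: ltW].
have C1 : 0 < C + 1 by lra.
exists (Num.min (r / 2) (e / (C + 1))); split.
  by rewrite lt_min; apply/andP; split; [lra|exact: divr_gt0].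
move=> k; rewrite lt_min => /andP[kr]; rewrite ltr_pdivlMr// => ke.
have [->|k0] := eqVneq k 0; first by rewrite addr0 subrr mulr0 subr0 !N0 mulr0.
have nk : 0 < N k by rewrite N_gt0.
have -> : D (a + k) - D a - x' * k = (q k - x') * k by rewrite /q; field.
have h := Hx' k nk kr; rewrite NM ler_pM2r//; nra.
Qed.

End MaxPrinciple.

(** * Openness of maps with positive Jacobian *)

Section OpenMapping.
Variable R : realType.
Implicit Types (z w k : R[i]) (f : R[i] -> R[i]).

(* Real differentiability with Wirtinger derivatives [a = f_z], [b = f_{conj z}]. *)
Definition rder f z (a b : R[i]) := forall e : R, 0 < e -> exists d : R, 0 < d /\
  forall k, N k < d -> N (f (z + k) - f z - (a * k + b * conjc k)) <= e * N k.

Lemma rder_harm (h g : R[i] -> R[i]) mu z a b : cder h z a -> cder g z b ->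
  rder (fun x => h x + mu * conjc (g x)) z a (mu * conjc b).
Proof.
move=> hh hg e e0; have m0 : 0 < N mu + 1 by rewrite ltr_wpDl ?N_ge0.
have [d1 [d10 H1]] := hh (e / 2) ltac:(by rewrite divr_gt0).
have [d2 [d20 H2]] := hg (e / 2 / (N mu + 1)) ltac:(by rewrite divr_gt0// divr_gt0).
exists (Num.min d1 d2); split; first by rewrite lt_min d10.
move=> k; rewrite lt_min => /andP[/H1 k1 /H2 k2].
have -> : h (z + k) + mu * conjc (g (z + k)) - (h z + mu * conjc (g z)) - (a * k + mu * conjc b * conjc k)
  = (h (z + k) - h z - a * k) + mu * conjc (g (z + k) - g z - b * k).
  by rewrite !rmorphB rmorphM /=; ring.
apply: le_trans (ND _ _) _; rewrite NM Nconj.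
have : N mu * N (g (z + k) - g z - b * k) <= (N mu + 1) * (e / 2 / (N mu + 1) * N k).
  by apply: ler_pM => //; rewrite ?N_ge0 ?lerDl.
have -> : (N mu + 1) * (e / 2 / (N mu + 1) * N k) = e / 2 * N k by field; rewrite gt_eqF.
lra.
Qed.

Lemma rder_cder f z a : cder f z a -> rder f z a 0.
Proof.
move=> H e /H[d [d0 Hd]]; exists d; split => // k /Hd.
by rewrite mul0r addr0.
Qed.

Lemma rder_ccont f z a b : rder f z a b -> ccont f z.
Proof.
move=> /(_ 1 ltr01)[d [d0 Hd]] e e0.
have s0 : 0 < N a + N b + 1 by have := N_ge0 a; have := N_ge0 b; lra.
exists (Num.min d (e / (N a + N b + 1))); split; first by rewrite lt_min d0 divr_gt0.
move=> k; rewrite lt_min => /andP[/Hd h1]; rewrite ltr_pdivlMr// => h2.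
have -> : f (z + k) - f z =
  (f (z + k) - f z - (a * k + b * conjc k)) + (a * k + b * conjc k) by rewrite subrK.
apply: le_trans (ND _ _) _; have := ND (a * k) (b * conjc k); rewrite !NM Nconj; lra.
Qed.

Lemma rder_expand f z a b : N b < N a -> rder f z a b -> exists d : R, 0 < d /\
  forall k, N k < d -> (N a - N b) / 2 * N k <= N (f (z + k) - f z).
Proof.
move=> ba H; have [|d [d0 Hd]] := H ((N a - N b) / 2); first lra.
exists d; split => // k /Hd h.
have := N_rtri (a * k) (- (b * conjc k)); rewrite opprK NN !NM Nconj.
have := N_rtri (a * k + b * conjc k) (f (z + k) - f z); rewrite (NB (a * k + _)); lra.
Qed.

(* Surjectivity near [f z0]: the minimum of [|f - w|] over a small disk is
   interior, and a nonzero interior minimum is excluded by invertibility of the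
   real differential. *)
Lemma open_mapping f z0 (rho : R) : 0 < rho ->
  (forall z, N (z - z0) < rho -> exists a b, N b < N a /\ rder f z a b) ->
  exists d : R, 0 < d /\ forall w, N (w - f z0) < d -> exists z, N (z - z0) < rho /\ f z = w.
Proof.
move=> rho0 df; have [|a [b [ba H0]]] := df z0; first by rewrite subrr N0.
have [d [d0 Hd]] := rder_expand ba H0.
pose J := (N a - N b) / 2; have J0 : 0 < J by rewrite /J; lra.
pose r := Num.min d rho / 2.
have [r0 rd rr] : [/\ 0 < r, r < d & r < rho].
  have m0 : 0 < Num.min d rho by rewrite lt_min d0.
  have m1 : Num.min d rho <= d by rewrite ge_min lexx.
  have m2 : Num.min d rho <= rho by rewrite ge_min lexx orbT.
  by rewrite /r; split; lra.
have Jr : 0 < J * r by rewrite mulr_gt0.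
exists (J * r / 2); split; first lra.
move=> w wz.
have [z [zr Hz]] : exists z, N (z - z0) <= r /\ forall y, N (y - z0) <= r ->
  - N (f y - w) <= - N (f z - w).
  apply: EVT_ball => [|x xr e e0]; first exact: ltW.
  have [a' [b' [_ /rder_ccont cf]]] := df x (le_lt_trans xr rr).
  have [|d' [d'0 Hd']] := @ccont_N _ (fun x => f x - w) x _ e e0.
    move=> e' /cf[d' [d'0 Hd']]; exists d'; split => // k /Hd'.
    by rewrite opprB addrA subrK.
  by exists d'; split => // y _ /Hd' h; rewrite -normrN opprD !opprK.
have zw : N (f z - w) <= N (f z0 - w) by rewrite -lerN2; apply: Hz; rewrite subrr N0 ltW.
(* On the circle [f] is at distance at least [J * r] from [f z0], while [w] is within [J * r / 2] of
   [f z0]; a minimum there would exceed the value at the centre. *)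
have {}zr : N (z - z0) < r.
  rewrite lt_neqAle zr andbT; apply/eqP => E.
  have := Hd (z - z0); rewrite E => /(_ rd); rewrite [z0 + _]addrC subrK -/J.
  have := ND (f z - w) (w - f z0); rewrite addrA subrK.
  by rewrite (NB (f z0)) in zw; lra.
exists z; split; first exact: lt_trans rr.
apply/eqP; rewrite -subr_eq0; apply: contrapT => /negP v0.
have {}v0 : 0 < N (f z - w) by rewrite N_gt0.
set v := f z - w in v0 zw Hz.
have [a' [b' [ba' H1]]] := df z (lt_trans zr rr).
pose D := N a' ^+ 2 - N b' ^+ 2.
have D0 : D != 0.
  have h1 : 0 < N a' - N b' by lra.
  have h2 : 0 < N a' + N b' by have := N_ge0 b'; lra.
  by rewrite /D subr_sqr gt_eqF// mulr_gt0.
(* Cramer's rule for the real-linear equation [a' * k + b' * conjc k = - v], with determinant the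
   Jacobian [D]. A short step along [k] brings [f] closer to [w]. *)
pose k := (conjc a' * (- v) - b' * conjc (- v)) * (D^-1)%:K.
have kE : a' * k + b' * conjc k = - v.
  have E : conjc k = (a' * conjc (- v) - conjc b' * (- v)) * (D^-1)%:K.
    by rewrite /k rmorphM rmorphB !rmorphM /= !conjcK; congr (_ * _); apply: cpx_eq;
      rewrite !ReImE ?oppr0.
  have -> : a' * k + b' * conjc k = (a' * conjc a' - b' * conjc b') * (- v) * (D^-1)%:K.
    by rewrite E /k; ring.
  by rewrite !mul_conj -rmorphB mulrAC -rmorphM -/D divff// mul1r.
have nk : 0 < N k + 1 by rewrite ltr_wpDl ?N_ge0.
have [d2 [d20 Hd2]] := H1 (N v / 2 / (N k + 1)) ltac:(by apply: divr_gt0 => //; exact: divr_gt0).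
pose t := Num.min (Num.min (d2 / (N k + 1)) ((r - N (z - z0)) / (N k + 1))) 1.
have t0 : 0 < t.
  by rewrite !lt_min ltr01 andbT; apply/andP; split; apply: divr_gt0 => //; lra.
have [t1 t2 t3] : [/\ t * (N k + 1) <= d2, t * (N k + 1) <= r - N (z - z0) & t <= 1].
  by split; rewrite -?ler_pdivlMr// /t !ge_min lexx ?orbT.
have tk : N (t%:K * k) = t * N k by rewrite NM Npos// ltW.
have tk1 : t * N k < t * (N k + 1) by rewrite ltr_pM2l// ltrDl.
have := Hd2 (t%:K * k); rewrite tk => /(_ ltac:(lra)).
have -> : a' * (t%:K * k) + b' * conjc (t%:K * k) = - (t%:K * v).
  by rewrite -mulrN -kE conjM conjk; ring.
rewrite opprK => h1.
have h2 : N v <= N (f (z + t%:K * k) - w).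
  rewrite -lerN2; apply: Hz; have -> : z + t%:K * k - z0 = (z - z0) + t%:K * k by ring.
  by apply: le_trans (ND _ _) _; rewrite tk; lra.
have h3 : N (f (z + t%:K * k) - w) <= N (f (z + t%:K * k) - f z + t%:K * v) + (1 - t) * N v.
  have -> : f (z + t%:K * k) - w = (f (z + t%:K * k) - f z + t%:K * v) + (1 - t)%:K * v.
    by rewrite rmorphB rmorph1 /v; ring.
  by apply: le_trans (ND _ _) _; rewrite [N (_ * v)]NM Npos//; lra.
have h4 : N v / 2 / (N k + 1) * (t * N k) <= t * (N v / 2).
  have -> : t * (N v / 2) = N v / 2 / (N k + 1) * (t * (N k + 1)) by field; rewrite gt_eqF.
  by rewrite ler_pM2l; [exact: ltW|apply: divr_gt0 => //; exact: divr_gt0].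
have : 0 < t * N v by rewrite mulr_gt0.
lra.
Qed.

Definition univ f := forall z w, N z < 1 -> N w < 1 -> f z = f w -> z = w.

Definition regular f := forall z, N z < 1 -> exists a b, N b < N a /\ rder f z a b.

Definition convex_image f := forall z w (t : R), N z < 1 -> N w < 1 -> 0 <= t <= 1 ->
  exists x, N x < 1 /\ f x = (1 - t)%:K * f z + t%:K * f w.

Lemma open_image f z0 (r : R) : regular f -> N z0 < 1 -> 0 < r -> exists d : R, 0 < d /\
  forall w, N (w - f z0) < d -> exists z, [/\ N z < 1, N (z - z0) < r & f z = w].
Proof.
move=> rf z01 r0; pose rho := Num.min r (1 - N z0).
have rho0 : 0 < rho by rewrite lt_min r0; lra.
have disk z : N (z - z0) < rho -> N z < 1.
  by rewrite lt_min => /andP[_]; have := N_rtri z z0; lra.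
have [|d [d0 Hd]] := @open_mapping f z0 rho rho0.
  by move=> z /disk; exact: rf.
exists d; split => // w /Hd[z [zr zw]]; exists z; split => //; first exact: disk.
by apply: lt_le_trans zr _; rewrite ge_min lexx.
Qed.

Lemma inverse_continuous f z0 (r : R) : regular f -> univ f -> N z0 < 1 -> 0 < r ->
  exists d : R, 0 < d /\ forall z, N z < 1 -> N (f z - f z0) < d -> N (z - z0) < r.
Proof.
move=> rf uf z01 r0; have [d [d0 Hd]] := open_image rf z01 r0.
exists d; split => // z z1 /Hd[z' [z'1 z'r E]].
by rewrite -(uf _ _ z'1 z1 E).
Qed.

End OpenMapping.

(** * From harmonic to analytic convex maps *)

Section Stable.
Variable R : realType.
Implicit Types (z w k : R[i]).
Variables h g Dh Dg : R[i] -> R[i].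
Hypothesis dh : forall z, N z < 1 -> cder h z (Dh z).
Hypothesis dg : forall z, N z < 1 -> cder g z (Dg z).
Hypothesis sense : forall z, N z < 1 -> N (Dg z) < N (Dh z).

Definition hconj (mu : R[i]) z := h z + mu * conjc (g z).
Definition hlin (eps : R[i]) z := h z + eps * g z.

Hypothesis stable : forall mu, N mu = 1 -> univ (hconj mu) /\ convex_image (hconj mu).

Lemma regular_hconj mu : N mu = 1 -> regular (hconj mu).
Proof.
move=> mu1 z z1; exists (Dh z), (mu * conjc (Dg z)); split.
  by rewrite NM mu1 mul1r Nconj; exact: sense.
by apply: rder_harm; [exact: dh|exact: dg].
Qed.

Lemma cder_hlin eps z : N z < 1 -> cder (hlin eps) z (Dh z + eps * Dg z).
Proof. by move=> z1; apply: cderD; [exact: dh|apply: cderMl; exact: dg]. Qed.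

Lemma hlin_neq0 eps z : N eps = 1 -> N z < 1 -> Dh z + eps * Dg z != 0.
Proof.
move=> e1 /sense h1; rewrite -N_gt0; have := N_rtri (Dh z) (- (eps * Dg z)).
by rewrite opprK NN NM e1 mul1r; lra.
Qed.

(** This makes the right side of [shear_increment] positive. With [eta] a third of the gap, the two
    first-order errors leave a margin [eta * N k]. *)
Lemma increment_lt z : N z < 1 -> exists d : R, 0 < d /\ forall k, 0 < N k -> N k < d ->
  N (g (z + k) - g z) < N (h (z + k) - h z).
Proof.
move=> z1; pose eta := (N (Dh z) - N (Dg z)) / 3.
have eta0 : 0 < eta by have := sense z1; rewrite /eta; lra.
have [d1 [d10 H1]] := dh z1 eta0; have [d2 [d20 H2]] := dg z1 eta0.
exists (Num.min d1 d2); split; first by rewrite lt_min d10.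
move=> k k0; rewrite lt_min => /andP[/H1 k1 /H2 k2].
have := ND (g (z + k) - g z - Dg z * k) (Dg z * k); rewrite subrK NM.
have := N_tri (h (z + k) - h z) (h (z + k) - h z - Dh z * k); rewrite subKr NM.
have E : N (Dh z) = N (Dg z) + 3 * eta by rewrite /eta; field.
rewrite E; have : 0 < eta * N k by rewrite mulr_gt0.
lra.
Qed.

Variables (eps d : R[i]).
Hypotheses (eps1 : N eps = 1) (d1 : N d = 1).
(** The solution of [d * mu = - conjc (eps * d)]. Then [d * f = d * h - conjc (eps * d * g)] and
    [d * F = d * h + eps * d * g] have the same imaginary part, so both maps send a point to the
    same line of direction [conjc d]. *)
Let mu := - conjc eps * conjc d ^+ 2.
Let f := hconj mu.
Let F := hlin eps.

Lemma mu1 : N mu = 1.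
Proof. by rewrite /mu NM NN NX !Nconj eps1 d1 expr1n mul1r. Qed.

Let dmu : d * mu = - conjc (eps * d).
Proof.
have dd : d * conjc d = 1 by rewrite mul_conj d1 expr1n.
by rewrite /mu conjM expr2 -[RHS]mulr1 -dd; ring.
Qed.

Let dfE z : d * f z = d * h z - conjc (eps * d * g z).
Proof. by rewrite /f /hconj mulrDr mulrA dmu conjM; ring. Qed.

Let Im_dfE z : Im (d * f z) = Im (d * F z).
Proof. by rewrite dfE /F /hlin !ReImE; ring. Qed.

(* With [d * (f z - f w) = tau] real, [d * (F z - F w) = A + B] where
   [A - conj B = tau], so that [tau * Re (A + B) = |A|^2 - |B|^2]. *)
Let shear_increment z w (tau : R) : d * (f z - f w) = tau%:K ->
  tau * (Re (d * F z) - Re (d * F w)) = N (h z - h w) ^+ 2 - N (g z - g w) ^+ 2.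
Proof.
move=> E; pose A := d * (h z - h w); pose B := eps * d * (g z - g w).
have E1 : A = conjc B + tau%:K.
  by rewrite -E [d * (f z - f w)]mulrBr !dfE /A /B; apply: cpx_eq; rewrite !ReImE; ring.
have -> : N (h z - h w) = N A by rewrite NM d1 mul1r.
have -> : N (g z - g w) = N B by rewrite !NM eps1 d1 !mul1r.
have -> : Re (d * F z) - Re (d * F w) = Re (A + B).
  by rewrite -ReN -ReD; congr Re; rewrite /F /hlin /A /B; ring.
by rewrite E1 !Nsq !ReImE; ring.
Qed.

Variables (z1 z2 : R[i]).
Hypotheses (z11 : N z1 < 1) (z21 : N z2 < 1).
Hypothesis same_line : Im (d * F z1) = Im (d * F z2).

(** [gam] is the [f]-preimage of the segment from [f z1] to [f z2], inside the disk because the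
    image of [f] is convex, and [tau] is the signed length of that segment. [F] moves on the same
    line, locally strictly monotone in the direction of [tau]. The clamp to [[0, 1]] states
    continuity globally. *)
Lemma shear_path : exists (gam : R -> R[i]) (tau : R),
  [/\ gam 0 = z1 /\ gam 1 = z2,
      forall s : R, 0 <= s <= 1 -> N (gam s) < 1 /\ Im (d * F (gam s)) = Im (d * F z1),
      continuous (fun s : R => Re (d * F (gam (Num.max 0 (Num.min s 1))))),
      (tau = 0 -> z1 = z2) &
      (tau != 0 -> forall s : R, 0 <= s <= 1 -> exists del : R, 0 < del /\
         forall s' : R, 0 <= s' <= 1 -> s' != s -> `|s' - s| < del ->
           0 < tau * (s' - s) * (Re (d * F (gam s')) - Re (d * F (gam s))))].
Proof.
have [uf cf] := stable mu1; have rf := regular_hconj mu1.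
have [gam Hg] : exists gam : R -> R[i], forall s : R, 0 <= s <= 1 ->
    N (gam s) < 1 /\ f (gam s) = (1 - s)%:K * f z1 + s%:K * f z2.
  suff /choice[gam Hg] : forall s : R, exists x, 0 <= s <= 1 ->
      N x < 1 /\ f x = (1 - s)%:K * f z1 + s%:K * f z2 by exists gam.
  move=> s; have [s01|_] := boolP (0 <= s <= 1); last by exists 0.
  by have [x hx] := cf z1 z2 s z11 z21 s01; exists x.
pose tau := Re (d * (f z2 - f z1)).
have tauE : d * (f z2 - f z1) = tau%:K.
  apply: cpx_eq => //; rewrite Imk mulrBr ImD ImN !Im_dfE same_line subrr//.
have gE (s s' : R) : 0 <= s <= 1 -> 0 <= s' <= 1 ->
  d * (f (gam s') - f (gam s)) = (tau * (s' - s))%:K.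
  move=> /Hg[_ e1] /Hg[_ e2]; rewrite e1 e2 rmorphM /= -tauE.
  by rewrite !rmorphB /= rmorph1; ring.
have gN (s s' : R) : 0 <= s <= 1 -> 0 <= s' <= 1 -> N (f (gam s') - f (gam s)) = `|tau| * `|s' - s|.
  by move=> hs hs'; rewrite -[LHS]mul1r -d1 -NM gE// Nreal normrM.
have gcont (s r : R) : 0 <= s <= 1 -> 0 < r -> exists del : R, 0 < del /\
    forall s' : R, 0 <= s' <= 1 -> `|s' - s| < del -> N (gam s' - gam s) < r.
  move=> hs r0; have [d' [d'0 Hd']] := inverse_continuous rf uf (Hg s hs).1 r0.
  have t1 : 0 < `|tau| + 1 by rewrite ltr_wpDl.
  exists (d' / (`|tau| + 1)); split; first exact: divr_gt0.
  move=> s' hs'; rewrite ltr_pdivlMr// => hd; apply: Hd'; first exact: (Hg s' hs').1.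
  by rewrite gN//; have := normr_ge0 (s' - s); nra.
pose p (s : R) := Num.max 0 (Num.min s 1).
have p01 (s : R) : 0 <= p s <= 1.
  by rewrite /p le_max lexx ge_max ler01 ge_min lexx orbT.
have pL (s k : R) : `|p (s + k) - p s| <= `|k|.
  have minL (x y : R) : `|Num.min x 1 - Num.min y 1| <= `|x - y|.
    have := ler_norm (x - y); have := ler_norm (y - x); rewrite (distrC y).
    by case: (leP x 1) => h1; case: (leP y 1) => h2 h3 h4; rewrite ler_norml; apply/andP; split;
      lra.
  have maxL (x y : R) : `|Num.max 0 x - Num.max 0 y| <= `|x - y|.
    have := ler_norm (x - y); have := ler_norm (y - x); rewrite (distrC y).
    by case: (leP 0 x) => h1; case: (leP 0 y) => h2 h3 h4; rewrite ler_norml; apply/andP; split;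
      lra.
  by apply: le_trans (maxL _ _) _; apply: le_trans (minL _ _) _; rewrite addrAC subrr add0r.
exists gam, tau; split.
- have h0 := Hg 0 ltac:(lra); have h1 := Hg 1 ltac:(lra); split.
    by apply: uf => //; [exact: h0.1|rewrite -/f h0.2 subr0 rmorph1 rmorph0; ring].
  by apply: uf => //; [exact: h1.1|rewrite -/f h1.2 subrr rmorph1 rmorph0; ring].
- move=> s hs; split; first exact: (Hg s hs).1.
  rewrite -!Im_dfE; apply/eqP; rewrite -subr_eq0 -ImN -ImD -mulrBr; apply/eqP.
  have h0 := Hg 0 ltac:(lra); have e0 : f (gam 0) = f z1 by rewrite h0.2 subr0 rmorph1 rmorph0;
    ring.
  by rewrite -e0 gE//; lra.
- move=> s; apply/continuous_atP => e e0.
  have [d2 [d20 H2]] := cder_ccont (cder_hlin eps (Hg (p s) (p01 s)).1) e0.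
  have [d3 [d30 H3]] := gcont (p s) d2 (p01 s) d20.
  exists d3; split => // k kd.
  have := H3 (p (s + k)) (p01 _) (le_lt_trans (pL s k) kd) => /H2.
  rewrite [gam (p s) + _]addrC subrK; apply: le_trans.
  by rewrite -ReN -ReD -mulrBr; apply: le_trans (Re_le _) _; rewrite NM d1 mul1r.
- move=> t0; apply: uf => //; apply/esym/eqP; rewrite -subr_eq0 -N_eq0 -[N _]mul1r -d1 -NM.
  by rewrite tauE t0 rmorph0 N0.
- move=> t0 s hs; have [d2 [d20 H2]] := increment_lt (Hg s hs).1.
  have [d3 [d30 H3]] := gcont s d2 hs d20.
  exists d3; split => // s' hs' ss' /(H3 s' hs') kd.
  rewrite (shear_increment (gE _ _ hs hs')).
  have := H2 (gam s' - gam s); rewrite [gam s + _]addrC subrK => H.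
  have {}H : N (g (gam s') - g (gam s)) < N (h (gam s') - h (gam s)).
    apply: H => //; rewrite N_gt0 subr_eq0; apply/eqP => E.
    have := gN s s' hs hs'; rewrite E subrr N0 => /esym/eqP.
    by rewrite mulf_eq0 !normr_eq0 (negbTE t0) subr_eq0 (negbTE ss').
  by rewrite subr_gt0 ltr_pXn2r// nnegrE N_ge0.
Qed.

End Stable.

Section StableTransfer.
Variable R : realType.
Variables h g Dh Dg : R[i] -> R[i].
Hypothesis dh : forall z : R[i], N z < 1 -> cder h z (Dh z).
Hypothesis dg : forall z : R[i], N z < 1 -> cder g z (Dg z).
Hypothesis sense : forall z : R[i], N z < 1 -> N (Dg z) < N (Dh z).
Hypothesis stable : forall mu, N mu = 1 -> univ (hconj h g mu) /\ convex_image (hconj h g mu).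

(** With [d = 1], [Re F] has equal values at both ends of the path, so it has an extremum at an
    interior parameter, where strict local monotonicity fails. *)
Lemma univ_hlin eps : N eps = 1 -> univ (hlin h g eps).
Proof.
move=> e1 z1 z2 z11 z21 E; set F := hlin h g eps in E.
have [gam [tau [[g0 g1] Hg cu t0 loc]]] :=
  shear_path dh dg sense stable e1 (N1 R) z11 z21 (congr1 (fun x => Im (1 * x)) E).
have [//|tn] := eqVneq z1 z2; exfalso.
have {}t0 : tau != 0 by apply/eqP => /t0 /eqP; exact/negP.
have {}loc := loc t0.
pose u (s : R) := Re (1 * F (gam s)).
pose v (s : R) := u (Num.max 0 (Num.min s 1)).
have vE (s : R) : 0 <= s <= 1 -> v s = u s.
  move=> /andP[s0 s1]; rewrite /v; congr u.
  by rewrite (min_idPl s1) (max_idPr s0).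
have u01 : u 0 = u 1 by rewrite /u g0 g1 E.
have cv : {within `[0, 1], continuous v} by exact: continuous_subspaceT.
have no_ext (s : R) : 0 < s -> s < 1 -> (forall s' : R, 0 <= s' <= 1 -> u s' <= u s) \/
    (forall s' : R, 0 <= s' <= 1 -> u s <= u s') -> False.
  move=> s0 s1 ext; have [d [d0 Hd]] := loc s ltac:(lra).
  pose k := Num.min (d / 2) (Num.min s (1 - s)).
  have k0 : 0 < k by rewrite !lt_min s0 /= andbC; apply/andP; split; lra.
  have kd : k <= d / 2 by rewrite ge_min lexx.
  have ks : k <= s by rewrite !ge_min lexx orbT.
  have ks1 : k <= 1 - s by rewrite !ge_min lexx !orbT.
  have ep : s + k - s = k by ring. have em : s - k - s = - k by ring.
  have := Hd (s + k) ltac:(lra); have := Hd (s - k) ltac:(lra).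
  rewrite ep em normrN gtr0_norm// -(subr_eq0 (s - k)) -(subr_eq0 (s + k)) ep em oppr_eq0 gt_eqF//.
  move=> /(_ isT ltac:(lra)) hm /(_ isT ltac:(lra)) hp.
  rewrite -!/(u _) in hm hp.
  have PQ : 0 <= (u (s + k) - u s) * (u (s - k) - u s).
    case: ext => ext; have e1' := ext (s + k) ltac:(lra); have e2' := ext (s - k) ltac:(lra).
      by apply: mulr_le0; lra.
    by apply: mulr_ge0; lra.
  have := mulr_gt0 hp hm; have := mulr_ge0 (sqr_ge0 (tau * k)) PQ; lra.
have [M] := EVT_max ler01 cv; rewrite in_itv /= => M01 HM.
have [m] := EVT_min ler01 cv; rewrite in_itv /= => m01 Hm.
have {}HM (s : R) : 0 <= s <= 1 -> u s <= u M by move=> hs; rewrite -!vE//; apply: HM;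
  rewrite in_itv.
have {}Hm (s : R) : 0 <= s <= 1 -> u m <= u s by move=> hs; rewrite -!vE//; apply: Hm;
  rewrite in_itv.
have [Mi|Mb] := boolP ((0 < M) && (M < 1)).
  by case/andP: Mi => a b; apply: (no_ext M) => //; left.
have [mi|mb] := boolP ((0 < m) && (m < 1)).
  by case/andP: mi => a b; apply: (no_ext m) => //; right.
have bdE (s : R) : 0 <= s <= 1 -> ~~ ((0 < s) && (s < 1)) -> u s = u 0.
  move=> /andP[s0 s1]; rewrite negb_and -!leNgt => /orP[h'|h'].
    by have -> : s = 0 by lra.
  by have -> : s = 1 by lra.
apply: (no_ext (1 / 2)); [lra|lra|left] => s hs.
rewrite (le_trans (HM s hs))// (bdE M)// -(bdE m)//; apply: Hm; lra.
Qed.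

(** Rotating by [d] makes [F z2 - F z1] real; the intermediate value theorem along the path hits the
    required real part, and the imaginary part is constant there. *)
Lemma convex_hlin eps : N eps = 1 -> convex_image (hlin h g eps).
Proof.
move=> e1 z1 z2 t z11 z21 t01; set F := hlin h g eps.
have [d [d1 dE]] := unit_dir (F z2 - F z1).
have same : Im (d * F z1) = Im (d * F z2).
  apply/eqP; rewrite eq_sym -subr_eq0 -ImN -ImD -mulrBr dE; exact/eqP.
have [gam [tau [[g0 g1] Hg cu t0 loc]]] := shear_path dh dg sense stable e1 d1 z11 z21 same.
pose u (s : R) := Re (d * F (gam s)).
pose v (s : R) := u (Num.max 0 (Num.min s 1)).
have vE (s : R) : 0 <= s <= 1 -> v s = u s.
  move=> /andP[s0 s1]; rewrite /v; congr u.
  by rewrite (min_idPl s1) (max_idPr s0).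
have cv : {within `[0, 1], continuous v} by exact: continuous_subspaceT.
have u0E : v 0 = Re (d * F z1) by rewrite vE ?/u ?g0//; lra.
have u1E : v 1 = Re (d * F z2) by rewrite vE ?/u ?g1//; lra.
pose y := (1 - t) * v 0 + t * v 1.
have [|s] := @IVT R v 0 1 y ler01 cv.
  by case: (leP (v 0) (v 1)) => h'; rewrite /y; apply/andP; split; nra.
rewrite in_itv /= => s01; rewrite vE// => us.
exists (gam s); split; first exact: (Hg s s01).1.
have d0 : d != 0 by rewrite -N_gt0 d1 ltr01.
have ReK (x : R) (z : R[i]) : Re (x%:K * z) = x * Re z by case: z => a b /=; rewrite mul0r subr0.
have ImK (x : R) (z : R[i]) : Im (x%:K * z) = x * Im z by case: z => a b /=; rewrite mul0r addr0.
have dE' : d * ((1 - t)%:K * F z1 + t%:K * F z2) =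
  (1 - t)%:K * (d * F z1) + t%:K * (d * F z2) by ring.
apply: (mulfI d0); apply: cpx_eq; rewrite -/F dE'.
  by rewrite -/(u s) us /y u0E u1E ReD !ReK.
by rewrite (Hg s s01).2 ImD !ImK -same; ring.
Qed.

End StableTransfer.

(** * Growth and distortion of convex functions *)

Section ConvexFunctions.
Variable R : realType.
Implicit Types (z w k c : R[i]).
Variables F D : R[i] -> R[i].
Hypothesis dF : forall z, N z < 1 -> cder F z (D z).
Hypothesis D_neq0 : forall z, N z < 1 -> D z != 0.
Hypothesis uF : univ F.
Hypothesis cF : convex_image F.
Hypothesis F0 : F 0 = 0.

Let zero_disk : N (0 : R[i]) < 1. Proof. by rewrite N0. Qed.

Lemma regular_cder : regular F.
Proof.
by move=> z z1; exists (D z), 0; rewrite N0 N_gt0 D_neq0//; split => //; exact/rder_cder/dF.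
Qed.

Lemma subordination (G : R[i] -> R[i]) : (forall z, N z < 1 -> exists l, cder G z l) ->
  (forall z, N z < 1 -> exists x, N x < 1 /\ F x = G z) -> G 0 = 0 ->
  forall z, N z < 1 -> exists x, N x <= N z /\ F x = G z.
Proof.
move=> dG GF G0.
have [phi Hphi] : exists phi : R[i] -> R[i], forall z, N z < 1 -> N (phi z) < 1 /\ F (phi z) = G z.
  suff /choice[phi H] : forall z, exists x, N z < 1 -> N x < 1 /\ F x = G z by exists phi.
  move=> z; have [z1|_] := boolP (N z < 1); last by exists 0.
  by have [x hx] := GF z z1; exists x.
move=> z z1; exists (phi z); split; last exact: (Hphi z z1).2.
apply: schwarz z1 => [w w1|w w1|]; last 1 first.
- by apply: uF => //; [exact: (Hphi 0 zero_disk).1|rewrite (Hphi 0 zero_disk).2 G0 F0].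
- have [p1 pE] := Hphi w w1; have [l hl] := dG w w1.
  pose P := phi w; have D0 : 0 < N (D P) by rewrite N_gt0 D_neq0.
  exists (l / D P) => e e0.
  have l0 : 0 < N l + 1 by rewrite ltr_wpDl ?N_ge0.
  (* The first entry makes [F] expand by at least [N (D P) / 2] near [P], which bounds the increment
     [j] of [phi]; the second then keeps [e1 * N j] within half of the allowed error
     [e * N (D P) * N k]. *)
  pose e1 := Num.min (N (D P) / 2) (e * N (D P) ^+ 2 / (4 * (N l + 1))).
  have e10 : 0 < e1.
    rewrite lt_min; apply/andP; split; first lra.
    by apply: divr_gt0; apply: mulr_gt0 => //; exact: exprn_gt0.
  have e1D : e1 <= N (D P) / 2 by rewrite ge_min lexx.
  have e1e : e1 * (4 * (N l + 1)) <= e * N (D P) ^+ 2.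
    by rewrite -ler_pdivlMr ?mulr_gt0// ge_min lexx orbT.
  have [d1 [d10 H1]] := dF p1 e10.
  have [d2 [d20 H2]] := cder_lip hl.
  have [d3 [d30 H3]] := hl (e * N (D P) / 2) ltac:(by rewrite divr_gt0// mulr_gt0).
  have [d4 [d40 H4]] := inverse_continuous regular_cder uF p1 d10.
  exists (Num.min (Num.min d2 d3) (Num.min (d4 / (N l + 1)) (1 - N w))); split.
    by rewrite !lt_min d20 d30 divr_gt0//=; lra.
  move=> k; rewrite !lt_min => /andP[/andP[/H2 k2 /H3 k3] /andP[k4 kw]].
  have wk1 : N (w + k) < 1 by have := ND w k; lra.
  have [q1 qE] := Hphi (w + k) wk1.
  rewrite ltr_pdivlMr// in k4.
  have := H4 (phi (w + k)) q1; rewrite qE pE => /(_ ltac:(lra)) jd.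
  set j := phi (w + k) - phi w in jd *.
  have := H1 j jd; rewrite /j [phi w + _]addrC subrK qE pE -/j -/P => k1.
  have nj : N (D P) / 2 * N j <= (N l + 1) * N k.
    have := N_rtri (D P * j) (G (w + k) - G w); rewrite (NB (D P * j)) NM.
    have : e1 * N j <= N (D P) / 2 * N j by rewrite ler_wpM2r ?N_ge0.
    lra.
  have tot : N (D P * j - l * k) <= e1 * N j + e * N (D P) / 2 * N k.
    have -> : D P * j - l * k = (G (w + k) - G w - l * k) - (G (w + k) - G w - D P * j) by ring.
    by apply: le_trans (N_tri _ _) _; lra.
  rewrite -(ler_pM2l D0) -NM.
  have -> : D P * (j - l / D P * k) = D P * j - l * k by field; exact: D_neq0.
  apply: le_trans tot _; rewrite -(ler_pM2l D0).
  have b1 : e1 * (N (D P) / 2 * N j) <= e1 * ((N l + 1) * N k) by rewrite ler_pM2l.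
  have b2 : e1 * (4 * (N l + 1)) * N k <= e * N (D P) ^+ 2 * N k by rewrite ler_wpM2r ?N_ge0.
  lra.
- exact: ltW (Hphi w w1).1.
Qed.

(* The homotopy [(1 - t) F(x) + t F(c x)] is subordinate to [F]; its derivative at
   [t = 0] points into the disk of radius [|z|]. *)
Lemma tangent_halfplane z c : z != 0 -> N z < 1 -> N c <= 1 ->
  0 <= Re ((F z - F (c * z)) / (z * D z)).
Proof.
move=> z0 z1 c1; set Q := _ / _; rewrite leNgt; apply/negP => Q0.
have nz : 0 < N z by rewrite N_gt0.
have D0 : 0 < N (D z) by rewrite N_gt0 D_neq0.
pose q := - Re Q; have q0 : 0 < q by rewrite oppr_gt0.
pose Dl := F (c * z) - F z; pose K := N Dl + 1.
have K0 : 0 < K by rewrite ltr_wpDl ?N_ge0.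
have cdisk x : N x < 1 -> N (c * x) < 1.
  by move=> x1; rewrite NM; apply: le_lt_trans x1; rewrite ler_piMl ?N_ge0.
have path t : 0 <= t <= 1 -> exists x, N x <= N z /\ F x = F z + t%:K * Dl.
  move=> t01; have [| | |x [xz xE]] :=
    @subordination (fun x => (1 - t)%:K * F x + t%:K * F (c * x)) _ _ _ z z1.
  - move=> x x1; eexists; apply: cderD; apply: cderMl; first exact: dF.
    apply: (cder_comp (g := fun x => c * x)); first by apply: cderMl; exact: cder_id.
    by apply: dF; exact: cdisk.
  - by move=> x x1; apply: cF => //; exact: cdisk.
  - by rewrite mulr0 !F0; ring.
  - by exists x; split => //; rewrite xE /Dl rmorphB rmorph1; ring.
(* The second entry is tuned to the end: [main2] and [nj] give [t * q * N z * N (D z) ^+ 2 <= 2 * e1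
   * t * K], at most half of the left side. *)
pose e1 := Num.min (N (D z) / 2) (q * N z * N (D z) ^+ 2 / (4 * K)).
have e10 : 0 < e1.
  rewrite lt_min; apply/andP; split; first lra.
  by apply: divr_gt0; [apply: mulr_gt0; [exact: mulr_gt0|exact: exprn_gt0]|exact: mulr_gt0].
have e1D : e1 <= N (D z) / 2 by rewrite ge_min lexx.
have e1e : e1 * (4 * K) <= q * N z * N (D z) ^+ 2.
  by rewrite -ler_pdivlMr ?mulr_gt0// ge_min lexx orbT.
have [d1 [d10 H1]] := dF z1 e10.
have [d4 [d40 H4]] := inverse_continuous regular_cder uF z1 d10.
pose t := Num.min 1 (d4 / 2 / K).
have t0 : 0 < t by rewrite lt_min ltr01 /=; apply: divr_gt0 => //; exact: divr_gt0.
have t1 : t <= 1 by rewrite ge_min lexx.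
have tK : t * K <= d4 / 2 by rewrite -ler_pdivlMr// ge_min lexx orbT.
have [x [xz xE]] := path t ltac:(lra).
have nD : N (F x - F z) = t * N Dl by rewrite xE addrAC subrr add0r NM Npos// ltW.
have nDl : N Dl <= K by rewrite lerDl.
have jd : N (x - z) < d1.
  apply: H4; first exact: le_lt_trans xz z1.
  by rewrite nD; apply: (@le_lt_trans _ _ (t * K)); [rewrite ler_pM2l|lra].
have := H1 _ jd; rewrite [z + _]addrC subrK => h1.
set j := x - z in h1 jd.
have nj : N (D z) / 2 * N j <= t * K.
  have := N_rtri (D z * j) (F x - F z); rewrite (NB (D z * j)) NM nD.
  have : e1 * N j <= N (D z) / 2 * N j by rewrite ler_wpM2r ?N_ge0.
  have : t * N Dl <= t * K by rewrite ler_pM2l.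
  lra.
pose E := F x - F z - D z * j.
have jE : D z * j = t%:K * Dl - E by rewrite /E xE; ring.
have QE : t%:K * Dl = - (t%:K * Q * (z * D z)).
  by rewrite /Q /Dl; field; rewrite z0 D_neq0.
(* The point [x = z + j] stays in the disk of radius [N z], so [conjc z * j] has nonpositive real
   part; to first order it is [- t * Q * N z ^+ 2], of real part [t * q * N z ^+ 2 > 0]. *)
have zj : conjc z * j = - (t%:K * Q * (N z ^+ 2)%:K) - conjc z * E / D z.
  rewrite -mul_conj; have -> : j = (t%:K * Dl - E) / D z by rewrite -jE; field; exact: D_neq0.
  by rewrite QE; field; exact: D_neq0.
have Rzj : Re (conjc z * j) <= 0.
  have xj : x = z + j by rewrite /j addrC subrK.
  have : N x ^+ 2 <= N z ^+ 2 by rewrite lerXn2r// nnegrE N_ge0.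
  rewrite xj !Nsq !ReImE; have := sqr_ge0 (Re x - Re z); have := sqr_ge0 (Im x - Im z); lra.
have RtQ : Re (t%:K * Q * (N z ^+ 2)%:K) = - (t * q * N z ^+ 2).
  by rewrite /q; case: (Q) => a b /=; ring.
have RE : Re (conjc z * E / D z) <= N z * (e1 * N j) / N (D z).
  apply: le_trans (Re_leN _) _; rewrite !NM Nconj NV ler_pM2r ?invr_gt0//.
  by rewrite ler_pM2l.
have main : t * q * N z ^+ 2 <= N z * (e1 * N j) / N (D z).
  by move: Rzj; rewrite zj ReD !ReN RtQ; lra.
move: main; rewrite ler_pdivlMr// => main.
have main2 : t * q * N z * N (D z) <= e1 * N j.
  by rewrite -(ler_pM2l nz); lra.
have b1 : e1 * (N (D z) / 2 * N j) <= e1 * (t * K) by rewrite ler_pM2l.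
have b2 : t * q * N z * N (D z) * N (D z) <= e1 * N j * N (D z) by rewrite ler_pM2r.
have b3 : t * (e1 * (4 * K)) <= t * (q * N z * N (D z) ^+ 2) by rewrite ler_pM2l.
have : 0 < t * (q * N z * N (D z) ^+ 2).
  by apply: mulr_gt0 => //; apply: mulr_gt0; [exact: mulr_gt0|exact: exprn_gt0].
lra.
Qed.

(** The Cayley transform [T] sends the right half-plane to the disk and [V] to 0, and the Schwarz
    lemma applies to it. *)
Lemma harnack_upper (v : R[i] -> R[i]) (x : R) : (forall c, N c < 1 -> exists l, cder v c l) ->
  (forall c, N c < 1 -> 0 < Re (v c)) -> 0 <= x -> x < 1 ->
  Re (v x%:K) * (1 - x) <= Re (v 0) * (1 + x).
Proof.
move=> dv v0 x0 x1; pose V := v 0.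
have V0 : 0 < Re V by apply: v0; rewrite N0.
have den c : N c < 1 -> v c + conjc V != 0.
  move=> c1; apply/eqP => E; have := congr1 Re E; rewrite ReD ReJ Re_0.
  by have := v0 c c1; lra.
pose T c := (v c - V) / (v c + conjc V).
have x1' : N x%:K < 1 by rewrite Npos.
have := @schwarz _ T _ _ _ x%:K x1'; rewrite (Npos x0) => H.
have {H} : N (T x%:K) <= x.
  apply: H.
  - move=> c c1; have [l hl] := dv c c1; eexists; apply: cder_div; first exact: den.
      by apply: cderB; [exact: hl|exact: cder_cst].
    by apply: cderD; [exact: hl|exact: cder_cst].
  - move=> c c1; rewrite /T NM NV ler_pdivrMr ?N_gt0 ?den// mul1r.
    rewrite Nle ?N_ge0// Nsq !ReImE; have := v0 c c1; nra.
  - by rewrite /T -/V subrr mul0r.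
rewrite /T NM NV ler_pdivrMr ?N_gt0 ?den// => h.
have p0 := v0 _ x1'; set p := v x%:K in h p0 *.
have : N (p - V) ^+ 2 <= (x * N (p + conjc V)) ^+ 2 by rewrite lerXn2r// nnegrE ?mulr_ge0 ?N_ge0.
rewrite exprMn !Nsq !ReImE => h2.
have h3 : (Re p - Re V) ^+ 2 <= (x * (Re p + Re V)) ^+ 2.
  have : x ^+ 2 * (Im p - Im V) ^+ 2 <= (Im p - Im V) ^+ 2.
    by rewrite ler_piMl ?sqr_ge0// expr_le1//; exact: ltW.
  rewrite exprMn; lra.
have h4 : Re p - Re V <= x * (Re p + Re V).
  rewrite leNgt; apply/negP => h5; move: h3; rewrite leNgt => /negP; apply.
  by rewrite ltr_pXn2r// nnegrE ?mulr_ge0//; nra.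
rewrite -/V; lra.
Qed.

Lemma Re_inv_ge0 z : 0 <= Re z -> 0 <= Re z^-1.
Proof. by case: z => a b /= a0; rewrite divr_ge0// addr_ge0 ?sqr_ge0. Qed.

Lemma Re_near1 z (e : R) : 0 <= e -> e <= 1 / 2 -> N z <= e -> 1 - 2 * e <= Re (1 - z)^-1.
Proof.
move=> e0 e2 ze; have h1 : 1 - e <= N (1 - z) by have := N_rtri 1 z; rewrite N1; lra.
have z1 : 1 - z != 0 by rewrite -N_gt0; lra.
have E : (1 - z)^-1 = 1 - (- (z / (1 - z))) by field.
have h2 : N (- (z / (1 - z))) <= 2 * e.
  rewrite NN NM NV ler_pdivrMr ?N_gt0//; nra.
by rewrite E ReD ReN Re_1; have := Re_leN (- (z / (1 - z))); lra.
Qed.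

(** By [tangent_halfplane] the function [c -> z * D z / (F z - F (c * z))] has nonnegative real
    part; its value at 0 is [z * D z / F z], and at [c = 1 - t] it behaves like [1 / t]. Harnack at
    [1 - t], multiplied out and with [t] tending to 0, reads [1 <= 2 * Re (z * D z / F z)]. *)
Lemma starlike_half z : z != 0 -> N z < 1 -> 1 / 2 <= Re (z * D z / F z).
Proof.
move=> z0 z1; set p := Re _; rewrite leNgt; apply/negP => p2.
have nz : 0 < N z by rewrite N_gt0.
have D0 : 0 < N (D z) by rewrite N_gt0 D_neq0.
have D0' := D_neq0 z1.
pose del := 1 / 2 - p; have del0 : 0 < del by rewrite /del; lra.
(* Added to [v] to make its real part strictly positive, as [harnack_upper] asks. *)
pose eta := del / 4; have eta0 : 0 < eta by rewrite /eta; lra.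
pose v c := z * D z / (F z - F (c * z)) + eta%:K.
have cdisk c : N c < 1 -> N (c * z) < 1.
  by move=> c1; rewrite NM; apply: le_lt_trans z1; rewrite ler_piMl ?N_ge0// ltW.
have den c : N c < 1 -> F z - F (c * z) != 0.
  move=> c1; rewrite subr_eq0; apply/eqP => /uF E.
  have {}E : c = 1.
    by apply: (mulIf z0); rewrite mul1r -E//; exact: cdisk.
  by move: c1; rewrite E N1 ltxx.
have dv c : N c < 1 -> exists l, cder v c l.
  move=> c1; eexists; apply: cderD; last exact: cder_cst.
  apply: cder_div; [exact: den|exact: cder_cst|apply: cderB; first exact: cder_cst].
  apply: (cder_comp (g := fun x => x * z)); last by apply: dF; exact: cdisk.
  by apply: cderM; [exact: cder_id|exact: cder_cst].
have v0 c : N c < 1 -> 0 < Re (v c).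
  move=> c1; rewrite /v ReD Rek ltr_wpDl// -invf_div; apply: Re_inv_ge0.
  by apply: tangent_halfplane => //; exact: ltW.
pose e := Num.min (del / 4) (1 / 2).
have e0 : 0 < e by rewrite lt_min; apply/andP; split; lra.
have e1 : e <= del / 4 by rewrite ge_min lexx.
have e2 : e <= 1 / 2 by rewrite ge_min lexx orbT.
have [d [d0 Hd]] := dF z1 (mulr_gt0 e0 D0).
pose t := Num.min (1 / 2) (d / 2).
have t0 : 0 < t by rewrite lt_min; apply/andP; split; lra.
have t1 : t <= 1 / 2 by rewrite ge_min lexx.
have td : t <= d / 2 by rewrite ge_min lexx orbT.
have nk : N (- (t%:K * z)) = t * N z by rewrite NN NM Npos// ltW.
have kd : N (- (t%:K * z)) < d by rewrite nk; nra.
have := Hd _ kd; rewrite nk; set err := _ - _ - _ => herr.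
have x0 : 0 <= 1 - t by lra.
have x1 : 1 - t < 1 by lra.
have := harnack_upper dv v0 x0 x1.
have v00 : Re (v 0) = p + eta by rewrite /v mul0r F0 subr0 ReD Rek.
have vp : 0 < p + eta by rewrite -v00; apply: v0; rewrite N0.
pose S := t%:K * z * D z.
have tK0 : t%:K != 0 by rewrite -N_gt0 Npos// ltW.
have S0 : S != 0 by rewrite /S !mulf_neq0.
have NS : N S = t * N z * N (D z) by rewrite /S !NM Npos// ltW.
have FE : F z - F ((1 - t)%:K * z) = S - err.
  have -> : (1 - t)%:K * z = z - t%:K * z by rewrite rmorphB rmorph1; ring.
  by rewrite /err /S; ring.
have u1 : N (err / S) <= e.
  by rewrite NM NV ler_pdivrMr ?N_gt0// NS; lra.
have Se : S - err != 0.
  by rewrite -FE; apply: den; rewrite Npos.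
have Rv : 1 - 2 * e + eta * t <= Re (v (1 - t)%:K) * t.
  have -> : Re (v (1 - t)%:K) = Re (z * D z / (S - err)) + eta by rewrite /v ReD Rek FE.
  rewrite [leRHS]mulrDl lerD2r.
  have -> : Re (z * D z / (S - err)) * t = Re (1 - err / S)^-1.
    have -> : (1 - err / S)^-1 = t%:K * (z * D z / (S - err)).
      have -> : 1 - err / S = (S - err) / S by field.
      rewrite invf_div.
      by rewrite /S !mulrA.
    by case: (z * D z / (S - err)) => a b /=; ring.
  by apply: Re_near1 => //; exact: ltW.
rewrite v00 subKr => h.
have h2 : (p + eta) * (1 + (1 - t)) <= 2 * (p + eta) by nra.
have et0 : 0 < eta * t by rewrite mulr_gt0.
have h3 : Re (v (1 - t)%:K) * t <= (p + eta) * (1 + (1 - t)) by lra.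
have r1 : eta = del / 4 by [].
have r2 : del = 1 / 2 - p by [].
have h4 := le_trans (le_trans Rv h3) h2.
by clear -et0 h4 e1 r1 r2 del0; lra.
Qed.

Hypothesis D0_1 : D 0 = 1.

(** For [p = w * D w / F w], the bound [Re p >= 1/2] means [N (1 - 1 / p) <= 1], so [th] is bounded
    by [N w]. The normalization makes [th] vanish to second order, so Schwarz improves this to
    [N w ^+ 2], and [F z = D z * (z - th z)] concludes. *)
Lemma logderiv_bound z : N z < 1 -> N (z * D z) * (1 - N z) <= N (F z).
Proof.
move=> z1; pose th w := w - F w / D w.
suff thB : N (th z) <= N z ^+ 2.
  have -> : F z = D z * (z - th z) by rewrite /th; field; exact: D_neq0.
  rewrite !NM; have := N_rtri z (th z); have := N_ge0 (D z); nra.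
have z00 : N (0 : R[i]) < 1 by rewrite N0.
have [l hl] := cder_unit_disk_deriv dF z00.
have [d1 [d10 H1]] := cder_lip hl.
pose L := N l + 1; have L0 : 0 < L by rewrite ltr_wpDl ?N_ge0.
pose d := Num.min d1 (Num.min (1 / (2 * L)) 1).
have d0 : 0 < d by rewrite !lt_min d10 ltr01 divr_gt0// mulr_gt0.
have DL k : N k < d -> N (D k - 1) <= L * N k.
  by rewrite lt_min => /andP[/H1]; rewrite add0r D0_1.
(* The numerator of [th] has two terms of size at most [L * N k ^+ 2], and [N (D k) >= 1/2] for
   [N k < 1 / (2 * L)]: hence [4 * L]. *)
apply: (@schwarz_order _ th 2 (4 * L) d) => //.
- move=> w w1; have [m hm] := cder_unit_disk_deriv dF w1.
  by eexists; apply: cderB; [exact: cder_id|apply: cder_div; [exact: D_neq0|exact: dF|exact: hm]].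
- move=> w w1; have [->|w0] := eqVneq w 0; first by rewrite /th F0 mul0r subr0 N0.
  have Fw : F w != 0.
    by apply: contra w0 => /eqP E; apply/eqP/uF => //; rewrite F0.
  have := starlike_half w0 w1; set p := w * D w / F w => hp.
  have p0 : p != 0 by rewrite /p !mulf_neq0 ?invr_neq0// D_neq0.
  have -> : th w = w * ((p - 1) / p) by rewrite /th /p; field; rewrite w0 Fw D_neq0.
  apply: (@le_trans _ _ (N w)); last exact: ltW.
  rewrite NM ler_piMr ?N_ge0// NM NV ler_pdivrMr ?N_gt0// mul1r.
  by clearbody p; rewrite Nle ?N_ge0// Nsq !ReImE ?Re_1 ?Im_1; nra.
- move=> k kd; have k1 : N k < 1 by move: kd; rewrite !lt_min => /and3P[].
  have kL : N k * (2 * L) < 1 by move: kd; rewrite !lt_min => /and3P[_];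
    rewrite ltr_pdivlMr// mulr_gt0.
  have Fk : N (F k - k) <= L * N k * N k.
    have := @mean_value_le _ (fun w => F w - w) 0 k (L * N k).
    rewrite add0r F0 !subr0; apply=> t /andP[t0 t1].
    have tk : N (t%:K * k) <= N k by rewrite NM Npos// ler_piMl ?N_ge0.
    exists (D (0 + t%:K * k) - 1); rewrite add0r; split.
      by apply: cderB; [apply: dF; exact: le_lt_trans k1|exact: cder_id].
    by apply: le_trans (DL _ (le_lt_trans tk kd)) _; rewrite ler_pM2l.
  have Dk := DL k kd.
  have Dh : 1 / 2 <= N (D k).
    by have := N_rtri 1 (1 - D k); rewrite N1 subKr NB; lra.
  have Dk0 : D k != 0 by rewrite D_neq0.
  have -> : th k = (k * (D k - 1) - (F k - k)) / D k by rewrite /th; field.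
  rewrite NM NV ler_pdivrMr ?N_gt0//.
  have := N_tri (k * (D k - 1)) (F k - k); rewrite NM.
  have : N k * N (D k - 1) <= N k * (L * N k) by rewrite ler_wpM2l ?N_ge0.
  have : 4 * L * N k ^+ 2 * (1 / 2) <= 4 * L * N k ^+ 2 * N (D k).
    by apply: ler_wpM2l => //; apply: mulr_ge0; [lra|exact: sqr_ge0].
  lra.
Qed.

(** Along the radius through [z], [M s = (N (F (s u)) * (1 / s - 1)) ^+ 2] is nonincreasing by
    [logderiv_bound], and it is at most about 1 near [s = 0] since [F] has derivative 1 there.
    Squaring avoids differentiating the modulus. *)
Lemma growth z : N z < 1 -> N (F z) <= N z / (1 - N z).
Proof.
move=> z1; have [->|z0] := eqVneq z 0; first by rewrite F0 !N0 mul0r.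
have nz : 0 < N z by rewrite N_gt0.
pose u := z * ((N z)^-1)%:K.
have Nu : N u = 1 by rewrite /u NM Npos ?invr_ge0 ?N_ge0// divff// gt_eqF.
have zu : (N z)%:K * u = z.
  by rewrite /u mulrCA -rmorphM divff ?gt_eqF// rmorph1 mulr1.
have Nsu (s : R) : 0 <= s -> N (0 + s%:K * u) = s by move=> s0; rewrite add0r NM Nu mulr1 Npos.
(* This is minus the imaginary unit, so that [is_derive_line] also yields the imaginary part of
   [F]. *)
pose i : R[i] := (0 +i* (-1))%C.
have Rei w : Re (i * w) = Im w by case: w => a b /=; ring.
pose a (s : R) := Re (1 * F (0 + s%:K * u)).
pose b (s : R) := Re (i * F (0 + s%:K * u)).
pose y (s : R) := s^-1 - 1.
pose M : R -> R := (a * a + b * b) * (y * y).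
have nE s : a s * a s + b s * b s = N (F (0 + s%:K * u)) ^+ 2.
  by rewrite /a /b Rei mul1r Nsq !expr2.
have dM (s : R) : 0 < s < 1 -> exists m : R, m <= 0 /\ is_derive s 1 M m.
  move=> /andP[s0 s1]; pose w := 0 + s%:K * u.
  have ws : N w = s by rewrite Nsu// ltW.
  have w1 : N w < 1 by rewrite ws.
  have da : is_derive s 1 a (Re (1 * (D w * u))) by apply: is_derive_line; exact: dF.
  have db : is_derive s 1 b (Re (i * (D w * u))) by apply: is_derive_line; exact: dF.
  have dy : is_derive s 1 y (- s ^- 2).
    have h1 : is_derive s 1 (fun x : R => x^-1) (- s ^- 2 *: 1).
      by apply: is_deriveV; rewrite gt_eqF.
    have h2 := is_deriveB h1 (is_derive_cst (1 : R) s 1).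
    by apply: is_derive_eq h2 _; rewrite subr0 /GRing.scale /= mulr1.
  have dm := is_deriveM (is_deriveD (is_deriveM da da) (is_deriveM db db)) (is_deriveM dy dy).
  eexists; split; last exact: dm.
  rewrite /GRing.scale /= -/(a s) -/(b s) !fctE.
  set a' := Re (1 * _); set b' := Re (i * _).
  set n := a s * a s + b s * b s.
  have n0 : 0 <= n by rewrite /n nE sqr_ge0.
  have key : (a s * a' + b s * b') * s * (1 - s) <= n.
    have -> : (a s * a' + b s * b') * s = Re (conjc (F w) * (w * D w)).
      rewrite /a /a' /b /b' !Rei !mul1r -/w.
      have -> : w * D w = s%:K * (D w * u) by rewrite /w add0r; ring.
      by case: (F w) => ? ?; case: (D w * u) => ? ? /=; ring.
    have h1 := logderiv_bound w1; rewrite ws in h1.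
    have h2 := Re_leN (conjc (F w) * (w * D w)); rewrite NM Nconj in h2.
    rewrite /n nE -/w; have := N_ge0 (F w); have s1' : 0 <= 1 - s by lra.
    have : Re (conjc (F w) * (w * D w)) * (1 - s) <= N (F w) * N (w * D w) * (1 - s)
      by rewrite ler_wpM2r.
    nra.
  have ys : y s = (1 - s) / s by rewrite /y; field; rewrite gt_eqF.
  have -> : n * (y s * - s ^- 2 + y s * - s ^- 2) +
      y s * y s * (a s * a' + a s * a' + (b s * b' + b s * b')) =
      2 * (1 - s) / s ^+ 3 * ((a s * a' + b s * b') * s * (1 - s) - n).
    by rewrite ys; field; rewrite gt_eqF.
  apply: mulr_ge0_le0; last by lra.
  by apply: divr_ge0; [apply: mulr_ge0 => //; lra|apply: exprn_ge0; exact: ltW].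
have Mdec (s1 : R) : 0 < s1 -> s1 < N z -> M (N z) <= M s1.
  move=> s10 s1z.
  have [df Hdf] : exists df : R -> R, forall s : R, 0 < s < 1 ->
    df s <= 0 /\ is_derive s 1 M (df s).
    suff /choice[df H] : forall s : R, exists m : R, 0 < s < 1 ->
      m <= 0 /\ is_derive s 1 M m by exists df.
    by move=> s; have [/dM[m hm]|_] := boolP (0 < s < 1); [exists m|exists 0].
  have cM (x : R) : 0 < x < 1 -> {for x, continuous M}.
    by move=> /Hdf[_ h]; apply/differentiable_continuous/derivable1_diffP.
  have [| |x] := @MVT R M df s1 (N z) s1z.
  - by move=> x; rewrite in_itv /= => /andP[h1 h2]; apply: (Hdf x _).2; lra.
  - apply/continuous_within_itvP => //; split.
    + by move=> x; rewrite in_itv /= => /andP[h1 h2]; apply: cM; lra.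
    + by apply: cvg_at_right_filter; apply: cM; lra.
    + by apply: cvg_at_left_filter; apply: cM; lra.
  rewrite in_itv /= => /andP[h1 h2] E.
  have : df x * (N z - s1) <= 0 by apply: mulr_le0_ge0; [apply: (Hdf x _).1; lra|lra].
  lra.
have Mz : M (N z) = (N (F z) * (1 - N z) / N z) ^+ 2.
  rewrite /M !fctE nE add0r zu /y; field; rewrite gt_eqF//.
suff : N (F z) * (1 - N z) / N z <= 1.
  by rewrite ler_pdivrMr// mul1r ler_pdivlMr//; lra.
apply/ler_addgt0Pr => e e0.
have dF0 : cder F 0 1 by rewrite -D0_1; apply: dF; rewrite N0.
have [d [d0 Hd]] := dF0 e e0.
pose s := Num.min (N z / 2) (d / 2).
have s0 : 0 < s by rewrite lt_min; apply/andP; split; lra.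
have sz : s <= N z / 2 by rewrite ge_min lexx.
have sd : s <= d / 2 by rewrite ge_min lexx orbT.
have Ns : N (s%:K * u) = s by rewrite -[X in N X]add0r Nsu// ltW.
have Fs : N (F (0 + s%:K * u)) <= (1 + e) * s.
  have := Hd (s%:K * u); rewrite Ns F0 subr0 mul1r add0r => /(_ ltac:(lra)) h.
  by have := ND (F (s%:K * u) - s%:K * u) (s%:K * u); rewrite subrK Ns; lra.
have Ms : M s <= (1 + e) ^+ 2.
  rewrite /M !fctE nE -expr2 -exprMn lerXn2r// ?nnegrE.
  - by apply: mulr_ge0; [exact: N_ge0|rewrite /y subr_ge0 invf_ge1//; lra].
  - by lra.
  - have -> : 1 + e = (1 + e) * s * s^-1 by rewrite mulfK// gt_eqF.
    apply: ler_pM => //; first exact: N_ge0.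
      by rewrite /y subr_ge0 invf_ge1//; lra.
    by rewrite /y; lra.
have := le_trans (Mdec s s0 ltac:(lra)) Ms; rewrite Mz ler_pXn2r// nnegrE; last lra.
by rewrite divr_ge0 ?mulr_ge0 ?N_ge0//; lra.
Qed.

Lemma distortion z : N z < 1 -> N (D z) <= 1 / (1 - N z) ^+ 2.
Proof.
move=> z1; have [->|z0] := eqVneq z 0.
  by rewrite D0_1 N1 N0 subr0 expr1n divr1.
have nz : 0 < N z by rewrite N_gt0.
have z1' : 0 < 1 - N z by lra.
have := logderiv_bound z1; have := growth z1; rewrite ler_pdivlMr// NM => h1 h2.
rewrite ler_pdivlMr ?exprn_gt0// -(ler_pM2l nz); nra.
Qed.

End ConvexFunctions.

(** * Covering radius *)

Section Covering.
Variable R : realType.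
Implicit Types (z w k c : R[i]) (f : R[i] -> R[i]).

(** [T = f / (2 d - f)] maps the half-plane [Re <= d] into the closed unit disk, and its derivative
    at 0 is [l / (2 d)]. *)
Lemma halfplane_deriv f l (d : R) : (forall z, N z < 1 -> exists l, cder f z l) ->
  f 0 = 0 -> cder f 0 l -> 0 < d -> (forall z, N z < 1 -> Re (f z) <= d) -> N l <= 2 * d.
Proof.
move=> df f0 hl d0 fd; pose T z := f z / ((2 * d)%:K - f z).
have den z : N z < 1 -> (2 * d)%:K - f z != 0.
  move=> /fd h; apply/eqP => /(congr1 Re); rewrite ReD ReN Rek Re_0; lra.
have z0 : N (0 : R[i]) < 1 by rewrite N0.
have hd : cder (fun z => (2 * d)%:K - f z) 0 (0 - l) by apply: cderB => //; exact: cder_cst.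
have hT := @cder_div _ f (fun z => (2 * d)%:K - f z) 0 _ _ (den 0 z0) hl hd.
have := @schwarz_deriv _ T _ _ _ _ hT.
have -> : (l * ((2 * d)%:K - f 0) - f 0 * (0 - l)) / ((2 * d)%:K - f 0) ^+ 2 = l / (2 * d)%:K.
  have d2 : 0 < 2 * d by exact: mulr_gt0.
  have k0 : (2 * d)%:K != 0 by rewrite -N_gt0 Npos// ltW.
  by rewrite f0 subr0 mul0r subr0 expr2 invfM mulrA mulfK.
rewrite NM NV Npos; last by apply: ltW; exact: mulr_gt0.
rewrite ler_pdivrMr ?mulr_gt0// mul1r; apply.
- move=> z z1; have [m hm] := df z z1; eexists; apply: cder_div; [exact: den|exact: hm|].
  by apply: cderB; [exact: cder_cst|exact: hm].
- move=> z z1; rewrite /T NM NV ler_pdivrMr ?N_gt0 ?den// mul1r.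
  rewrite Nle ?N_ge0// Nsq !ReImE; have := fd z z1; nra.
- by rewrite /T f0 mul0r.
Qed.

(* The nearest point to [W] of the closure of [S] is a zero of the distance to
   [S] on the closed disk about [W] touching [S]. *)
Lemma separation (S : set R[i]) W (m0 : R) : 0 < m0 -> S !=set0 ->
  (forall u v (t : R), S u -> S v -> 0 <= t <= 1 -> S ((1 - t)%:K * u + t%:K * v)) ->
  (forall s, S s -> m0 <= N (s - W)) ->
  exists c, N c = 1 /\ forall s, S s -> Re (c * s) <= N W.
Proof.
move=> m00 [s0 S0] cS Sm.
pose A x := [set N (s - x) | s in S]; pose dS x := inf (A x).
have hA x : has_inf (A x).
  by split; [exists (N (s0 - x)), s0|exists 0 => _ [s _ <-]; exact: N_ge0].
have dle x s : S s -> dS x <= N (s - x).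
  by move=> Ss; apply: ge_inf; [case: (hA x)|exists s].
have dge x (y : R) : (forall s, S s -> y <= N (s - x)) -> y <= dS x.
  by move=> H; apply: lb_le_inf; [case: (hA x)|move=> _ [s Ss <-]; exact: H].
have dlip x y : dS y <= dS x + N (y - x).
  rewrite -lerBlDr; apply: dge => s Ss; rewrite lerBlDr; apply: le_trans (dle y s Ss) _.
  by rewrite (NB y) (le_trans _ (ND _ _))// addrA subrK.
have adh x (e : R) : 0 < e -> exists s, S s /\ N (s - x) < dS x + e.
  by move=> e0; have [_ [s Ss <-] h] := inf_adherent e0 (hA x); exists s.
pose m := dS W; have mm0 : 0 < m by apply: lt_le_trans m00 _; exact: dge.
have [p [pm Hp]] : exists p, N (p - W) <= m /\ forall y, N (y - W) <= m -> - dS y <= - dS p.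
  apply: EVT_ball => [|x xm e e0]; first exact: ltW.
  exists e; split => // y _ yx; rewrite (_ : - dS y - - dS x = dS x - dS y) ?ler_norml;
    last by ring.
  have := dlip x y; have := dlip y x; rewrite (NB x); lra.
have dp : dS p = 0.
  apply/eqP; rewrite eq_le; apply/andP; split; last by apply: dge => s _; exact: N_ge0.
  apply/ler_addgt0Pr => e e0; rewrite add0r; have [s [Ss sW]] := adh W e e0.
  have ms : m <= N (s - W) by exact: dle.
  have n0 : 0 < N (s - W) by lra.
  pose r := m / N (s - W); have r0 : 0 <= r by rewrite divr_ge0 ?N_ge0// ltW.
  have r1 : r <= 1 by rewrite ler_pdivrMr// mul1r.
  have rn : r * N (s - W) = m by rewrite divfK// gt_eqF.
  pose y := W + r%:K * (s - W).
  have yW : N (y - W) <= m by rewrite /y addrAC subrr add0r NM Npos// rn.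
  have := Hp y yW; rewrite lerN2 => h; apply: le_trans h _; apply: le_trans (dle y s Ss) _.
  have -> : s - y = (1 - r)%:K * (s - W) by rewrite /y rmorphB rmorph1; ring.
  by rewrite NM Npos ?subr_ge0// mulrBl mul1r rn; rewrite -/m in sW; lra.
have pW : 0 < N (W - p) by have := dlip p W; rewrite dp -/m; lra.
have obtuse s : S s -> 0 <= Re (conjc (p - W) * (s - p)).
  (* [p] is only adherent to [S]: points [s1] of [S] near [p] replace it, and convexity puts the
     points of the segment from [s1] to [s] in [S], at distance at least [m] from [W]. *)
  move=> Ss; have key t : 0 <= t <= 1 -> N (p - W) ^+ 2 <= N (p - W + t%:K * (s - p)) ^+ 2.
    move=> /andP[t0 t1]; rewrite lerXn2r ?nnegrE ?N_ge0//; apply: le_trans pm _.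
    apply/ler_addgt0Pr => e e0; have [s1 [Ss1 s1p]] := adh p e e0.
    have t01 : 0 <= t <= 1 by rewrite t0.
    have h := dle W _ (cS s1 s t Ss1 Ss t01); apply: le_trans h _.
    have -> : (1 - t)%:K * s1 + t%:K * s - W = (p - W + t%:K * (s - p)) + (1 - t)%:K * (s1 - p).
      by rewrite rmorphB rmorph1; ring.
    apply: le_trans (ND _ _) _; rewrite lerD2l NM Npos ?subr_ge0//.
    by have := N_ge0 (s1 - p); rewrite dp add0r in s1p; nra.
  set Q := Re _; rewrite leNgt; apply/negP => Q0.
  pose B := N (s - p) ^+ 2 + 1; have B0 : 0 < B by rewrite ltr_wpDl ?sqr_ge0.
  pose t := Num.min 1 (- Q / B).
  have t0 : 0 < t by rewrite lt_min ltr01 divr_gt0// oppr_gt0.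
  have t1 : t <= 1 by rewrite ge_min lexx.
  have tB : t * B <= - Q by rewrite -ler_pdivlMr// ge_min lexx orbT.
  have := key t ltac:(by rewrite ltW).
  have -> : N (p - W + t%:K * (s - p)) ^+ 2 = N (p - W) ^+ 2 + 2 * t * Q + t * t * N (s - p) ^+ 2.
    by rewrite /Q; case: (p - W) => a b; case: (s - p) => a' b'; rewrite !Nsq /=; ring.
  have : t * (t * B) <= t * - Q by rewrite ler_pM2l.
  have : t * Q < 0 by rewrite pmulr_rlt0.
  have tt : 0 < t * t by rewrite mulr_gt0.
  rewrite /B; lra.
have [c [c1 cE]] := unit_dir (W - p).
have cE2 : c = conjc (W - p) * ((N (W - p))^-1)%:K.
  have Wp : W - p != 0 by rewrite -N_gt0.
  apply: (mulIf Wp); rewrite cE mulrAC [conjc _ * _]mulrC mul_conj -rmorphM.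
  by rewrite expr2 mulfK// gt_eqF.
exists c; split => // s Ss; apply: (@le_trans _ _ (Re (c * p))).
  rewrite -subr_ge0 -ReN -ReD -mulrBr cE2.
  have -> : conjc (W - p) * ((N (W - p))^-1)%:K * (p - s) =
    ((N (W - p))^-1)%:K * (conjc (p - W) * (s - p)).
    by rewrite -(opprB p W) conjN; ring.
  by have := obtuse s Ss; case: (_ * (s - p)) => a b /= h;
    rewrite mul0r subr0 mulr_ge0// invr_ge0 N_ge0.
have -> : c * p = c * W - (N (W - p))%:K by rewrite -cE; ring.
by rewrite ReD ReN Rek; have := Re_leN (c * W); rewrite NM c1 mul1r; lra.
Qed.

(** [w] may be adherent to the image, so [W = (1 + eta) w] is separated instead. It has distance at
    least [eta * d] from the image: otherwise [w] would be a convex combination of a nearby image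
    point [s] and of [b = (W - s) / eta], which lies in the disk about 0 covered by [f]. Then [eta]
    tends to 0. *)
Lemma covering_half (h g Dh Dg : R[i] -> R[i]) w :
  (forall z, N z < 1 -> cder h z (Dh z)) -> (forall z, N z < 1 -> cder g z (Dg z)) ->
  h 0 = 0 -> Dh 0 = 1 -> g 0 = 0 -> Dg 0 = 0 ->
  let f := fun z => h z + conjc (g z) in
  regular f -> convex_image f -> (forall z, N z < 1 -> f z <> w) -> 1 / 2 <= N w.
Proof.
move=> dh dg h0 h1 g0 g1 f rf cf fw.
have zz : N (0 : R[i]) < 1 by rewrite N0.
have f0 : f 0 = 0 by rewrite /f h0 g0 conjc0 addr0.
have [d [d0 Hd]] := open_image rf zz ltr01; rewrite f0 in Hd.
have w0 : 0 < N w.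
  by rewrite N_gt0; apply/eqP => w0; apply: (fw 0 zz); rewrite f0 w0.
suff H (eta : R) : 0 < eta -> 1 / 2 <= (1 + eta) * N w.
  rewrite leNgt; apply/negP => wh.
  have := H ((1 / 2 - N w) / (2 * N w)) ltac:(by apply: divr_gt0; lra).
  have -> : (1 + (1 / 2 - N w) / (2 * N w)) * N w = N w + (1 / 2 - N w) / 2 by field;
    rewrite gt_eqF.
  lra.
move=> eta0; have e1 : 0 < 1 + eta by lra.
pose W := (1 + eta)%:K * w.
have NW : N W = (1 + eta) * N w by rewrite NM Npos// ltW.
pose S := [set f z | z in [set z | N z < 1]].
have [||u v t [a a1 <-] [b b1 <-] t01|s Ss|c [c1 Hc]] := @separation S W (eta * d).
- exact: mulr_gt0.
- by exists (f 0), 0.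
- by have [x [x1 xE]] := cf a b t a1 b1 t01; exists x.
- rewrite leNgt; apply/negP => sW.
  pose t := 1 / (1 + eta).
  have t01 : 0 <= 1 - t <= 1 by rewrite /t; apply/andP; split;
    rewrite ?subr_ge0 ?gerBl ?ler_pdivrMr ?divr_ge0//; lra.
  pose b := (eta^-1)%:K * (W - s).
  have bd : N (b - 0) < d.
    by rewrite subr0 NM Npos ?invr_ge0 ?ltW// mulrC ltr_pdivrMr// NB mulrC.
  have [z' [z'1 _ z'E]] := Hd b bd; case: Ss => z z1 zE.
  have [x [x1 xE]] := cf z z' (1 - t) z1 z'1 t01.
  apply: (fw x x1); rewrite xE z'E zE /b.
  have e0 : eta%:K != 0 :> R[i] by rewrite -N_gt0 Npos// ltW.
  have e10 : 1 + eta%:K != 0 :> R[i] by rewrite -[1]/(1%:K) -rmorphD -N_gt0 Npos// ltW.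
  rewrite /W /t !(rmorphB, rmorphD, rmorph1, rmorphM, fmorphV) /=.
  by field; rewrite e0.
rewrite -NW; pose phi z := c * h z + conjc c * g z.
have dphi z : N z < 1 -> cder phi z (c * Dh z + conjc c * Dg z).
  by move=> z1; apply: cderD; apply: cderMl; [exact: dh|exact: dg].
have W0 : 0 < N W by rewrite NW mulr_gt0.
have := @halfplane_deriv phi _ (N W) _ _ (dphi 0 zz) W0.
rewrite h1 g1 mulr1 mulr0 addr0 c1 => H.
have {H} : 1 <= 2 * N W.
  apply: H => [z z1||z z1]; first by eexists; exact: dphi.
    by rewrite /phi h0 g0 !mulr0 addr0.
  have -> : Re (phi z) = Re (c * f z) by rewrite /phi /f !ReImE; ring.
  by apply: Hc; exists z.
lra.
Qed.

Lemma align (a b : R[i]) : exists eps, N eps = 1 /\ N (a + eps * b) = N a + N b.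
Proof.
have [c [c1 ca]] := unit_dir a; have [d [d1 db]] := unit_dir b.
have c0 : c != 0 by rewrite -N_gt0 c1.
exists (c^-1 * d); split; first by rewrite NM NV c1 d1 invr1 mulr1.
have -> : a + c^-1 * d * b = c^-1 * (c * a + d * b) by field.
by rewrite ca db NM NV c1 invr1 mul1r -rmorphD Npos// addr_ge0 ?N_ge0.
Qed.

End Covering.

(** * The radius bound *)

Section Bound.
Variable R : realType.
Implicit Types (z w k c : R[i]).

(** Induction through [w'], differentiable again by [cder_unit_disk_deriv]; each mean value estimate
    gains one power of [N z]. The result is the local input of [schwarz_order]. *)
Lemma vanishing_order (w : C R -> C R) (m : nat) :
  (forall z : R[i], N z < 1 -> exists l : R[i], cder (w : R[i] -> R[i]) z l) ->
  (forall j : nat, (j < m)%N -> derive1n j w 0 = 0) ->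
  exists C d : R, 0 < d /\ forall z : R[i], N z < d -> N (w z : R[i]) <= C * N z ^+ m.
Proof.
elim: m w => [|m ih] w dw w0.
  have [l /cder_ccont/(_ 1 ltr01)[d [d0 Hd]]] := dw 0 ltac:(by rewrite N0).
  exists (N (w 0 : R[i]) + 1), d; split => // z /Hd; rewrite add0r expr0 mulr1.
  by have := ND (w z - w 0) (w 0); rewrite subrK; lra.
have dw' (z : R[i]) : N z < 1 -> cder (w : R[i] -> R[i]) z (derive1 w z).
  by move=> /dw[l hl]; rewrite (cder_derive1 hl).
have [||Cst [d [d0 Hd]]] := ih (derive1 w).
- exact: cder_unit_disk_deriv dw'.
- by move=> j jm; rewrite -derive1Sn; exact: w0.
exists `|Cst|, (Num.min d 1); split; first by rewrite lt_min d0 ltr01.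
move=> z; rewrite lt_min => /andP[zd z1].
have w00 : w 0 = 0 by exact: (w0 0%N).
have := @mean_value_le _ (w : R[i] -> R[i]) 0 z (`|Cst| * N z ^+ m).
rewrite add0r w00 subr0 exprSr mulrA; apply=> t /andP[t0 t1].
have tz : N (0 + t%:K * z) <= N z by rewrite add0r NM Npos// ler_piMl ?N_ge0.
exists (derive1 w (0 + t%:K * z)); split; first by apply: dw'; exact: le_lt_trans z1.
apply: le_trans (Hd _ (le_lt_trans tz zd)) _.
apply: (@le_trans _ _ (`|Cst| * N (0 + t%:K * z) ^+ m)).
  by rewrite ler_wpM2r ?exprn_ge0 ?N_ge0// ler_norm.
by rewrite ler_wpM2l// lerXn2r// nnegrE N_ge0.
Qed.

Lemma stable_bound (h g Dh Dg : R[i] -> R[i]) :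
  (forall z, N z < 1 -> cder h z (Dh z)) -> (forall z, N z < 1 -> cder g z (Dg z)) ->
  (forall z, N z < 1 -> N (Dg z) < N (Dh z)) ->
  (forall mu, N mu = 1 -> univ (hconj h g mu) /\ convex_image (hconj h g mu)) ->
  h 0 = 0 -> Dh 0 = 1 -> g 0 = 0 -> Dg 0 = 0 ->
  forall z, N z < 1 -> N (h z) + N (g z) <= N z / (1 - N z) /\
    N (Dh z) + N (Dg z) <= 1 / (1 - N z) ^+ 2.
Proof.
move=> dh dg sense st h0 h1 g0 g1 z z1.
have D0 eps w : N eps = 1 -> N w < 1 -> Dh w + eps * Dg w != 0.
  by move=> e1 w1; exact: (hlin_neq0 sense).
have H0 eps : hlin h g eps 0 = 0 by rewrite /hlin h0 g0 mulr0 addr0.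
have H1 eps : Dh 0 + eps * Dg 0 = 1 by rewrite h1 g1 mulr0 addr0.
split.
- have [eps [e1 <-]] := align (h z) (g z).
  apply: (growth (F := hlin h g eps) (D := fun z => Dh z + eps * Dg z)) => //.
  + by move=> w w1; exact: cder_hlin.
  + by move=> w w1; exact: D0.
  + exact: (univ_hlin dh dg sense st).
  + exact: (convex_hlin dh dg sense st).
- have [eps [e1 <-]] := align (Dh z) (Dg z).
  apply: (distortion (F := hlin h g eps) (D := fun z => Dh z + eps * Dg z)) => //.
  + by move=> w w1; exact: cder_hlin.
  + by move=> w w1; exact: D0.
  + exact: (univ_hlin dh dg sense st).
  + exact: (convex_hlin dh dg sense st).
Qed.

Definition majorant (lam x : R) := (1 - lam) * x / (1 - x) + lam * x / (1 - x) ^+ 2.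

(** In [y = x / (1 - x)] one has [x / (1 - x) ^+ 2 = y + y ^+ 2], so the majorant is
    [y + lam * y ^+ 2]: monotonicity is visible and the root is that of a quadratic. *)
Lemma majorantE lam x : x < 1 -> majorant lam x = x / (1 - x) + lam * (x / (1 - x)) ^+ 2.
Proof. by move=> x1; rewrite /majorant; field; rewrite subr_eq0 gt_eqF. Qed.

Lemma majorant_lt lam x y : 0 <= lam -> 0 <= x -> x < y -> y < 1 -> majorant lam x < majorant lam y.
Proof.
move=> l0 x0 xy y1; have x1 := lt_trans xy y1; rewrite !majorantE//.
have a0 : 0 <= x / (1 - x) by rewrite divr_ge0//; lra.
have ab : x / (1 - x) < y / (1 - y).
  rewrite ltr_pdivrMr; last lra.
  by rewrite mulrAC ltr_pdivlMr; lra.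
have : lam * (x / (1 - x)) ^+ 2 <= lam * (y / (1 - y)) ^+ 2.
  by rewrite ler_wpM2l// lerXn2r ?nnegrE//; lra.
lra.
Qed.

Lemma majorant_le lam x y : 0 <= lam -> 0 <= x -> x <= y -> y < 1 ->
  majorant lam x <= majorant lam y.
Proof.
by move=> l0 x0; rewrite le_eqVlt => /predU1P[->//|xy] y1; apply/ltW/majorant_lt.
Qed.

Lemma r6_funE lam m r : r6_fun lam m r = majorant lam (r ^+ m) - 2^-1.
Proof. by []. Qed.

Lemma r6_fun_eq0 (lam r : R) m : (r6_fun lam m r = 0) <-> (majorant lam (r ^+ m) = 1 / 2).
Proof. by rewrite r6_funE div1r; split=> [/eqP|->]; [rewrite subr_eq0 => /eqP|rewrite subrr]. Qed.

Lemma majorant_root (lam : R) : 0 <= lam -> exists x, 0 < x < 1 /\ majorant lam x = 1 / 2.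
Proof.
move=> l0; pose s := Num.sqrt (1 + 2 * lam).
have s0 : 0 <= s by exact: sqrtr_ge0.
have s2 : s ^+ 2 = 1 + 2 * lam by rewrite sqr_sqrtr//; lra.
have lE : lam = (s ^+ 2 - 1) / 2 by rewrite s2; field.
(* The positive root of [y + lam * y ^+ 2 = 1/2] is [1 / (1 + s)], a form valid also for [lam = 0];
   then [x = y / (1 + y)]. *)
exists (1 / (2 + s)); split.
  by rewrite divr_gt0 ?ltr_pdivrMr//=; lra.
rewrite majorantE; last by rewrite ltr_pdivrMr; lra.
rewrite lE; field; rewrite !gt_eqF//; lra.
Qed.

Lemma nth_root_exists (x : R) m : (0 < m)%N -> 0 < x < 1 -> exists r, 0 < r < 1 /\ r ^+ m = x.
Proof.
move=> m0 /andP[x0 x1].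
have c : {within `[0, 1], continuous (fun r : R => r ^+ m)}.
  by apply: continuous_subspaceT => r; exact: exprn_continuous.
have [|r] := @IVT R (fun r => r ^+ m) 0 1 x ler01 c.
  by rewrite expr0n (gtn_eqF m0) expr1n /= (min_idPl ler01) (max_idPr ler01) !ltW.
rewrite in_itv /= => /andP[r0 r1] rx; exists r; split => //.
rewrite !lt_neqAle r0 r1 !andbT; apply/andP; split.
  by apply: contraTneq x0 => r00; rewrite -rx -r00 expr0n (gtn_eqF m0) ltxx.
by apply: contraTneq x1 => r11; rewrite -rx r11 expr1n ltxx.
Qed.

Lemma normC_ltE (z w : C R) : (`|z| < `|w|) = (N (z : R[i]) < N (w : R[i])).
Proof. exact: ltC_real. Qed.

Lemma normC_leE (z : C R) (x : R) : (`|z| <= RtoC x) = (N (z : R[i]) <= x).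
Proof. exact: leC_real. Qed.

Lemma normC_eq1 (z : C R) : (`|z| = 1) = (N (z : R[i]) = 1).
Proof. by apply/propext; split=> [[]|H]; last by rewrite NE H. Qed.

Lemma majorant_comb (lam x : R) (a b : R[i]) : 0 <= lam -> lam <= 1 ->
  N a <= x / (1 - x) -> N b <= x * (1 / (1 - x) ^+ 2) ->
  N ((1 - lam)%:K * a + lam%:K * b) <= majorant lam x.
Proof.
move=> l0 l1 ha hb; apply: le_trans (ND _ _) _; rewrite !NM !Npos ?subr_ge0//.
have -> : majorant lam x = (1 - lam) * (x / (1 - x)) + lam * (x * (1 / (1 - x) ^+ 2)).
  by rewrite /majorant; ring.
by apply: lerD; apply: ler_wpM2l; rewrite ?subr_ge0.
Qed.

Lemma N_conjM (a b : R[i]) : N (conjc a * conjc b) = N a * N b.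
Proof. by rewrite NM !Nconj. Qed.

Lemma N_pm_le (a b : R[i]) (x p q : R) : N a = x * p -> N b = x * q ->
  N (a - b) <= x * (p + q) /\ N (a + b) <= x * (p + q).
Proof. by move=> ea eb; rewrite mulrDr -ea -eb; split; [exact: N_tri|exact: ND]. Qed.

Lemma univ_Disk (f : C R -> C R) : univalent_in_D f -> univ (f : R[i] -> R[i]).
Proof. by move=> uf z w z1 w1; apply: uf; rewrite normC_lt1. Qed.

Lemma convex_Disk (f : C R -> C R) : convex_set_C (f @` @Disk R) ->
  convex_image (f : R[i] -> R[i]).
Proof.
move=> cf z w t z1 w1 t01.
have Sz : (f @` @Disk R) (f z) by exists z => //; rewrite /Disk /= normC_lt1.
have Sw : (f @` @Disk R) (f w) by exists w => //; rewrite /Disk /= normC_lt1.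
have [x x1 xE] := cf _ _ Sz Sw t t01.
by exists x; split => //; move: x1; rewrite /Disk /= normC_lt1.
Qed.

(** The image is open, so its boundary points are omitted values, to which the covering estimate
    applies. *)
Lemma le_dist_half (f : C R -> C R) (x : R) : f 0 = 0 -> regular (f : R[i] -> R[i]) ->
  (forall w : R[i], (forall z, N z < 1 -> f z <> w) -> 1 / 2 <= N w) ->
  x <= 1 / 2 -> le_dist_bdry (x%:K : C R) f.
Proof.
move=> f0 rf cov x2 w [_ wi]; rewrite f0 subr0 NE leC_real; apply: le_trans x2 _.
apply: cov => z z1 zw; apply: wi.
have [d [d0 Hd]] := open_image rf z1 ltr01.
apply/nbhs_ballP; exists (d%:K : C R); first by rewrite /= (ltC_real 0 d).
move=> y; rewrite -ball_normE /ball_ /= NE ltC_real NB -zw => /Hd[z' [z'1 _ z'E]].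
by exists z' => //; rewrite /Disk /= normC_lt1.
Qed.

Lemma radius_bound (lam r6 : R) (m : nat) (h g w : C R -> C R) (z : C R) :
  (0 < m)%N -> 0 <= lam <= 1 -> 0 < r6 < 1 -> r6_fun lam m r6 = 0 ->
  in_SH0 h g -> stable_convex h g -> in_B m w -> `|z| <= RtoC r6 ->
  le_dist_bdry `|comb_D lam h g w z| (harm h g) /\
  le_dist_bdry `|comb_Dscr lam h g w z| (harm h g).
Proof.
move=> m0 /andP[l0 l1] /andP[r0 r1] rE [[ah ag] [h0 h1] [g0 g1] sp _] st [aw wb w0 _] zr.
have disk (x : R[i]) : N x < 1 -> `|x : C R| < 1 by rewrite normC_lt1.
have dh (x : R[i]) : N x < 1 -> cder (h : R[i] -> R[i]) x (derive1 h x).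
  by move=> /disk/ah; exact: derivable_cder.
have dg (x : R[i]) : N x < 1 -> cder (g : R[i] -> R[i]) x (derive1 g x).
  by move=> /disk/ag; exact: derivable_cder.
have sense (x : R[i]) : N x < 1 -> N (derive1 g x : R[i]) < N (derive1 h x : R[i]).
  by move=> hx; rewrite -(normC_ltE (derive1 g x) (derive1 h x)); exact: sp (disk x hx).
have st' (mu : R[i]) : N mu = 1 -> univ (hconj h g mu) /\ convex_image (hconj h g mu).
  move=> mu1; have [|u c] := st mu; first by rewrite (normC_eq1 mu).
  by split; [exact: univ_Disk|exact: convex_Disk].
have zr' : N (z : R[i]) <= r6 by rewrite -(normC_leE z r6).
have z1 : N (z : R[i]) < 1 by exact: le_lt_trans zr' r1.
have dw (x : R[i]) : N x < 1 -> exists l : R[i], cder (w : R[i] -> R[i]) x l.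
  by move=> /disk/aw/derivable_cder hl; exists (derive1 w x).
have [Cst [d [d0 Hd]]] := vanishing_order dw w0.
pose x : R[i] := w z.
have wz : N x <= r6 ^+ m.
  apply: (@le_trans _ _ (N (z : R[i]) ^+ m)).
    apply: (schwarz_order dw _ d0 Hd z1) => y y1.
    by have := wb y (disk y y1); rewrite normC_le1.
  by rewrite lerXn2r// nnegrE ?N_ge0// ltW.
have rm1 : r6 ^+ m < 1 by rewrite exprn_ilt1// ?ltW// -lt0n.
have x1 : N x < 1 by exact: le_lt_trans rm1.
have [B1 B2] := stable_bound dh dg sense st' h0 h1 g0 g1 x1.
have majx : majorant lam (N x) <= 1 / 2.
  apply: (@le_trans _ _ (majorant lam (r6 ^+ m))); first by apply: majorant_le => //; exact: N_ge0.
  by rewrite (iffLR (r6_fun_eq0 _ _ _) rE).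
(* Stated for arbitrary [b] because the two operators differ only by a sign that the triangle
   inequality ignores. *)
have main (a b : R[i]) : N a <= N (h x : R[i]) + N (g x : R[i]) ->
    N b <= N x * (N (derive1 h x : R[i]) + N (derive1 g x : R[i])) ->
    N ((1 - lam)%:K * a + lam%:K * b) <= 1 / 2.
  move=> Ha Hb; apply: le_trans majx; apply: (majorant_comb l0 l1).
    exact: le_trans Ha B1.
  by apply: le_trans Hb _; rewrite ler_wpM2l ?N_ge0.
have rf : regular (harm h g : R[i] -> R[i]).
  have := regular_hconj dh dg sense (N1 R).
  by congr regular; apply/funext => y; rewrite /hconj mul1r.
have cf : convex_image (harm h g : R[i] -> R[i]).
  have := (st' 1 (N1 R)).2.
  by congr convex_image; apply/funext => y; rewrite /hconj mul1r.
have f0 : harm h g 0 = 0 by rewrite /harm h0 g0 conjC0 addr0.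
have cov (y : R[i]) : (forall z, N z < 1 -> harm h g z <> y) -> 1 / 2 <= N y.
  exact: (covering_half dh dg h0 h1 g0 g1 rf cf).
have Ha : N (harm h g x : R[i]) <= N (h x : R[i]) + N (g x : R[i]).
  by apply: le_trans (ND _ _) _; rewrite Nconj.
have e1 : N (x * derive1 h x : R[i]) = N x * N (derive1 h x : R[i]) by exact: NM.
have e2 : N (conjc x * conjc (derive1 g x) : R[i]) = N x * N (derive1 g x : R[i]).
  exact: N_conjM.
split; rewrite NE; apply: le_dist_half => //; apply: main => //.
- exact: (N_pm_le e1 e2).1.
- exact: (N_pm_le e1 e2).2.
Qed.

End Bound.

(** * Sharpness *)

Section Sharpness.
Variable R : realType.
Implicit Types (z w k c : R[i]).

Definition halfplane_map z : R[i] := z / (1 - z).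

Lemma disk_neq1 z : N z < 1 -> 1 - z != 0.
Proof. by move=> z1; rewrite subr_eq0; apply: contraTneq z1 => <-; rewrite N1 ltxx. Qed.

Lemma cder_halfplane_map z : N z < 1 -> cder halfplane_map z ((1 - z) ^- 2).
Proof.
move=> z1; have d := disk_neq1 z1.
have -> : (1 - z) ^- 2 = (1 * (1 - z) - z * (0 - 1)) / (1 - z) ^+ 2 by field.
by apply: cder_div => //; [exact: cder_id|apply: cderB; [exact: cder_cst|exact: cder_id]].
Qed.

Lemma halfplane_map_inj z w : N z < 1 -> N w < 1 -> halfplane_map z = halfplane_map w -> z = w.
Proof.
move=> /disk_neq1 dz /disk_neq1 dw /eqP; rewrite /halfplane_map eqr_div// => /eqP E.
by rewrite -[z](subrK (z * w)) -{1}[z]mulr1 -mulrBr E; ring.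
Qed.

(** The inverse of [halfplane_map] is [v / (1 + v)], so its image consists of the points nearer to 0
    than to -1. *)
Lemma Re_gt_half z : (N z < N (1 + z)) = (- (1 / 2) < Re z).
Proof.
rewrite -(@ltr_pXn2r _ 2)// ?nnegrE ?N_ge0// !Nsq !ReImE ?Re_1 ?Im_1.
by apply/idP/idP => h; lra.
Qed.

Lemma halfplane_map_image z : N z < 1 -> - (1 / 2) < Re (halfplane_map z).
Proof.
move=> z1; have d := disk_neq1 z1; rewrite -Re_gt_half.
have -> : 1 + halfplane_map z = (1 - z)^-1 by rewrite /halfplane_map; field.
by rewrite /halfplane_map NM -[ltRHS]mul1r NV ltr_pM2r// invr_gt0 N_gt0.
Qed.

Lemma halfplane_map_surj v : - (1 / 2) < Re v -> exists z, N z < 1 /\ halfplane_map z = v.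
Proof.
rewrite -Re_gt_half => h; have d : 1 + v != 0.
  by rewrite -N_gt0; apply: le_lt_trans h; exact: N_ge0.
exists (v / (1 + v)); split; first by rewrite NM NV ltr_pdivrMr ?N_gt0// mul1r.
rewrite /halfplane_map; have -> : 1 - v / (1 + v) = (1 + v)^-1 by field.
by rewrite invrK divfK.
Qed.

Lemma derive1n_monomial (m j : nat) :
  derive1n j ((fun z => z ^+ m) : C R -> C R) = (fun z => (m ^_ j)%:R * z ^+ (m - j)) :> (C R ->
    C R).
Proof.
elim: j => [|j ih]; first by rewrite derive1n0 subn0 ffactn0; apply/funext => z; rewrite mul1r.
rewrite derive1nS ih; apply/funext => z; apply: cder_derive1.
have := cderMl (m ^_ j)%:R (cderX (m - j) (cder_id z)).
congr cder; rewrite ffactnSr natrM subnS mulr1; ring.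
Qed.

Lemma monomial_in_B (m : nat) : (0 < m)%N -> in_B m ((fun z => z ^+ m) : C R -> C R).
Proof.
move=> m0; split.
- by move=> z _; exact: cder_derivable (cderX m (cder_id z)).
- by move=> z; rewrite normC_lt1 normC_le1 NX => z1; rewrite exprn_ile1 ?N_ge0// ltW.
- by move=> j jm; rewrite derive1n_monomial expr0n subn_eq0 leqNgt jm mulr0.
- by rewrite derive1n_monomial subnn expr0 mulr1 ffactnn pnatr_eq0 -lt0n fact_gt0.
Qed.

Let h : C R -> C R := halfplane_map.
Let g : C R -> C R := fun=> 0.

Let harm0 (mu : C R) : (fun z => h z + mu * Num.conj (g z)) = h.
Proof. by apply/funext => z; rewrite /g conjC0 mulr0 addr0. Qed.

Let harmE : harm h g = h.
Proof. by apply/funext => z; rewrite /harm /g conjC0 addr0. Qed.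

Let dg z : derive1 g z = 0.
Proof. exact: (cder_derive1 (cder_cst 0 z)). Qed.

Let dh z : N z < 1 -> derive1 h z = (1 - z) ^- 2.
Proof. by move=> z1; exact: (cder_derive1 (cder_halfplane_map z1)). Qed.

Let uh : univalent_in_D h.
Proof. by move=> z w; rewrite !normC_lt1; exact: halfplane_map_inj. Qed.

Let himage (v : R[i]) : (h @` @Disk R) v <-> - (1 / 2) < Re v.
Proof.
split; first by case=> z; rewrite /Disk /= normC_lt1 => /halfplane_map_image h1 <-.
by move=> /halfplane_map_surj[z [z1 zE]]; exists z => //; rewrite /Disk /= normC_lt1.
Qed.

Lemma halfplane_map_SH0 : in_SH0 h g.
Proof.
have z0 : N (0 : R[i]) < 1 by rewrite N0.
split.
- split => z; rewrite normC_lt1 => z1; first exact: cder_derivable (cder_halfplane_map z1).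
  exact: cder_derivable (cder_cst 0 z).
- by split; [rewrite /h /halfplane_map mul0r|rewrite dh// subr0 expr1n invr1].
- by split; [|exact: dg].
- move=> z; rewrite normC_lt1 => z1; rewrite dg dh// normr0 normr_gt0.
  by rewrite invr_neq0// expf_neq0// disk_neq1.
- by rewrite harmE; exact: uh.
Qed.

Lemma conv_gt (a b c t : R) : c < a -> c < b -> 0 <= t -> t <= 1 -> c < (1 - t) * a + t * b.
Proof.
move=> ca cb t0 t1; have [t00|tp] := leP t 0.
  have -> : t = 0 by lra.
  by rewrite subr0 mul1r mul0r addr0.
have h1 : 0 <= (1 - t) * (a - c) by apply: mulr_ge0; lra.
have h2 : 0 < t * (b - c) by apply: mulr_gt0; lra.
lra.
Qed.

Lemma halfplane_map_stable : stable_convex h g.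
Proof.
move=> mu _; rewrite harm0; split; first exact: uh.
move=> u v /himage hu /himage hv t /andP[t0 t1]; apply/himage.
have -> : Re (RtoC (1 - t) * u + RtoC t * v : R[i]) = (1 - t) * Re u + t * Re v.
  by case: (u) => a b; case: (v) => a' b' /=; ring.
exact: conv_gt.
Qed.

(** A boundary point at distance exactly 1/2 from the image of 0; testing [le_dist_bdry] there is
    enough to refute it. *)
Lemma halfplane_map_bdry : bdry (harm h g @` @Disk R) (- (1 / 2))%:K.
Proof.
rewrite harmE; split.
- move=> B /nbhs_ballP[e /= e0 He].
  have e0' : 0 < Re e by move: e0; rewrite ltcE => /andP[].
  have eE : e = (Re e)%:K by move: e0; rewrite ltcE => /andP[/eqP/= h1 _];
    case: (e) h1 => a b /= ->.
  exists (- (1 / 2) + Re e / 2)%:K; split; first by apply/himage; rewrite Rek; lra.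
  apply: He; rewrite -ball_normE /ball_ /= eE NE ltC_real -rmorphB Nreal opprD addrA subrr sub0r normrN.
  by rewrite gtr0_norm; lra.
- move=> /nbhs_ballP[e /= e0 He].
  have e0' : 0 < Re e by move: e0; rewrite ltcE => /andP[].
  have eE : e = (Re e)%:K by move: e0; rewrite ltcE => /andP[/eqP/= h1 _];
    case: (e) h1 => a b /= ->.
  have /He/himage : ball ((- (1 / 2))%:K : C R) e (- (1 / 2) - Re e / 2)%:K.
    rewrite -ball_normE /ball_ /= eE NE ltC_real -rmorphB Nreal opprB addrC subrK.
    by rewrite gtr0_norm; lra.
  by rewrite Rek; lra.
Qed.

(** On the positive axis growth and distortion are equalities for this map, and with [g = 0] both
    operators reduce to [z h']. *)
Lemma halfplane_map_comb (lam x : R) : 0 <= x -> x < 1 ->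
  RtoC (1 - lam) * harm h g (x%:K : C R) + RtoC lam * Dop h g (x%:K : C R) = (majorant lam x)%:K /\
  RtoC (1 - lam) * harm h g (x%:K : C R) + RtoC lam * Dscr h g (x%:K : C R) = (majorant lam x)%:K.
Proof.
move=> x0 x1; have xd : N x%:K < 1 by rewrite Npos.
have k1 : h (x%:K : C R) = (x / (1 - x))%:K.
  by rewrite /h /halfplane_map rmorphM fmorphV rmorphB rmorph1.
have k2 : x%:K * (1 - x%:K) ^- 2 = (x / (1 - x) ^+ 2)%:K.
  by rewrite rmorphM fmorphV rmorphXn rmorphB rmorph1.
have E : majorant lam x =
  (1 - lam) * (x / (1 - x)) + lam * (x / (1 - x) ^+ 2) by rewrite /majorant !mulrA.
by rewrite harmE /Dop /Dscr dg dh// conjC0 mulr0 subr0 addr0 k1 k2 E rmorphD !rmorphM.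
Qed.

Lemma sharp (lam r6 r : R) (m : nat) : (0 < m)%N -> 0 <= lam <= 1 -> 0 < r6 < 1 ->
  r6_fun lam m r6 = 0 -> r6 < r < 1 ->
  exists (h g w : C R -> C R) (z : C R),
    [/\ in_SH0 h g, stable_convex h g, in_B m w & `|z| = RtoC r] /\
    ~ le_dist_bdry `|comb_D lam h g w z| (harm h g) /\
    ~ le_dist_bdry `|comb_Dscr lam h g w z| (harm h g).
Proof.
move=> m0 /andP[l0 l1] /andP[r60 r61] /r6_fun_eq0 rE /andP[rr r1].
have r0 : 0 < r by exact: lt_trans rr.
have xm : r6 ^+ m < r ^+ m by rewrite ltr_pXn2r// nnegrE ltW.
have x0 : 0 <= r ^+ m by rewrite exprn_ge0// ltW.
have x1 : r ^+ m < 1 by rewrite exprn_ilt1// ?ltW// -lt0n.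
have big : 1 / 2 < majorant lam (r ^+ m).
  by rewrite -rE; apply: majorant_lt => //; rewrite exprn_ge0// ltW.
exists h, g, (fun z => z ^+ m), (r%:K : C R); split.
  split; [exact: halfplane_map_SH0|exact: halfplane_map_stable|exact: monomial_in_B|].
  by rewrite NE Npos// ltW.
have [c1 c2] := halfplane_map_comb lam x0 x1.
have key (u : C R) : u = (majorant lam (r ^+ m))%:K -> ~ le_dist_bdry `|u| (harm h g).
  move=> -> /(_ _ halfplane_map_bdry).
  rewrite harmE /h /halfplane_map mul0r subr0 !NE leC_real !Nreal normrN.
  move=> H; have : majorant lam (r ^+ m) <= 1 / 2.
    by apply: le_trans (ler_norm _) _; apply: le_trans H _; rewrite ger0_norm.
  by rewrite leNgt big.
by split; apply: key; [rewrite -c1|rewrite -c2]; rewrite /comb_D /comb_Dscr rmorphXn.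
Qed.

End Sharpness.

Theorem theorem4p2 (R : realType) (m : nat) (lam : R) :
  (0 < m)%N -> 0 <= lam <= 1 ->
  (* r_{6,m} exists and is the unique root in (0,1) *)
  (exists r : R, 0 < r < 1 /\ r6_fun lam m r = 0) /\
  (forall r1 r2 : R, 0 < r1 < 1 -> 0 < r2 < 1 ->
     r6_fun lam m r1 = 0 -> r6_fun lam m r2 = 0 -> r1 = r2) /\
  (forall r6 : R, 0 < r6 < 1 -> r6_fun lam m r6 = 0 ->
    (* the inequalities hold for |z| <= r_{6,m} *)
    (forall (h g w : C R -> C R) (z : C R),
       in_SH0 h g -> stable_convex h g -> in_B m w -> `|z| <= RtoC r6 ->
       le_dist_bdry `|comb_D lam h g w z| (harm h g) /\
       le_dist_bdry `|comb_Dscr lam h g w z| (harm h g)) /\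
    (* sharpness for the first inequality *)
    (forall r : R, r6 < r < 1 ->
       exists (h g w : C R -> C R) (z : C R),
         [/\ in_SH0 h g, stable_convex h g, in_B m w, `|z| = RtoC r &
             ~ le_dist_bdry `|comb_D lam h g w z| (harm h g)]) /\
    (* sharpness for the second inequality *)
    (forall r : R, r6 < r < 1 ->
       exists (h g w : C R -> C R) (z : C R),
         [/\ in_SH0 h g, stable_convex h g, in_B m w, `|z| = RtoC r &
             ~ le_dist_bdry `|comb_Dscr lam h g w z| (harm h g)])).
Proof.
move=> m0 l01; have /andP[l0 l1] := l01.
split; [|split].
- have [x [x01 xE]] := majorant_root l0; have [r [r01 rE]] := nth_root_exists m0 x01.
  by exists r; split => //; apply/r6_fun_eq0; rewrite rE.
- have lt_majorant (r s : R) : 0 < r < 1 -> 0 < s < 1 -> r < s ->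
  majorant lam (r ^+ m) < majorant lam (s ^+ m).
    move=> /andP[r0 r1] /andP[s0 s1] rs; apply: majorant_lt => //.
    + by rewrite exprn_ge0// ltW.
    + by rewrite ltr_pXn2r// nnegrE ltW.
    + by rewrite exprn_ilt1// ?ltW// -lt0n.
  move=> r1 r2 r11 r21 /r6_fun_eq0 e1 /r6_fun_eq0 e2.
  case: (ltgtP r1 r2) => // /lt_majorant; rewrite e1 e2 ltxx => H.
    by have := H r11 r21.
  by have := H r21 r11.
- move=> r6 r601 r6E; split; [|split].
  + by move=> h g w z; exact: radius_bound.
  + move=> r r1; have [h [g [w [z [[? ? ? ?] [? _]]]]]] := sharp m0 l01 r601 r6E r1.
    by exists h, g, w, z.
  + move=> r r1; have [h [g [w [z [[? ? ? ?] [_ ?]]]]]] := sharp m0 l01 r601 r6E r1.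
    by exists h, g, w, z.
Qed.
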